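(* Let $\mathcal I$ be a non-trivial ideal in $\mathbb C[[x,y]]$ and $\omega=x^{\nu-1}dx\wedge dy$ with $\nu\in\mathbb N^*$; if $\mathcal I$ is not divisible by $x$, assume $\nu=1$. Then, with the notation of the context, $$\zeta(\mathcal I,\omega)(T)=\sum_{\Delta}(\mathbb L-1)^2 D_\Delta\,\frac{1}{(1-\mathbb L^{-(p_1\nu+q_1)}T^{N_1})(1-\mathbb L^{-(p_2\nu+q_2)}T^{N_2})}$$ $$+\sum_{L}(\mathbb L-1)(\mathbb L-r-1)\frac{\mathbb L^{-(p\nu+q)}T^N}{1-\mathbb L^{-(p\nu+q)}T^N}+\sum_{L}\sum_{\mu}\zeta(\mathcal I_{\sigma_{(p,q,\mu)}},\omega_1)(T),$$ where $\Delta$ runs over the two-dimensional cones and $L$ over the one-dimensional cones (corresponding to the compact faces) of the dual decomposition determined by the Newton diagram of $\mathcal I$; $r$ is the number of distinct roots of the face polynomial of the face corresponding to $L$; $\mu$ ranges over these distinct roots; and $\omega_1=x_1^{p\nu+q-1}dx_1\wedge dy_1$.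
   Context: Newton diagram. For $f=\sum c_{\alpha,\beta}x^\alpha y^\beta$ let $\operatorname{Supp}f=\{(\alpha,\beta):c_{\alpha,\beta}\ne0\}$. For $\mathcal I=(f_1,\dots,f_r)$ the Newton diagram $\Delta(\mathcal I)$ is the smallest convex set containing $\bigcup_i\operatorname{Supp}f_i+\mathbb R_+^2$ (it is independent of the generators). Let its vertices be $v_i=(\alpha_i,\beta_i)$, $0\le i\le m$, with $\alpha_{i-1}<\alpha_i$, $\beta_{i-1}>\beta_i$. The compact faces are $S_i=[v_{i-1},v_i]$, $1\le i\le m$ (there may be none); the supporting line of a compact face $S$ has equation $p\alpha+q\beta=N$ with $p,q\ge1$ coprime. There are two non-compact faces: the vertical half-line $\alpha=\alpha_0$ from $v_0$ (with $(p,q)=(1,0)$, $N=\alpha_0$) and the horizontal half-line $\beta=\beta_m$ from $v_m$ (with $(p,q)=(0,1)$, $N=\beta_m$). Face polynomial. For a compact face $S$ with line $l_S$, $\operatorname{in}(\mathcal I,S)$ is the ideal generated by the $\operatorname{in}(f_i,l_S)=\sum_{(\alpha,\beta)\in l_S}c_{\alpha,\beta}x^\alpha y^\beta$. It can be written $x^{a_S}y^{b_S}F_{\mathcal I,S}(x^{q},y^{p})\,(k_1(x^{q},y^{p}),\dots,k_s(x^{q},y^{p}))$ with $F_{\mathcal I,S}$ a homogeneous polynomial, monic in $y$, not divisible by $x$ or $y$, and either $s=1$, $k_1=1$, or $s\ge2$ and $k_1,\dots,k_s$ coprime homogeneous of the same degree $d_S\ge1$. $F_{\mathcal I,S}$ is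 the face polynomial; its roots are the $\mu\in\mathbb C^*$ with $F_{\mathcal I,S}(1,\mu)=0$. Newton maps. For coprime $p,q\ge1$ take $(p',q')\in\mathbb N^2$ with $pp'-qq'=1$, $p'\le q$, $q'<p$. For $\mu\in\mathbb C^*$, $\sigma_{(p,q,\mu)}:\mathbb C[[x,y]]\to\mathbb C[[x_1,y_1]]$, $f(x,y)\mapsto f(\mu^{q'}x_1^p,\,x_1^q(y_1+\mu^{p'}))$, and $\mathcal I_{\sigma}$ is the ideal generated by the image $\sigma(\mathcal I)$. Dual cones. A face with equation $p\alpha+q\beta=N$ gives the half-line generated by $(p,q)$ in the dual plane. This decomposes the open positive quadrant into one-dimensional open cones $L$ (one for each compact face, generated by the corresponding $(p,q)$) and two-dimensional open cones $\Delta$, each generated by the vectors $(p_1,q_1),(p_2,q_2)$ of two consecutive (compact or non-compact) faces with equations $p_1\alpha+q_1\beta=N_1$, $p_2\alpha+q_2\beta=N_2$, meeting in the vertex $(a,b)$ of the Newton diagram. Put $$\mathcal P_\Delta=\{(i,j)\in\mathbb N^2: (i,j)=\mu_1(p_1,q_1)+\mu_2(p_2,q_2),\ \mu_1,\mu_2\in\mathbb Q,\ 0<\mu_1\le1,\ 0<\mu_2\le1\},$$ $$D_\Delta=\sum_{(i,j)\in\mathcal P_\Delta}\mathbb L^{-(\nu i+j)}T^{ia+jb}.$$ Motivic zeta function. $\mathcal G$ is the Grothendieck ring of complex algebraic varieties, $\mathbb L=[\mathbb A^1_{\mathbb C}]$, $\mathcal G_{loc}=\mathcal G[\mathbb L^{-1}]$.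 $\mathcal L^0(\mathbb C^2)$ is the set of arcs at the origin, i.e. pairs $\phi=(x(t),y(t))\in (t\mathbb C[[t]])^2$; $\pi_n$ is truncation modulo $t^{n+1}$. A cylinder is $A=\pi_n^{-1}(C)$ with $C$ a constructible set of $n$-jets at the origin, with motivic measure $\mu(A)=[C]\mathbb L^{-2n}$. Put $\operatorname{ord}_\phi\mathcal I=\min\{\operatorname{ord}_t(f\circ\phi):f\in\mathcal I\}$ and $\operatorname{ord}(\omega\circ\phi)=(\nu-1)\operatorname{ord}_t x(t)$ (equal to $0$ if $\nu=1$). Let $V_{n,m}=\{\phi\in\mathcal L^0(\mathbb C^2):\operatorname{ord}_\phi\mathcal I=n,\ \operatorname{ord}(\omega\circ\phi)=m\}$ and $$\zeta(\mathcal I,\omega)(T)=\sum_{n\ge1}\Big(\sum_{m\ge0}\mu(V_{n,m})\mathbb L^{-m}\Big)T^n\in\mathcal G_{loc}[[T]]$$ (for each $n$ the sum over $m$ is finite). The formula is understood with coefficients in the further localization of $\mathcal G_{loc}$ with respect to the elements $1-\mathbb L^{-a}$, $a\in\mathbb Z\setminus\{0\}$. *)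

(* Defs.v *)
From HB Require Import structures.
From mathcomp Require Import all_boot all_order all_algebra.
From mathcomp Require Import finmap generic_quotient complex.
From mathcomp Require Import boolp classical_sets functions cardinality fsbigop.
From mathcomp Require Import reals convex.
From mathcomp Require Import mpoly.

Set Implicit Arguments.
Unset Strict Implicit.
Unset Printing Implicit Defensive.

Import Order.TTheory GRing.Theory Num.Theory.
Local Open Scope quotient_scope.
Local Open Scope classical_set_scope.
Local Open Scope ring_scope.

Record fps (R : Type) := Fps { coef : nat -> R }.
Arguments Fps {R}.

HB.instance Definition _ (R : Type) := gen_eqMixin (fps R).
HB.instance Definition _ (R : Type) := gen_choiceMixin (fps R).

Lemma fpsP (R : Type) (f g : fps R) : coef f =1 coef g -> f = g.
Proof. by case: f g => f [g] /= /funext ->. Qed.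

Section FpsRing.
Variable R : comPzRingType.
Implicit Types f g h : fps R.

Definition fps_zero : fps R := Fps (fun _ => 0).
Definition fps_opp f : fps R := Fps (fun n => - coef f n).
Definition fps_add f g : fps R := Fps (fun n => coef f n + coef g n).
Definition fps_one : fps R := Fps (fun n => (n == 0%N)%:R).
Definition fps_mul f g : fps R :=
  Fps (fun n => \sum_(i < n.+1) coef f i * coef g (n - i)%N).

Let addA : associative fps_add.
Proof. by move=> f g h; apply: fpsP => n /=; rewrite addrA. Qed.
Let addC : commutative fps_add.
Proof. by move=> f g; apply: fpsP => n /=; rewrite addrC. Qed.
Let add0 : left_id fps_zero fps_add.
Proof. by move=> f; apply: fpsP => n /=; rewrite add0r. Qed.
Let addN : left_inverse fps_zero fps_opp fps_add.
Proof. by move=> f; apply: fpsP => n /=; rewrite addNr. Qed.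

HB.instance Definition _ := GRing.isZmodule.Build (fps R) addA addC add0 addN.

Let mulC : commutative fps_mul.
Proof.
move=> f g; apply: fpsP => n /=.
rewrite (reindex_inj rev_ord_inj) /=; apply: eq_bigr => i _.
by rewrite mulrC subSS subKn // -ltnS.
Qed.

Let mulA : associative fps_mul.
Proof.
move=> f g h; rewrite [RHS]mulC; apply: fpsP => n /=.
pose c3 i j := coef f i * (coef g (n - i - j)%N * coef h j).
transitivity (\sum_(i < n.+1) \sum_(j < n.+1 | (j <= n - i)%N) c3 i j).
  apply: eq_bigr => /= i _.
  have -> : \sum_(j < (n - i).+1) coef g j * coef h (n - i - j)%N =
      coef (fps_mul h g) (n - i)%N by rewrite mulC.
  rewrite /= big_distrr /= (big_ord_narrow_leq (leq_subr _ _)).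
  by apply: eq_bigr => j _; rewrite /c3 [coef h _ * _]mulrC.
rewrite (exchange_big_dep predT) //=; apply: eq_bigr => j _.
transitivity (\sum_(i < n.+1 | (i <= n - j)%N) c3 i j).
  apply: eq_bigl => i; rewrite -ltnS -(ltnS i) -!subSn ?leq_ord //.
  by rewrite -subn_gt0 -(subn_gt0 i) -!subnDA addnC.
rewrite (big_ord_narrow_leq (leq_subr _ _)) big_distrr /=.
by apply: eq_bigr => i _; rewrite /c3 -!subnDA addnC mulrA mulrC.
Qed.

Let mul1 : left_id fps_one fps_mul.
Proof.
move=> f; apply: fpsP => n /=; rewrite big_ord_recl /= mul1r subn0.
by rewrite big1 ?addr0 // => i _; rewrite mul0r.
Qed.

Let mulD : left_distributive fps_mul fps_add.
Proof.
move=> f g h; apply: fpsP => n /=; rewrite -big_split /=.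
by apply: eq_bigr => i _; rewrite mulrDl.
Qed.

HB.instance Definition _ :=
  GRing.Zmodule_isComPzRing.Build (fps R) mulA mulC mul1 mulD.

Definition fps_term (c : R) (n : nat) : fps R :=
  Fps (fun m => if m == n then c else 0).

(** [None] stands for infinity. *)
Definition order f : option nat :=
  if pselect (exists n, coef f n != 0) is left ex then Some (ex_minn ex)
  else None.

End FpsRing.

Definition map_fps (R S : Type) (h : R -> S) (f : fps R) : fps S :=
  Fps (fun n => h (coef f n)).

(** The ring k[[x,y]]: [coef (coef f a) b] is the coefficient of x^a y^b. *)
Notation fps2 k := (fps (fps k)).

(** Substitution x := u, y := v, where u and v have no constant term and the
    coefficients are mapped by [io]: terms with a > n or b > n do not contribute
    to the coefficient of degree n. *)
Definition subst2 (k A : comPzRingType) (io : k -> A) (u v : fps A)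
    (f : fps2 k) : fps A :=
  Fps (fun n => \sum_(a < n.+1) \sum_(b < n.+1)
         io (coef (coef f a) b) * coef (u ^+ a * v ^+ b) n).

Definition is_ideal (A : comPzRingType) (J : set A) : Prop :=
  [/\ J 0, forall a b, J a -> J b -> J (a + b) & forall a b, J b -> J (a * b)].

Definition ideal_gen (A : comPzRingType) (G : set A) : set A :=
  smallest (@is_ideal A) G.

(** The inverse of an invertible element of a (possibly zero) commutative ring;
    by convention 0 on the other elements. *)
Definition cinv (A : comPzRingType) (a : A) : A := xget 0 [set b | a * b = 1].

Inductive rterm (X : Type) : Type :=
| TVar of X | TZero | TOne
| TOpp of rterm X | TAdd of rterm X & rterm X | TMul of rterm X & rterm X.
Arguments TZero {X}.
Arguments TOne {X}.

HB.instance Definition _ (X : Type) := gen_eqMixin (rterm X).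
HB.instance Definition _ (X : Type) := gen_choiceMixin (rterm X).

Section Presented.
Variables (X : Type) (rel : rterm X -> rterm X -> Prop).

Inductive rcong : rterm X -> rterm X -> Prop :=
| RC_rel s t : rel s t -> rcong s t
| RC_refl s : rcong s s
| RC_sym s t : rcong s t -> rcong t s
| RC_trans s t u : rcong s t -> rcong t u -> rcong s u
| RC_opp s s' : rcong s s' -> rcong (TOpp s) (TOpp s')
| RC_add s s' t t' : rcong s s' -> rcong t t' -> rcong (TAdd s t) (TAdd s' t')
| RC_mul s s' t t' : rcong s s' -> rcong t t' -> rcong (TMul s t) (TMul s' t')
| RC_addA s t u : rcong (TAdd s (TAdd t u)) (TAdd (TAdd s t) u)
| RC_addC s t : rcong (TAdd s t) (TAdd t s)
| RC_add0 s : rcong (TAdd TZero s) s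
| RC_addN s : rcong (TAdd (TOpp s) s) TZero
| RC_mulA s t u : rcong (TMul s (TMul t u)) (TMul (TMul s t) u)
| RC_mulC s t : rcong (TMul s t) (TMul t s)
| RC_mul1 s : rcong (TMul TOne s) s
| RC_mulD s t u : rcong (TMul (TAdd s t) u) (TAdd (TMul s u) (TMul t u)).

Definition rcongb (s t : rterm X) : bool := `[< rcong s t >].

Lemma rcongb_equiv : equiv_class_of rcongb.
Proof.
split=> [s|s t|t s u]; first by apply/asboolP; exact: RC_refl.
- by apply/idP/idP => /asboolP /RC_sym h; apply/asboolP.
- by move=> /asboolP st /asboolP tu; apply/asboolP; exact: RC_trans tu.
Qed.

Canonical rcong_equiv := EquivRelPack rcongb_equiv.

Definition presented := {eq_quot rcong_equiv}.

HB.instance Definition _ := Choice.on presented.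
HB.instance Definition _ := EqQuotient.on presented.

Definition pres (s : rterm X) : presented := \pi_presented s.

Lemma pres_eq s t : rcong s t -> pres s = pres t.
Proof. by move=> st; apply/eqmodP/asboolP. Qed.

Lemma pres_repr (a : presented) : pres (repr a) = a.
Proof. exact: reprK. Qed.

Lemma repr_pres s : rcong (repr (pres s)) s.
Proof.
have /eqmodP : repr (pres s) = s %[mod presented] by rewrite reprK.
by move/asboolP.
Qed.

Definition pres_opp (a : presented) := pres (TOpp (repr a)).
Definition pres_add (a b : presented) := pres (TAdd (repr a) (repr b)).
Definition pres_mul (a b : presented) := pres (TMul (repr a) (repr b)).

Lemma pres_oppE s : pres_opp (pres s) = pres (TOpp s).
Proof. by apply: pres_eq; apply: RC_opp; exact: repr_pres. Qed.
Lemma pres_addE s t : pres_add (pres s) (pres t) = pres (TAdd s t).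
Proof. by apply: pres_eq; apply: RC_add; exact: repr_pres. Qed.
Lemma pres_mulE s t : pres_mul (pres s) (pres t) = pres (TMul s t).
Proof. by apply: pres_eq; apply: RC_mul; exact: repr_pres. Qed.

Let addA : associative pres_add.
Proof.
move=> a b c; rewrite -[a]pres_repr -[b]pres_repr -[c]pres_repr !pres_addE.
by apply: pres_eq; exact: RC_addA.
Qed.
Let addC : commutative pres_add.
Proof. by move=> a b; apply: pres_eq; exact: RC_addC. Qed.
Let add0 : left_id (pres TZero) pres_add.
Proof.
by move=> a; rewrite -[a]pres_repr pres_addE; apply: pres_eq; exact: RC_add0.
Qed.
Let addN : left_inverse (pres TZero) pres_opp pres_add.
Proof.
move=> a; rewrite -[a]pres_repr pres_oppE pres_addE.
by apply: pres_eq; exact: RC_addN.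
Qed.

HB.instance Definition _ := GRing.isZmodule.Build presented addA addC add0 addN.

Let mulA : associative pres_mul.
Proof.
move=> a b c; rewrite -[a]pres_repr -[b]pres_repr -[c]pres_repr !pres_mulE.
by apply: pres_eq; exact: RC_mulA.
Qed.
Let mulC : commutative pres_mul.
Proof. by move=> a b; apply: pres_eq; exact: RC_mulC. Qed.
Let mul1 : left_id (pres TOne) pres_mul.
Proof.
by move=> a; rewrite -[a]pres_repr pres_mulE; apply: pres_eq; exact: RC_mul1.
Qed.
Let mulD : left_distributive pres_mul pres_add.
Proof.
move=> a b c; rewrite -[a]pres_repr -[b]pres_repr -[c]pres_repr.
rewrite (pres_addE (repr a)) !(pres_mulE _ (repr c)) pres_addE.
by apply: pres_eq; exact: RC_mulD.
Qed.

HB.instance Definition _ :=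
  GRing.Zmodule_isComPzRing.Build presented mulA mulC mul1 mulD.

Definition pgen (x : X) : presented := pres (TVar x).

End Presented.

(** The localization A[S^-1] is generated by the elements of A and by formal
    inverses of the elements of S. *)
Section Localization.
Variables (A : comPzRingType) (S : set A).

Inductive locgen : Type := LocElt of A | LocInv of {s : A | S s}.

Inductive locrel : rterm locgen -> rterm locgen -> Prop :=
| LR_add a b :
    locrel (TVar (LocElt (a + b))) (TAdd (TVar (LocElt a)) (TVar (LocElt b)))
| LR_mul a b :
    locrel (TVar (LocElt (a * b))) (TMul (TVar (LocElt a)) (TVar (LocElt b)))
| LR_one : locrel (TVar (LocElt 1)) TOne
| LR_inv (s : {s : A | S s}) :
    locrel (TMul (TVar (LocElt (proj1_sig s))) (TVar (LocInv s))) TOne.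

Definition localization : comPzRingType := presented locrel.

Definition to_loc (a : A) : localization := pgen locrel (LocElt a).

End Localization.

Section Varieties.
Variable k : fieldType.

(** A set with a family of open subsets and, for each open U, the set of
    regular functions on U (only the values on U are relevant). *)
Record fspace := FSpace {
  pt : Type;
  zopen : set (set pt);
  reg : set pt -> set (pt -> k)
}.

Definition is_space (X : fspace) : Prop :=
  [/\ zopen [set: pt X],
      forall U V : set (pt X), zopen U -> zopen V -> zopen (U `&` V),
      forall F : set (set (pt X)), F `<=` @zopen X -> zopen (\bigcup_(U in F) U),
      forall (U V : set (pt X)) f g, zopen U -> zopen V -> V `<=` U ->
        reg U f -> (forall x, V x -> g x = f x) -> reg V g &
      forall (U : set (pt X)) f, zopen U ->
        (forall x, U x -> exists V, [/\ zopen V, V x, V `<=` U & reg V f]) ->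
        reg U f].

Definition is_morphism (X Y : fspace) (h : pt X -> pt Y) : Prop :=
  forall V : set (pt Y), zopen V ->
    zopen (h @^-1` V) /\ forall g, reg V g -> reg (h @^-1` V) (g \o h).

Definition isomorphic (X Y : fspace) : Prop :=
  exists (h : pt X -> pt Y) (h' : pt Y -> pt X),
    [/\ cancel h h', cancel h' h, is_morphism h & is_morphism h'].

(** The structure induced on a subset: traces of open sets, and functions that
    locally extend to regular functions. *)
Definition induced (X : fspace) (Z : set (pt X)) : fspace := {|
  pt := {x : pt X | Z x};
  zopen := [set V | exists2 U : set (pt X), zopen U &
                    V = [set x | U (proj1_sig x)]];
  reg V := [set f | forall x, V x -> exists (U : set (pt X)) (g : pt X -> k),
              [/\ zopen U, U (proj1_sig x), reg U g &
                  forall y, V y -> U (proj1_sig y) -> f y = g (proj1_sig y)]]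
|}.

(** The product: its topology is generated by the non-vanishing loci of the
    functions sum_i f_i(x) g_i(y), and regular functions are locally quotients
    of such functions. *)
Section Product.
Variables X Y : fspace.

Definition tensor_eval (s : seq ((pt X -> k) * (pt Y -> k))) (z : pt X * pt Y) :=
  \sum_(fg <- s) fg.1 z.1 * fg.2 z.2.

Definition tensor_on (U : set (pt X)) (V : set (pt Y))
    (s : seq ((pt X -> k) * (pt Y -> k))) : Prop :=
  forall i : 'I_(size s), reg U (tnth (in_tuple s) i).1 /\
                          reg V (tnth (in_tuple s) i).2.

Definition tensor_locus U V s : set (pt X * pt Y) :=
  [set z | [/\ U z.1, V z.2 & tensor_eval s z != 0]].

Definition prod_space : fspace := {|
  pt := (pt X * pt Y)%type;
  zopen := [set W | forall z, W z -> exists U V s,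
              [/\ zopen U, zopen V, tensor_on U V s, tensor_locus U V s z &
                  tensor_locus U V s `<=` W]];
  reg W := [set f | forall z, W z -> exists U V s s',
              [/\ zopen U, zopen V, tensor_on U V s /\ tensor_on U V s',
                  tensor_locus U V s' z &
                  forall z', W z' -> tensor_locus U V s' z' ->
                    f z' = tensor_eval s z' / tensor_eval s' z']]
|}.

End Product.

Definition affpt (n : nat) := 'I_n -> k.

Definition zeros (n : nat) (ps : seq {mpoly k[n]}) : set (affpt n) :=
  [set x | forall p, p \in ps -> p.@[x] = 0].

(** Affine n-space with the Zariski topology; regular functions are locally
    quotients of polynomials. *)
Definition affine_space (n : nat) : fspace := {|
  pt := affpt n;
  zopen := [set U | forall x, U x -> exists2 p : {mpoly k[n]},
              p.@[x] != 0 & [set y | p.@[y] != 0] `<=` U];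
  reg U := [set f | forall x, U x -> exists p q : {mpoly k[n]},
              q.@[x] != 0 /\
              forall y, U y -> q.@[y] != 0 ->
                f y = p.@[y] / q.@[y]]
|}.

Definition is_affine (X : fspace) : Prop :=
  exists n (ps : seq {mpoly k[n]}),
    isomorphic X (@induced (affine_space n) (zeros ps)).

(** Varieties (possibly reducible, possibly empty): separated spaces with
    functions having a finite affine open cover. *)
Definition is_variety (X : fspace) : Prop :=
  [/\ is_space X,
      exists r (U : 'I_r -> set (pt X)),
        [/\ forall i, zopen (U i), forall x, exists i, U i x &
            forall i, is_affine (induced (U i))] &
      @zopen (prod_space X X) [set z | z.1 <> z.2]].

(** The collection of all varieties has to be small in order to generate a ring.
    Up to isomorphism the underlying set of a variety is a subset of the set of
    finite sequences of scalars: a variety is a finite union of affine pieces. *)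
Record variety := Variety {
  vset : set (seq k);
  vopen : set (set {x : seq k | vset x});
  vreg : set {x : seq k | vset x} -> set ({x : seq k | vset x} -> k);
  varietyP : is_variety (FSpace vopen vreg)
}.

Definition vspace (V : variety) : fspace := FSpace (@vopen V) (@vreg V).

Inductive vrel : rterm variety -> rterm variety -> Prop :=
| VR_iso V W : isomorphic (vspace V) (vspace W) -> vrel (TVar V) (TVar W)
| VR_cut X V W (Z : set (pt (vspace X))) : zopen (~` Z) ->
    isomorphic (vspace V) (induced Z) ->
    isomorphic (vspace W) (induced (~` Z)) ->
    vrel (TVar X) (TAdd (TVar V) (TVar W))
| VR_prod V W P :
    isomorphic (vspace P) (prod_space (vspace V) (vspace W)) ->
    vrel (TVar P) (TMul (TVar V) (TVar W))
| VR_pt P : isomorphic (vspace P) (affine_space 0) -> vrel (TVar P) TOne.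

Definition Groth : comPzRingType := presented vrel.

(** The class [X] of a space with functions X that is a variety. *)
Definition vclass (X : fspace) : Groth :=
  xget 0 [set v | exists2 V : variety, isomorphic (vspace V) X &
                  v = pgen vrel V].

Definition locally_closed (n : nat) (S : set (affpt n)) : Prop :=
  exists ps qs : seq {mpoly k[n]}, S = zeros ps `\` zeros qs.

Definition constructible (n : nat) (C : set (affpt n)) : Prop :=
  exists r (S : 'I_r -> set (affpt n)),
    (forall i, locally_closed (S i)) /\ C = \bigcup_i S i.

(** [C] is the sum of the classes of the pieces of any partition of C into
    locally closed subsets. *)
Definition cclass (n : nat) (C : set (affpt n)) : Groth :=
  xget 0 [set v | exists r (S : 'I_r -> set (affpt n)),
    [/\ forall i, locally_closed (S i), trivIset setT S, C = \bigcup_i S i &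
        v = \sum_i vclass (@induced (affine_space n) (S i))]].

Definition Lef : Groth := vclass (affine_space 1).

Definition Gloc : comPzRingType := @localization Groth [set Lef].

Definition Lloc : Gloc := to_loc [set Lef] Lef.

Definition Lpow (a : int) : Gloc :=
  match a with Posz n => Lloc ^+ n | Negz n => cinv Lloc ^+ n.+1 end.

Definition denoms : set Gloc :=
  [set s | exists2 a : int, a != 0 & s = 1 - Lpow (- a)].

Definition Mloc : comPzRingType := @localization Gloc denoms.

Definition toM : Gloc -> Mloc := to_loc denoms.

Definition arc := (fps k * fps k)%type.

Definition arcs0 : set arc := [set phi | coef phi.1 0 = 0 /\ coef phi.2 0 = 0].

(** An n-jet at the origin is given by the coefficients of t, ..., t^n in x(t)
    and y(t). *)
Definition jet (n : nat) (phi : arc) : affpt (n + n) :=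
  fun i => match fintype.split i with
           | inl j => coef phi.1 j.+1
           | inr j => coef phi.2 j.+1
           end.

Definition cylinder (n : nat) (C : set (affpt (n + n))) : set arc :=
  arcs0 `&` [set phi | C (jet phi)].

Definition motmeas (A : set arc) : Gloc :=
  xget 0 [set v | exists n (C : set (affpt (n + n))),
    [/\ constructible C, A = cylinder C &
        v = to_loc [set Lef] (cclass C) * Lpow (- (2 * n)%N%:Z)]].

(** The minimum of ord_t (f o phi), for f in I, is n. *)
Definition ord_ideal (I : set (fps2 k)) (phi : arc) (n : nat) : Prop :=
  (exists2 f, I f & order (subst2 id phi.1 phi.2 f) = Some n) /\
  (forall f m, I f -> order (subst2 id phi.1 phi.2 f) = Some m -> (n <= m)%N).

(** Order along phi of the form x^(nu-1) dx /\ dy; it is 0 for nu = 1 even when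
    x(t) = 0. *)
Definition ord_form (nu : nat) (phi : arc) : option nat :=
  if nu == 1%N then Some 0%N else omap (muln nu.-1) (order phi.1).

Definition Vset (I : set (fps2 k)) (nu n m : nat) : set arc :=
  [set phi | [/\ arcs0 phi, ord_ideal I phi n & ord_form nu phi = Some m]].

Definition zeta (I : set (fps2 k)) (nu : nat) : fps Gloc :=
  Fps (fun n => if n is 0 then 0
    else \sum_(m \in [set: nat]) motmeas (Vset I nu n m) * Lpow (- m%:Z)).

Definition newton_exps (p q : nat) : nat * nat :=
  xget (0, 0)%N [set e : nat * nat |
    [/\ (p * e.1 = q * e.2 + 1)%N, (e.1 <= q)%N & (e.2 < p)%N]].

(** x := mu^q' x1^p, y := x1^q (y1 + mu^p') *)
Definition newton_map (p q : nat) (mu : k) : fps2 k -> fps2 k :=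
  let e := newton_exps p q in
  subst2 (fun c => fps_term c 0)
    (fps_term (fps_term (mu ^+ e.2) 0) p)
    (fps_term (fps_term 1 1 + fps_term (mu ^+ e.1) 0) q).

Definition newton_ideal (I : set (fps2 k)) (p q : nat) (mu : k) : set (fps2 k) :=
  ideal_gen (newton_map p q mu @` I).

Definition supp (f : fps2 k) : set (nat * nat) :=
  [set ab | coef (coef f ab.1) ab.2 != 0].

Section NewtonDiagram.
Variable R : realType.

Definition newton_diagram (fs : seq (fps2 k)) : set (R^o * R^o) :=
  smallest (@convex_set R (R^o * R^o)%type)
    [set z | exists f (ab : nat * nat) (u v : R),
       [/\ f \in fs, supp f ab, 0 <= u, 0 <= v &
           z = (ab.1%:R + u, ab.2%:R + v)]].

Definition is_vertex (D : set (R^o * R^o)) (z : R^o * R^o) : Prop :=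
  D z /\ forall (a b : R^o * R^o) (t : R), D a -> D b -> 0 < t -> t < 1 ->
           z = t *: a + (1 - t) *: b -> a = b.

Definition newton_vertices (fs : seq (fps2 k)) : seq (nat * nat) :=
  xget [::] [set vs |
    sorted (fun u v => (u.1 < v.1) && (v.2 < u.2))%N vs /\
    is_vertex (newton_diagram fs) =
      [set z | exists2 v, v \in vs & z = (v.1%:R, v.2%:R)]].

End NewtonDiagram.

(** The face p alpha + q beta = N. *)
Record face := Face { fp : nat; fq : nat; fN : nat }.

Definition compact_face (u v : nat * nat) : face :=
  let g := gcdn (u.2 - v.2) (v.1 - u.1) in
  let p := ((u.2 - v.2) %/ g)%N in
  let q := ((v.1 - u.1) %/ g)%N in
  Face p q (p * u.1 + q * u.2).

Definition compact_faces (vs : seq (nat * nat)) : seq face :=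
  [seq compact_face (nth (0, 0)%N vs i) (nth (0, 0)%N vs i.+1)
     | i <- iota 0 (size vs).-1].

(** All faces: the vertical one, the compact ones, the horizontal one.  The
    i-th and (i+1)-st faces meet in the vertex v_i. *)
Definition faces (vs : seq (nat * nat)) : seq face :=
  Face 1 0 (head (0, 0)%N vs).1 ::
  rcons (compact_faces vs) (Face 0 1 (last (0, 0)%N vs).2).

(** Polynomials in x and y are elements of [{poly {poly k}}], the outer variable
    being y. *)

Definition mono2 (c : k) (a b : nat) : {poly {poly k}} :=
  (c *: 'X^a)%:P * 'X^b.

(** The part of f supported by the line of a compact face; on it a, b <= N. *)
Definition initial (S : face) (f : fps2 k) : {poly {poly k}} :=
  \sum_(a < (fN S).+1) \sum_(b < (fN S).+1 |
      (fp S * a + fq S * b == fN S)%N) mono2 (coef (coef f a) b) a b.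

(** F(x^q, y^p) *)
Definition subst_pow (q p : nat) (F : {poly {poly k}}) : {poly {poly k}} :=
  (map_poly (comp_poly 'X^q) F) \Po 'X^p.

Definition homogeneous (d : nat) (F : {poly {poly k}}) : Prop :=
  forall a b, F`_b`_a != 0 -> (a + b)%N = d.

Definition divides (F G : {poly {poly k}}) : Prop := exists H, G = F * H.

Definition coprime_polys (ks : seq {poly {poly k}}) : Prop :=
  forall F, (forall K, K \in ks -> divides F K) -> F \is a GRing.unit.

Definition is_face_poly (fs : seq (fps2 k)) (S : face) (F : {poly {poly k}}) :
    Prop :=
  exists (a b : nat) (ks : seq {poly {poly k}}),
    [/\ ideal_gen [set initial S f | f in [set` fs]] =
        ideal_gen [set mono2 1 a b * subst_pow (fq S) (fp S) F
                         * subst_pow (fq S) (fp S) K | K in [set` ks]],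
        (exists e, homogeneous e F) /\ F \is monic,
        ~ divides ('X%:P) F /\ ~ divides 'X F &
        ks = [:: 1] \/
        [/\ (2 <= size ks)%N, 0 \notin ks, coprime_polys ks &
            exists2 d, (1 <= d)%N & forall K, K \in ks -> homogeneous d K]].

Definition face_poly (fs : seq (fps2 k)) (S : face) : {poly {poly k}} :=
  xget 0 (is_face_poly fs S).

Definition face_roots (fs : seq (fps2 k)) (S : face) : set k :=
  [set mu | mu != 0 /\ (map_poly (horner_eval 1) (face_poly fs S)).[mu] = 0].

Definition cone_points (F1 F2 : face) : set (nat * nat) :=
  [set ij | exists m1 m2 : rat,
     [/\ 0 < m1 <= 1, 0 < m2 <= 1,
         ij.1%:R = m1 * (fp F1)%:R + m2 * (fp F2)%:R &
         ij.2%:R = m1 * (fq F1)%:R + m2 * (fq F2)%:R]].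

Definition LT (e N : nat) : fps Mloc := fps_term (toM (Lpow (- e%:Z))) N.

Definition Lc : fps Mloc := fps_term (toM Lloc) 0.

Definition Dcone (nu : nat) (F1 F2 : face) (v : nat * nat) : fps Mloc :=
  \sum_(ij \in cone_points F1 F2)
    LT (nu * ij.1 + ij.2) (ij.1 * v.1 + ij.2 * v.2).

Definition cone_term (nu : nat) (F1 F2 : face) (v : nat * nat) : fps Mloc :=
  (Lc - 1) ^+ 2 * Dcone nu F1 F2 v *
  cinv ((1 - LT (fp F1 * nu + fq F1) (fN F1)) *
        (1 - LT (fp F2 * nu + fq F2) (fN F2))).

Definition face_term (nu r : nat) (S : face) : fps Mloc :=
  (Lc - 1) * (Lc - r%:R - 1) * LT (fp S * nu + fq S) (fN S) *
  cinv (1 - LT (fp S * nu + fq S) (fN S)).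

End Varieties.

(* Main.v *)
From HB Require Import structures.
From mathcomp Require Import all_boot all_order all_algebra.
From mathcomp Require Import finmap complex ring lra zify.
From mathcomp Require Import boolp classical_sets cardinality fsbigop.
From mathcomp Require Import reals convex interval_inference.
From mathcomp Require Import mpoly.
Require Import Defs.

Set Implicit Arguments.
Unset Strict Implicit.
Unset Printing Implicit Defensive.

Import Order.TTheory GRing.Theory Num.Theory.
Local Open Scope classical_set_scope.
Local Open Scope ring_scope.

(** Arcs of order n along the ideal are sorted by the pair (i, j) of orders of x(t) and
    y(t).  If (i, j) lies in the open cone dual to a vertex (a, b), the order along the
    ideal is ia + jb, attained only by the monomial x^a y^b, so that these arcs
    contribute (L - 1)^2 L^-(nu i + j) T^(ia + jb); multiplying the sum over the cone by
    the two factors 1 - L^-(p nu + q) T^N removes the translates of the cone along its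
    edges and leaves the half-open parallelogram P_Delta.  If (i, j) = t (p, q) lies on
    the ray of a compact face, the initial forms at the leading coefficients (A, B) vanish
    simultaneously exactly when mu = B^p / A^q is a root of the face polynomial.  The
    arcs with mu not a root have order tN and give the second sum.  Those with mu a root
    are the images under the Newton map of the arcs with ord x1 = t, bijectively because
    p p' - q q' = 1 and because p-th roots of power series with constant term 1 exist;
    the Jacobian of this map accounts for the exponent of omega_1.

    Everything is done modulo T^(n+1) with finitely many cells (i, j) of arcs: the index
    n + 1 stands for all orders greater than n, in particular for x(t) = 0. *)

(** * Locally closed subsets of affine space *)

(** [vclass], [cclass] and [motmeas] are choices of a value, so each of them needs a uniqueness
    argument before it can be computed: partitions into locally closed sets are compared on a common
    refinement by the vanishing patterns of finitely many polynomials, and truncation levels on a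
    common larger level. Identities of classes then come from explicit isomorphisms of jet spaces.
    This is why the inverse of the Newton map is built from a Newton iteration and a truncated
    geometric series: its coefficients are polynomial in the given coefficients and in inverses of
    nonvanishing functions of the leading ones, hence regular. The cutoff at n + 1 matters for a
    cone only if its vertex (a, b) lies on a coordinate axis. If a = 0, infinitely many orders of
    x(t) share one exponent of T; the last cell stands for the tail of a geometric series, and the
    factor 1 - L^-(p1 nu + q1), which is 1 - L^-1 because p1 = nu = 1 and q1 = 0, makes it
    telescope. There N1 = 0, so that this denominator is a constant, which is why the elements 1 -
    L^-a are inverted. The case b = 0 is symmetric, with y(t) and the second factor. *)

Section Spaces.
Variable k : fieldType.
Implicit Types X Y W : fspace k.

Lemma is_morphism_comp X Y W (g : pt Y -> pt W) (h : pt X -> pt Y) :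
  is_morphism h -> is_morphism g -> is_morphism (g \o h).
Proof.
move=> mh mg V oV; have [o1 r1] := mg _ oV; have [o2 r2] := mh _ o1.
by split=> // f rf; exact: r2 (r1 _ rf).
Qed.

Lemma isomorphic_sym X Y : isomorphic X Y -> isomorphic Y X.
Proof. by move=> [h [h' [a b c d]]]; exists h', h; split. Qed.

Lemma isomorphic_trans Y X W : isomorphic X Y -> isomorphic Y W -> isomorphic X W.
Proof.
move=> [h [h' [a b c d]]] [g [g' [a' b' c' d']]].
exists (g \o h), (h' \o g'); split.
- exact: can_comp.
- exact: can_comp.
- exact: is_morphism_comp.
- exact: is_morphism_comp.
Qed.

Lemma sig_eq (T : Type) (Z : set T) (x y : {x | Z x}) : proj1_sig x = proj1_sig y -> x = y.
Proof. by case: x y => [x hx] [y hy] /= e; subst y; congr exist; exact: Prop_irrelevance. Qed.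

Lemma induced_morphism X Y (Z : set (pt X)) (Z' : set (pt Y)) (h : pt X -> pt Y)
    (hZ : forall x, Z x -> Z' (h x)) :
  is_morphism h ->
  @is_morphism _ (induced Z) (induced Z')
    (fun x => exist Z' (h (proj1_sig x)) (hZ _ (proj2_sig x))).
Proof.
move=> mh V /= [U oU ->]; split.
  by exists (h @^-1` U) => //; case: (mh _ oU).
move=> f rf x /= Ux; have [U' [g [oU' U'x rg e]]] := rf (exist Z' _ (hZ _ (proj2_sig x))) Ux.
exists (h @^-1` U'), (g \o h); split=> //.
- by case: (mh _ oU').
- by case: (mh _ oU') => _; apply.
- by move=> y Uy U'y; rewrite /= e.
Qed.

Lemma induced_isomorphic X Y (Z : set (pt X)) (Z' : set (pt Y))
    (h : pt X -> pt Y) (h' : pt Y -> pt X) :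
  cancel h h' -> cancel h' h -> is_morphism h -> is_morphism h' ->
  (forall x, Z x <-> Z' (h x)) -> isomorphic (induced Z) (induced Z').
Proof.
move=> a b mh mh' hZ.
have hZ' y : Z' y -> Z (h' y) by move=> z; apply/hZ; rewrite b.
have hZ1 x : Z x -> Z' (h x) by move/hZ.
exists (fun x => exist Z' (h (proj1_sig x)) (hZ1 _ (proj2_sig x))).
exists (fun x => exist Z (h' (proj1_sig x)) (hZ' _ (proj2_sig x))).
split.
- by move=> x; apply: sig_eq => /=; rewrite a.
- by move=> x; apply: sig_eq => /=; rewrite b.
- exact: induced_morphism.
- exact: induced_morphism.
Qed.

(** Open sets and regular functions of a product are described by tensors sum f_i(x) g_i(y), and
    composing the two factors of a tensor with [h] and [h'] gives a tensor again. *)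
Lemma prod_morphism X X' Y Y' (h : pt X -> pt Y) (h' : pt X' -> pt Y') :
  is_morphism h -> is_morphism h' ->
  @is_morphism k (prod_space X X') (prod_space Y Y') (fun z => (h z.1, h' z.2)).
Proof.
move=> mh mh'; pose pb (s : seq ((pt Y -> k) * (pt Y' -> k))) := [seq (fg.1 \o h, fg.2 \o h') |
  fg <- s].
have te s z : tensor_eval (pb s) z = tensor_eval s (h z.1, h' z.2) by rewrite /tensor_eval big_map.
have pb_on U V s : zopen U -> zopen V -> tensor_on U V s -> tensor_on (h @^-1` U) (h' @^-1` V)
  (pb s).
  move=> oU oV ts i; have hi : (i < size s)%N by rewrite -(size_map (fun fg => (fg.1 \o h, fg.2
    \o h')) s).
  rewrite (tnth_nth ((fun=> 0), (fun=> 0))) /= (nth_map ((fun=> 0), (fun=> 0))) //=.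
  have := ts (Ordinal hi); rewrite (tnth_nth ((fun=> 0), (fun=> 0))) /= => -[r1 r2]; split.
    by case: (mh _ oU) => _; apply.
  by case: (mh' _ oV) => _; apply.
have pre U : zopen U -> zopen (h @^-1` U) by move=> /mh [].
have pre' U : zopen U -> zopen (h' @^-1` U) by move=> /mh' [].
move=> W oW; split.
  move=> z /= /oW [U [V [s [oU oV ts lz sW]]]].
  exists (h @^-1` U), (h' @^-1` V), (pb s); split; [exact: pre|exact: pre'|exact: pb_on| |].
  - by case: lz => ? ? ?; split=> //; rewrite te.
  - by move=> z' [] ? ? t0; apply: sW; split=> //=; rewrite -te.
move=> f rff z /= /rff [U [V [s [s' [oU oV [ts ts'] lz e]]]]].
exists (h @^-1` U), (h' @^-1` V), (pb s), (pb s'); split; [exact: pre|exact: pre'|..].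
- by split; exact: pb_on.
- by case: lz => ? ? ?; split=> //; rewrite te.
- by move=> z' Wz' [] ? ? t0; rewrite /= e // ?te //; split=> //=; rewrite -te.
Qed.

Lemma prod_isomorphic X X' Y Y' : isomorphic X Y -> isomorphic X' Y' ->
  isomorphic (prod_space X X') (prod_space Y Y').
Proof.
move=> [h [g [a b c d]]] [h' [g' [a' b' c' d']]].
exists (fun z => (h z.1, h' z.2)), (fun z => (g z.1, g' z.2)).
split; [| |exact: prod_morphism|exact: prod_morphism].
- by move=> [x y]; rewrite /= a a'.
- by move=> [x y]; rewrite /= b b'.
Qed.

(** Transport of structure. It serves to replace a subset of affine space by a copy whose points are
    sequences of scalars, as [variety] requires. *)
Lemma isomorphic_variety X Y : isomorphic X Y -> is_variety X -> is_variety Y.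
Proof.
move=> [h [h' [a b mh mh']]] [[s1 s2 s3 s4 s5] [r [U [oU cU aU]]] sep].
have pre V : zopen (h @^-1` V) -> @zopen k Y V.
  move=> o; have -> : V = h' @^-1` (h @^-1` V) by apply/seteqP; split=> y /=; rewrite b.
  by case: (mh' _ o).
have preo V : @zopen k Y V -> zopen (h @^-1` V) by move=> o; case: (mh _ o).
have prer V f : @zopen k Y V -> reg (h @^-1` V) (f \o h) -> reg V f.
  move=> o rf; have [_ /(_ _ rf)] := mh' _ (preo _ o).
  have -> : h' @^-1` (h @^-1` V) = V by apply/seteqP; split=> y /=; rewrite b.
  by have -> : (f \o h) \o h' = f by apply/funext => y /=; rewrite b.
split; [split|..].
- exact: pre.
- by move=> V V' o o'; apply: pre; rewrite preimage_setI; apply: s2; apply: preo.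
- move=> F oF; apply: pre; rewrite preimage_bigcup.
  have -> : \bigcup_(i in F) h @^-1` i = \bigcup_(W in [set h @^-1` i | i in F]) W.
    apply/seteqP; split=> x; first by move=> [i Fi hx]; exists (h @^-1` i) => //; exists i.
    by move=> [_ [i Fi <-] hx]; exists i.
  by apply: s3 => _ [i Fi <-]; apply: preo; exact: oF.
- move=> V V' f g oV oV' sV rf e; apply: prer => //.
  apply: (s4 (h @^-1` V) (h @^-1` V') (f \o h)).
  + exact: preo.
  + exact: preo.
  + by move=> x /=; exact: sV.
  + by case: (mh _ oV) => _; apply.
  + by move=> x /= /e.
- move=> V f oV loc; apply: prer => //; apply: s5; first exact: preo.
  move=> x /= /loc [V' [oV' V'x sV rf]]; exists (h @^-1` V'); split=> //.
  + exact: preo.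
  + by move=> y /=; exact: sV.
  + by case: (mh _ oV') => _; apply.
- exists r, (fun i => h' @^-1` U i); split.
  + by move=> i; case: (mh' _ (oU i)).
  + by move=> y; have [i Ui] := cU (h' y); exists i.
  + move=> i; have [n [ps iso]] := aU i; exists n, ps.
    apply: isomorphic_trans iso; apply: (@induced_isomorphic _ _ _ _ h' h) => //.
- have -> : [set z : pt Y * pt Y | z.1 <> z.2] = [set z | [set z' : pt X * pt X | z'.1 <> z'.2]
  (h' z.1, h' z.2)].
    apply/seteqP; split=> -[y y'] /= ne; first by move/(can_inj b).
    by move=> e; apply: ne; rewrite e.
  by case: (prod_morphism mh' mh' sep).
Qed.

End Spaces.

(** * Induced structures and regular functions on subsets of affine space *)

Section AffineSubsets.
Variable k : fieldType.

(** An explicit form of the structure induced from affine space, with ambient polynomials in place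
    of ambient open sets and ambient regular functions; [inducedE] identifies the two. *)
Definition asp n (S : set (affpt k n)) : fspace k := {|
  pt := {x : affpt k n | S x};
  zopen := [set V | forall x, V x -> exists2 p : {mpoly k[n]},
     p.@[sval x] != 0 & forall y, p.@[sval y] != 0 -> V y];
  reg V := [set f | forall x, V x -> exists p q : {mpoly k[n]},
     q.@[sval x] != 0 /\ forall y, V y -> q.@[sval y] != 0 -> f y = p.@[sval y] / q.@[sval y]]
|}.

Lemma zopen_neq0 n (p : {mpoly k[n]}) : @zopen _ (affine_space k n) [set y | p.@[y] != 0].
Proof. by move=> x px; exists p. Qed.

Lemma inducedE n (S : set (affpt k n)) : @induced k (affine_space k n) S = asp S.
Proof.
rewrite /induced /asp; congr FSpace.
  apply/seteqP; split=> V /=.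
    by move=> [U oU ->] x /oU [p px pU]; exists p => // y py; exact: pU.
  move=> oV.
  (* The largest ambient open set whose trace lies in V. *)
  exists (\bigcup_(p in [set p : {mpoly k[n]} | forall y : {x | S x}, p.@[sval y] != 0 -> V y])
    [set y | p.@[y] != 0]).
    by move=> x [p /= hp px]; exists p => // y py; exists p.
  apply/seteqP; split=> x /=; last by move=> [p hp px]; exact: hp.
  by move=> /oV [p px hp]; exists p.
apply/funext => V; apply/seteqP; split=> f /= rf x Vx.
  have [U [g [oU Ux rg e]]] := rf _ Vx.
  have [p0 p0x p0U] := oU _ Ux; have [p [q [qx hq]]] := rg _ Ux.
  (* The factor [p0] confines the new denominator to the open set U, on which g represents f. *)
  exists (p * p0), (q * p0); rewrite mevalM mulf_neq0 //; split=> // y Vy.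
  rewrite !mevalM mulf_eq0 negb_or => /andP[qy p0y].
  have Uy : U (sval y) by apply: p0U.
  by rewrite e // hq // -mulf_div divff // mulr1.
have [p [q [qx hq]]] := rf _ Vx.
exists [set y | q.@[y] != 0], (fun y => p.@[y] / q.@[y]); split=> //.
- exact: zopen_neq0.
- by move=> y /= qy; exists p, q.
Qed.

Lemma asp_is_space n (S : set (affpt k n)) : is_space (asp S).
Proof.
split => /=.
- by move=> x _; exists 1; rewrite ?meval1 ?oner_neq0.
- move=> U V oU oV x [/oU [p px hp] /oV [q qx hq]]; exists (p * q).
    by rewrite mevalM mulf_neq0.
  by move=> y; rewrite mevalM mulf_eq0 negb_or => /andP[/hp ? /hq ?].
- move=> F oF x [U FU Ux]; have [p px hp] := oF _ FU _ Ux.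
  by exists p => // y /hp Uy; exists U.
- move=> U V f g oU oV sV rf e x Vx; have [p [q [qx hq]]] := rf _ (sV _ Vx).
  by exists p, q; split=> // y Vy qy; rewrite e // hq //; exact: sV.
- move=> U f oU loc x Ux; have [V [oV Vx sV rf]] := loc _ Ux.
  have [p0 p0x hp0] := oV _ Vx; have [p [q [qx hq]]] := rf _ Vx.
  exists (p * p0), (q * p0); rewrite mevalM mulf_neq0 //; split=> // y Uy.
  rewrite !mevalM mulf_eq0 negb_or => /andP[qy p0y].
  by rewrite hq //; [rewrite -mulf_div divff // mulr1|exact: hp0].
Qed.

(** The complement of the diagonal is covered by the loci x_i - y_i <> 0, and x_i - y_i is a tensor
    with two terms. *)
Lemma asp_separated n (S : set (affpt k n)) :
  @zopen _ (prod_space (asp S) (asp S)) [set z | z.1 <> z.2].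
Proof.
move=> [x y] /= ne.
have [i ni] : exists i, sval x i != sval y i.
  apply: contrapT => h; apply: ne; apply: sig_eq; apply/funext => i.
  by apply/eqP/negPn/negP => ni; apply: h; exists i.
exists setT, setT, [:: ((fun z => sval z i), (fun=> 1)); ((fun=> 1), (fun z => - sval z i))].
have te z z' : tensor_eval [:: ((fun z : pt (asp S) => sval z i), (fun=> 1));
  ((fun=> 1), (fun z : pt (asp S) => - sval z i))] (z, z') = sval z i - sval z' i.
  by rewrite /tensor_eval !big_cons big_nil /= mulr1 mul1r addr0.
have rc c : @reg _ (asp S) setT (fun=> c).
  by move=> z _ /=; exists c%:MP, 1; rewrite meval1 oner_neq0; split=> // w _ _;
    rewrite mevalC meval1 divr1.
have rx (c : k) : @reg _ (asp S) setT (fun z => c * sval z i).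
  move=> z _ /=; exists (c *: 'X_i), 1; rewrite meval1 oner_neq0; split=> // w _ _.
  by rewrite mevalZ mevalXU meval1 divr1.
split=> //.
- by case: (asp_is_space S).
- by case: (asp_is_space S).
- case=> -[|[|//]] hi; rewrite (tnth_nth ((fun=> 0), (fun=> 0))) /=; split; try exact: (rc 1).
    by have := rx 1; under eq_fun do rewrite mul1r.
  by have := rx (-1); under eq_fun do rewrite mulN1r.
- by split=> //; rewrite te subr_eq0.
- by move=> [z z'] [] _ _; rewrite te => h /= e; move: h; rewrite e subrr eqxx.
Qed.

(** The regular functions of [asp S], but as functions of ambient points: maps between subsets can
    then be given by formulas that make sense everywhere. *)
Definition rf n (S : set (affpt k n)) (f : affpt k n -> k) : Prop :=
  forall x, S x -> exists p q : {mpoly k[n]},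
    q.@[x] != 0 /\ forall y, S y -> q.@[y] != 0 -> f y = p.@[y] / q.@[y].

Section RegularFunctions.
Variables (n : nat) (S : set (affpt k n)).
Implicit Types f g : affpt k n -> k.

Lemma rf_poly (p : {mpoly k[n]}) : rf S (fun x => p.@[x]).
Proof. by move=> x Sx; exists p, 1; rewrite meval1 oner_neq0; split=> // y _ _;
  rewrite meval1 divr1. Qed.

Lemma rf_ext f g : (forall x, S x -> f x = g x) -> rf S f -> rf S g.
Proof.
move=> e h x Sx; have [p [q [qx hq]]] := h _ Sx; exists p, q; split=> // y Sy qy.
by rewrite -e // hq.
Qed.

Lemma rf_cst c : rf S (fun=> c).
Proof. by apply: rf_ext (rf_poly c%:MP) => x _; rewrite mevalC. Qed.

Lemma rf_coord i : rf S (fun x => x i).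
Proof. by apply: rf_ext (rf_poly 'X_i) => x _; rewrite mevalXU. Qed.

Lemma rfD f g : rf S f -> rf S g -> rf S (fun x => f x + g x).
Proof.
move=> hf hg x Sx; have [p [q [qx hq]]] := hf _ Sx; have [p' [q' [qx' hq']]] := hg _ Sx.
exists (p * q' + p' * q), (q * q'); rewrite mevalM mulf_neq0 //; split=> // y Sy.
rewrite mevalD !mevalM mulf_eq0 negb_or => /andP[qy qy'].
by rewrite hq // hq' // addf_div.
Qed.

Lemma rfM f g : rf S f -> rf S g -> rf S (fun x => f x * g x).
Proof.
move=> hf hg x Sx; have [p [q [qx hq]]] := hf _ Sx; have [p' [q' [qx' hq']]] := hg _ Sx.
exists (p * p'), (q * q'); rewrite mevalM mulf_neq0 //; split=> // y Sy.
rewrite !mevalM mulf_eq0 negb_or => /andP[qy qy'].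
by rewrite hq // hq' // mulf_div.
Qed.

(** The local formula q / p for the inverse is valid only where the formula p / q for f is, so the
    denominator has to force both p and q to be nonzero. *)
Lemma rfV f : (forall x, S x -> f x != 0) -> rf S f -> rf S (fun x => (f x)^-1).
Proof.
move=> nz hf x Sx; have [p [q [qx hq]]] := hf _ Sx.
have px : p.@[x] != 0 by have := nz _ Sx; rewrite hq // mulf_eq0 negb_or => /andP[].
exists (q * q), (p * q); rewrite mevalM mulf_neq0 //; split=> // y Sy.
rewrite !mevalM mulf_eq0 negb_or => /andP[py qy].
by rewrite hq // invf_div -mulf_div divff // mulr1.
Qed.

Lemma rf_sum (J : Type) (r : seq J) (F : J -> affpt k n -> k) :
  (forall j, rf S (F j)) -> rf S (fun x => \sum_(j <- r) F j x).
Proof.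
move=> h; elim: r => [|j r IH].
  by apply: rf_ext (rf_cst 0) => x _; rewrite big_nil.
by apply: rf_ext (rfD (h j) IH) => x _; rewrite big_cons.
Qed.

Lemma rf_exp f m : rf S f -> rf S (fun x => f x ^+ m).
Proof.
move=> h; elim: m => [|m IH]; first exact: rf_cst.
by apply: rf_ext (rfM h IH) => x _; rewrite exprS.
Qed.

Lemma rf_prod (J : Type) (r : seq J) (F : J -> affpt k n -> k) :
  (forall j, rf S (F j)) -> rf S (fun x => \prod_(j <- r) F j x).
Proof.
move=> h; elim: r => [|j r IH].
  by apply: rf_ext (rf_cst 1) => x _; rewrite big_nil.
by apply: rf_ext (rfM (h j) IH) => x _; rewrite big_cons.
Qed.

Lemma rf_meval m (h : affpt k n -> affpt k m) (p : {mpoly k[m]}) :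
  (forall i, rf S (fun x => h x i)) -> rf S (fun x => p.@[h x]).
Proof.
move=> rh; apply: (@rf_ext (fun x => \sum_(j <- msupp p) p@_j * \prod_i h x i ^+ j i)).
  by move=> x _; rewrite mevalE.
apply: rf_sum => j; apply: rfM; first exact: rf_cst.
by apply: rf_prod => i; exact: rf_exp.
Qed.

Lemma rf_quot m (h : affpt k n -> affpt k m) (p q : {mpoly k[m]}) x :
  (forall i, rf S (fun x => h x i)) -> S x -> q.@[h x] != 0 ->
  exists P Q : {mpoly k[n]}, Q.@[x] != 0 /\ forall y, S y -> Q.@[y] != 0 ->
    q.@[h y] != 0 /\ p.@[h y] / q.@[h y] = P.@[y] / Q.@[y].
Proof.
move=> rh Sx qx; have [P1 [Q1 [Q1x h1]]] := rf_meval p rh Sx.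
have [P2 [Q2 [Q2x h2]]] := rf_meval q rh Sx.
have P2x : P2.@[x] != 0 by move: qx; rewrite h2 // mulf_eq0 negb_or => /andP[].
exists (P1 * Q2 * Q2), (Q1 * P2 * Q2); rewrite !mevalM !mulf_neq0 //; split=> // y Sy.
rewrite !mevalM !mulf_eq0 !negb_or => /andP[/andP[Q1y P2y] Q2y].
rewrite h2 // h1 //; split; first by rewrite mulf_neq0 ?invr_eq0.
by field; rewrite Q1y P2y Q2y.
Qed.

End RegularFunctions.

Lemma asp_morphism n m (S : set (affpt k n)) (T : set (affpt k m))
    (h : affpt k n -> affpt k m) (hT : forall x, S x -> T (h x)) :
  (forall i, rf S (fun x => h x i)) ->
  @is_morphism k (asp S) (asp T)
    (fun x => exist T (h (sval x)) (hT _ (proj2_sig x))).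
Proof.
move=> rh V oV; split.
  move=> [x Sx] /= Vx; have [p /= px hp] := oV _ Vx.
  have [P [Q [Qx hQ]]] := rf_meval p rh Sx.
  have Px : P.@[x] != 0 by move: px; rewrite hQ // mulf_eq0 negb_or => /andP[].
  exists (P * Q); first by rewrite mevalM mulf_neq0.
  move=> [y Sy]; rewrite mevalM mulf_eq0 negb_or => /andP[Py Qy].
  by apply: hp; rewrite /= hQ // mulf_neq0 ?invr_eq0.
move=> f rff [x Sx] /= Vx; have [p [q [/= qx hq]]] := rff _ Vx.
have [P [Q [Qx hQ]]] := rf_quot p rh Sx qx.
exists P, Q; split=> // -[y Sy] /= Vy Qy; have [qy <-] := hQ _ Sy Qy.
by rewrite /= hq.
Qed.

Lemma asp_isomorphic n m (S : set (affpt k n)) (T : set (affpt k m))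
    (h : affpt k n -> affpt k m) (h' : affpt k m -> affpt k n) :
  (forall x, S x -> T (h x)) -> (forall y, T y -> S (h' y)) ->
  (forall x, S x -> h' (h x) = x) -> (forall y, T y -> h (h' y) = y) ->
  (forall i, rf S (fun x => h x i)) -> (forall i, rf T (fun y => h' y i)) ->
  isomorphic (asp S) (asp T).
Proof.
move=> hT hS a b rh rh'.
exists (fun x => exist T (h (sval x)) (hT _ (proj2_sig x))).
exists (fun x => exist S (h' (sval x)) (hS _ (proj2_sig x))).
split; [| |exact: asp_morphism|exact: asp_morphism].
- by move=> [x Sx]; apply: sig_eq; rewrite /= a.
- by move=> [y Ty]; apply: sig_eq; rewrite /= b.
Qed.

Lemma induced_asp n (S Z : set (affpt k n)) :
  isomorphic (@induced k (asp S) [set x | Z (sval x)]) (asp (S `&` Z)).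
Proof.
pose Z' := [set x : {x | S x} | Z (sval x)].
exists (fun x : {x | Z' x} => exist (S `&` Z) (sval (sval x)) (conj (proj2_sig (sval x))
  (proj2_sig x))).
exists (fun x : {x | (S `&` Z) x} => exist Z' (exist S (sval x) (proj1 (proj2_sig x))) (proj2
  (proj2_sig x))).
split.
- by move=> x; apply: sig_eq; apply: sig_eq.
- by move=> x; apply: sig_eq.
- move=> V oV; split.
    exists (\bigcup_(p in [set p : {mpoly k[n]} | forall y : {x | (S `&` Z) x}, p.@[sval y] != 0
      -> V y]) [set y | p.@[sval y] != 0]).
      by move=> x [p /= hp px]; exists p => // y py; exists p.
    apply/seteqP; split=> x /=; last by move=> [p hp px]; exact: hp.
    by move=> /oV [p px hp]; exists p.
  move=> f rff x Vx; have [p [q [qx hq]]] := rff _ Vx.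
  exists [set y | q.@[sval y] != 0], (fun y => p.@[sval y] / q.@[sval y]); split=> //.
  + by move=> y qy; exists q.
  + by move=> y /= qy; exists p, q.
  + by move=> y Vy /= qy; exact: hq.
- move=> V [U oU ->]; split.
    by move=> x /= /oU [p px hp]; exists p => // y py; exact: hp.
  move=> f rff x /= Ux.
  have [U' [g [oU' U'x rg e]]] := rff (exist Z' (exist S _ (proj1 (proj2_sig x))) (proj2
    (proj2_sig x))) Ux.
  have [p0 /= p0x hp0] := oU' _ U'x; have [p [q [/= qx hq]]] := rg _ U'x.
  exists (p * p0), (q * p0); rewrite mevalM mulf_neq0 //; split=> // y Uy.
  rewrite /= !mevalM mulf_eq0 negb_or => /andP[qy p0y].
  have U'y : U' (exist S _ (proj1 (proj2_sig y))) by exact: hp0.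
  rewrite e //= hq // -mulf_div divff // mulr1; congr (_ / _).
Qed.

(** Rabinowitsch's trick: the locus where [q] does not vanish on a closed set is
    the closed set [q z = 1] in one more variable. *)
Lemma affine_principal n (ps : seq {mpoly k[n]}) (q : {mpoly k[n]}) :
  is_affine (asp (zeros ps `&` [set x | q.@[x] != 0])).
Proof.
pose up (p : {mpoly k[n]}) : {mpoly k[n.+1]} := mmap (fun c => c%:MP) (fun i => 'X_(lift ord_max
  i)) p.
pose pr (x : affpt k n.+1) : affpt k n := fun i => x (lift ord_max i).
have upE p x : (up p).@[x] = p.@[pr x].
  rewrite /up /mmap raddf_sum mevalE /=; apply: eq_bigr => m _.
  rewrite mevalM mevalC; congr (_ * _); rewrite /mmap1 rmorph_prod; apply: eq_bigr => i _.
  by rewrite rmorphXn /= mevalXU.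
exists n.+1, (rcons (map up ps) (up q * 'X_ord_max - 1)); rewrite inducedE.
pose ins (x : affpt k n) : affpt k n.+1 := fun i => oapp x (q.@[x])^-1 (unlift ord_max i).
have pri x : pr (ins x) = x by apply/funext => i; rewrite /pr /ins liftK.
have insm x : ins x ord_max = (q.@[x])^-1 by rewrite /ins unlift_none.
apply: (@asp_isomorphic _ _ _ _ ins pr).
- move=> x [zx qx] p; rewrite mem_rcons inE => /orP[/eqP ->|/mapP [p' p'ps ->]].
    by rewrite mevalB mevalM upE pri mevalXU insm meval1 mulfV // subrr.
  by rewrite upE pri; exact: zx.
- move=> y hy; split.
    by move=> p pps; rewrite -upE; apply: hy; rewrite mem_rcons inE map_f ?orbT.
  have := hy (up q * 'X_ord_max - 1); rewrite mem_rcons inE eqxx => /(_ isT)/eqP.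
  rewrite mevalB mevalM upE mevalXU meval1 subr_eq0 /= => /eqP e.
  by apply/eqP => q0; move/eqP: e; rewrite q0 mul0r eq_sym oner_eq0.
- by move=> x _; exact: pri.
- move=> y hy; have := hy (up q * 'X_ord_max - 1); rewrite mem_rcons inE eqxx => /(_ isT)/eqP.
  rewrite mevalB mevalM upE mevalXU meval1 subr_eq0 /= => /eqP e.
  apply/funext => i; rewrite /ins; case: unliftP => [j ->|->] //=.
  apply: (@mulfI _ q.@[pr y]); last by rewrite e mulfV //; apply/eqP => q0; move/eqP: e;
    rewrite q0 mul0r eq_sym oner_eq0.
  by apply/eqP => q0; move/eqP: e; rewrite q0 mul0r eq_sym oner_eq0.
- move=> i; rewrite /ins; case: unliftP => [j _|_] /=; first exact: rf_coord.
  by apply: rfV; [by move=> x []|exact: rf_poly].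
- by move=> i; exact: rf_coord.
Qed.

(** If S is the set of zeros of [ps] that are not common zeros of [qs], the loci q <> 0 for q in
    [qs] form a finite open cover of S, and each of them is affine by [affine_principal]. *)
Lemma asp_variety n (S : set (affpt k n)) : locally_closed S -> is_variety (asp S).
Proof.
move=> [ps [qs ->]]; split; [exact: asp_is_space| |exact: asp_separated].
exists (size qs), (fun i => [set x | (tnth (in_tuple qs) i).@[sval x] != 0]); split.
- by move=> i x /= qx; exists (tnth (in_tuple qs) i).
- move=> [x [zx nz]] /=; apply: contrapT => h; apply: nz => q qqs.
  have [i ->] : exists i, q = tnth (in_tuple qs) i by exact/tnthP.
  by apply/eqP/negPn/negP => nq; apply: h; exists i.
- move=> i; pose q := tnth (in_tuple qs) i.
  have [m [rs iso]] := affine_principal ps q; exists m, rs; apply: isomorphic_trans iso.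
  have -> : zeros ps `&` [set x | q.@[x] != 0] = (zeros ps `\` zeros qs) `&` [set x | q.@[x] != 0].
    apply/seteqP; split=> x [] => [zx qx|[zx _] qx] //; split=> //; split=> // zq.
    by move: qx; rewrite /= zq ?eqxx // mem_tnth.
  exact: induced_asp.
Qed.

Definition ljoin n m (x : affpt k n) (y : affpt k m) : affpt k (n + m) :=
  fun i => match fintype.split i with inl j => x j | inr j => y j end.
Definition lpart n m (z : affpt k (n + m)) : affpt k n := fun i => z (lshift m i).
Definition rpart n m (z : affpt k (n + m)) : affpt k m := fun i => z (rshift n i).
Definition Sprod n m (S : set (affpt k n)) (T : set (affpt k m)) : set (affpt k (n + m)) :=
  [set z | S (lpart z) /\ T (rpart z)].

Lemma lpartK n m (x : affpt k n) (y : affpt k m) : lpart (ljoin x y) = x.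
Proof. by apply/funext => i; rewrite /lpart /ljoin (unsplitK (inl _ i)). Qed.
Lemma rpartK n m (x : affpt k n) (y : affpt k m) : rpart (ljoin x y) = y.
Proof. by apply/funext => i; rewrite /rpart /ljoin (unsplitK (inr _ i)). Qed.
Lemma ljoinK n m (z : affpt k (n + m)) : ljoin (lpart z) (rpart z) = z.
Proof.
by apply/funext => i; rewrite /ljoin -[in RHS](splitK i); case: fintype.split.
Qed.

Lemma reg_rf n (S : set (affpt k n)) (f : affpt k n -> k) V :
  rf S f -> @reg k (asp S) V (fun x => f (sval x)).
Proof.
move=> h [x Sx] Vx; have [p [q [qx hq]]] := h _ Sx; exists p, q; split=> // -[y Sy] _ qy.
exact: hq.
Qed.

Section Product.
Variables (n m : nat) (S : set (affpt k n)) (T : set (affpt k m)).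

(** A monomial in both groups of variables is a product of one monomial in each group, so that every
    polynomial on the product is a tensor. *)
Let tens (p : {mpoly k[n + m]}) : seq ((pt (asp S) -> k) * (pt (asp T) -> k)) :=
  [seq ((fun x => p@_e * \prod_(i < n) sval x i ^+ e (lshift m i)),
        (fun y => \prod_(i < m) sval y i ^+ e (rshift n i))) | e <- msupp p].

Let tensE p x y : tensor_eval (tens p) (x, y) = p.@[ljoin (sval x) (sval y)].
Proof.
rewrite /tensor_eval big_map mevalE; apply: eq_bigr => e _ /=.
rewrite -mulrA big_split_ord /=; congr (_ * (_ * _)); apply: eq_bigr => i _.
  by rewrite -[X in _ = X ^+ _]/(lpart (ljoin (sval x) (sval y)) i) lpartK.
by rewrite -[X in _ = X ^+ _]/(rpart (ljoin (sval x) (sval y)) i) rpartK.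
Qed.

Let tens_on p : tensor_on setT setT (tens p).
Proof.
move=> i; have /mapP [e _ ->] := mem_tnth i (in_tuple (tens p)); split=> /=.
  apply: (@reg_rf _ _ (fun x => p@_e * \prod_(i < n) x i ^+ e (lshift m i))).
  by apply: rfM; [exact: rf_cst|apply: rf_prod => j; apply: rf_exp; exact: rf_coord].
apply: (@reg_rf _ _ (fun x => \prod_(i < m) x i ^+ e (rshift n i))).
by apply: rf_prod => j; apply: rf_exp; exact: rf_coord.
Qed.

Lemma tensor_on_cons X Y (U : set (pt X)) (V : set (pt Y)) fg (s : seq ((pt X -> k) * (pt Y ->
  k))) :
  tensor_on U V (fg :: s) -> (reg U fg.1 /\ reg V fg.2) /\ tensor_on U V s.
Proof.
move=> h; split; first by have := h ord0; rewrite (tnth_nth fg).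
by move=> i; have := h (lift ord0 i); rewrite !(tnth_nth fg).
Qed.

Let up (p : {mpoly k[n]}) :
  exists P : {mpoly k[n + m]}, forall z, P.@[z] = p.@[lpart z].
Proof.
exists (mmap (fun c => c%:MP) (fun i => 'X_(lshift m i)) p) => z.
rewrite /mmap raddf_sum mevalE /=; apply: eq_bigr => e _.
rewrite mevalM mevalC; congr (_ * _); rewrite /mmap1 rmorph_prod; apply: eq_bigr => i _.
by rewrite rmorphXn /= mevalXU.
Qed.

Let upr (p : {mpoly k[m]}) :
  exists P : {mpoly k[n + m]}, forall z, P.@[z] = p.@[rpart z].
Proof.
exists (mmap (fun c => c%:MP) (fun i => 'X_(rshift n i)) p) => z.
rewrite /mmap raddf_sum mevalE /=; apply: eq_bigr => e _.
rewrite mevalM mevalC; congr (_ * _); rewrite /mmap1 rmorph_prod; apply: eq_bigr => i _.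
by rewrite rmorphXn /= mevalXU.
Qed.

(** The converse of [tens]: near a point a tensor of regular functions is a quotient of polynomials,
    the denominators of its terms being multiplied together. The empty tensor already contributes a
    denominator that keeps the neighbourhood inside U x V. *)
Let tens_rat (U : set (pt (asp S))) (V : set (pt (asp T))) s x y :
  zopen U -> zopen V -> tensor_on U V s -> U x -> V y ->
  exists P Q : {mpoly k[n + m]}, Q.@[ljoin (sval x) (sval y)] != 0 /\
   forall x' y', Q.@[ljoin (sval x') (sval y')] != 0 ->
    [/\ U x', V y' & tensor_eval s (x', y') = P.@[ljoin (sval x') (sval y')] / Q.@[ljoin (sval
      x') (sval y')]].
Proof.
move=> oU oV + Ux Vy; elim: s => [_|fg s IH].
  have [p px hp] := oU _ Ux; have [q qy hq] := oV _ Vy.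
  have [P hP] := up p; have [Q hQ] := upr q.
  exists 0, (P * Q); rewrite !mevalM !hP !hQ lpartK rpartK mulf_neq0 //; split=> // x' y'.
  rewrite !mevalM !hP !hQ lpartK rpartK meval0 mul0r mulf_eq0 negb_or => /andP[px' qy'].
  by split; [exact: hp|exact: hq|rewrite /tensor_eval big_nil].
move=> /tensor_on_cons[[r1 r2] /IH [P [Q [Qz hQ]]]].
have [p1 [q1 [q1x h1]]] := r1 _ Ux; have [p2 [q2 [q2x h2]]] := r2 _ Vy.
have [P1 hP1] := up p1; have [Q1 hQ1] := up q1.
have [P2 hP2] := upr p2; have [Q2 hQ2] := upr q2.
exists (P1 * P2 * Q + P * Q1 * Q2), (Q * Q1 * Q2).
rewrite !mevalM hQ1 hQ2 lpartK rpartK !mulf_neq0 //; split=> // x' y'.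
rewrite mevalD !mevalM hQ1 hQ2 hP1 hP2 lpartK rpartK !mulf_eq0 !negb_or => /andP[/andP[Qn q1n] q2n].
have [Ux' Vy' e] := hQ _ _ Qn; split=> //.
rewrite /tensor_eval big_cons -[\sum_(_ <- _) _]/(tensor_eval s (x', y')) e /= h1 // h2 //.
by field; rewrite Qn q1n q2n.
Qed.

Lemma asp_prod : isomorphic (asp (Sprod S T)) (prod_space (asp S) (asp T)).
Proof.
have hin x y : S x -> T y -> Sprod S T (ljoin x y) by split; rewrite ?lpartK ?rpartK.
exists (fun z => (exist S (lpart (sval z)) (proj1 (proj2_sig z)), exist T (rpart (sval z)) (proj2
  (proj2_sig z)))).
exists (fun xy => exist (Sprod S T) (ljoin (sval xy.1) (sval xy.2)) (hin _ _ (proj2_sig xy.1)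
  (proj2_sig xy.2))).
split.
- by move=> z; apply: sig_eq; rewrite /= ljoinK.
- by move=> [x y]; congr pair; apply: sig_eq; rewrite /= ?lpartK ?rpartK.
- move=> W oW; split.
    move=> z /= /oW [U [V [s [oU oV ts [/= Ux Vy lz] sW]]]].
    have [P [Q [Qz hQ]]] := tens_rat oU oV ts Ux Vy.
    have [_ _ e] := hQ _ _ Qz; move: lz; rewrite e /= ljoinK mulf_eq0 negb_or => /andP[Pz _].
    exists (P * Q); first by rewrite mevalM mulf_neq0 //; move: Qz; rewrite /= ljoinK.
    move=> z'; rewrite mevalM mulf_eq0 negb_or => /andP[Pz' Qz'].
    have := hQ (exist S (lpart (sval z')) (proj1 (proj2_sig z'))) (exist T (rpart (sval z'))
      (proj2 (proj2_sig z'))).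
    rewrite /= ljoinK => /(_ Qz') [Ux' Vy' e']; apply: sW; split=> //=.
    by rewrite e' mulf_neq0 ?invr_eq0.
  move=> f rff z /= /rff [U [V [s [s' [oU oV [ts ts'] [/= Ux Vy lz] e]]]]].
  have [P [Q [Qz hQ]]] := tens_rat oU oV ts Ux Vy.
  have [P' [Q' [Qz' hQ']]] := tens_rat oU oV ts' Ux Vy.
  have [_ _ e'] := hQ' _ _ Qz'; move: lz; rewrite e' /= ljoinK mulf_eq0 negb_or => /andP[Pz _].
  rewrite /= !ljoinK in Qz Qz'.
  exists (P * Q' * Q'), (Q * P' * Q'); rewrite !mevalM !mulf_neq0 //; split=> // y Wy.
  rewrite !mevalM !mulf_eq0 !negb_or => /andP[/andP[Qy P'y] Q'y].
  have := hQ (exist S (lpart (sval y)) (proj1 (proj2_sig y))) (exist T (rpart (sval y)) (proj2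
    (proj2_sig y))).
  have := hQ' (exist S (lpart (sval y)) (proj1 (proj2_sig y))) (exist T (rpart (sval y)) (proj2
    (proj2_sig y))).
  rewrite /= ljoinK => /(_ Q'y) [Uy Vy' e1] /(_ Qy) [_ _ e2].
  rewrite e //=; last by split=> //=; rewrite e1 mulf_neq0 ?invr_eq0.
  by rewrite e1 e2; field; rewrite Qy P'y Q'y.
- move=> V oV; split.
    move=> [x y] /= /oV [p /= pz hp]; exists setT, setT, (tens p); split.
    + by case: (asp_is_space S).
    + by case: (asp_is_space T).
    + exact: tens_on.
    + by split=> //; rewrite tensE.
    + by move=> [x' y'] [] _ _; rewrite tensE => pz'; exact: hp.
  move=> f rff [x y] /= /rff [p [q [/= qz hq]]]; exists setT, setT, (tens p), (tens q); split.
  + by case: (asp_is_space S).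
  + by case: (asp_is_space T).
  + by split; exact: tens_on.
  + by split=> //; rewrite tensE.
  + by move=> [x' y'] /= Vz [] _ _; rewrite !tensE => qz'; exact: hq.
Qed.

End Product.

End AffineSubsets.

(** * Classes in the Grothendieck ring *)

Section LocallyClosed.
Variable k : fieldType.

(** Equations and inequations of locally closed sets need polynomials on the whole space; the local
    quotients of [rf] are only used for maps. *)
Definition polyf n (f : affpt k n -> k) := exists p : {mpoly k[n]}, forall x, f x = p.@[x].

Section Closure.
Variable n : nat.
Implicit Types (f g : affpt k n -> k) (S T : set (affpt k n)).

Lemma polyf_cst c : polyf (fun _ : affpt k n => c).
Proof. by exists c%:MP => x; rewrite mevalC. Qed.

Lemma polyf_coord i : polyf (fun x : affpt k n => x i).
Proof. by exists 'X_i => x; rewrite mevalXU. Qed.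

Lemma polyfD f g : polyf f -> polyf g -> polyf (fun x => f x + g x).
Proof. by move=> [p hp] [q hq]; exists (p + q) => x; rewrite mevalD hp hq. Qed.

Lemma polyfM f g : polyf f -> polyf g -> polyf (fun x => f x * g x).
Proof. by move=> [p hp] [q hq]; exists (p * q) => x; rewrite mevalM hp hq. Qed.

Lemma polyf_rf S f : polyf f -> rf S f.
Proof. by move=> [p hp]; have := rf_poly (S := S) p; apply: rf_ext => x _; rewrite hp. Qed.

Lemma lc_eq0 f : polyf f -> locally_closed [set x | f x = 0].
Proof.
move=> [p hp]; exists [:: p], [:: 1]; apply/seteqP; split=> x /=.
  move=> fx; split; first by move=> q; rewrite inE => /eqP ->; rewrite -hp.
  by move=> /(_ 1); rewrite inE eqxx meval1 => /(_ isT)/eqP; rewrite oner_eq0.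
by move=> [zp _]; rewrite hp; apply: zp; rewrite inE.
Qed.

Lemma lc_neq0 f : polyf f -> locally_closed [set x | f x <> 0].
Proof.
move=> [p hp]; exists [::], [:: p]; apply/seteqP; split=> x /=.
  by move=> fx; split=> // zp; apply: fx; rewrite hp; apply: zp; rewrite inE.
by move=> [_ zp] fx; apply: zp => q; rewrite inE => /eqP ->; rewrite -hp.
Qed.

Lemma lcI S T : locally_closed S -> locally_closed T -> locally_closed (S `&` T).
Proof.
move=> [ps [qs ->]] [ps' [qs' ->]]; exists (ps ++ ps'), [seq q * q' | q <- qs, q' <- qs'].
apply/seteqP; split=> x.
  move=> [[zp nq] [zp' nq']]; split.
    by move=> p; rewrite mem_cat => /orP[/zp|/zp'].
  move=> z; apply: nq => q qqs; apply: contrapT => /eqP nz; apply: nq' => q' q'qs'.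
  have /eqP := z (q * q') (allpairs_f _ qqs q'qs').
  by rewrite mevalM mulf_eq0 (negbTE nz) => /eqP.
move=> [zp nq]; split; split.
- by move=> p pps; apply: zp; rewrite mem_cat pps.
- by move=> z; apply: nq => _ /allpairsP [[q q'] /= [qqs _ ->]]; rewrite mevalM z // mul0r.
- by move=> p pps; apply: zp; rewrite mem_cat pps orbT.
- by move=> z; apply: nq => _ /allpairsP [[q q'] /= [_ qqs ->]]; rewrite mevalM (z q') // mulr0.
Qed.

Lemma lcT : locally_closed [set: affpt k n].
Proof. by have := lc_eq0 (polyf_cst 0); congr locally_closed; apply/seteqP; split. Qed.

Lemma lc_set0 : locally_closed (@set0 (affpt k n)).
Proof. by have := lc_neq0 (polyf_cst 0); congr locally_closed; apply/seteqP; split. Qed.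

Lemma lc_all (J : Type) (s : seq J) (Q : J -> set (affpt k n)) :
  (forall j, locally_closed (Q j)) -> locally_closed [set x | List.Forall (fun j => Q j x) s].
Proof.
move=> h; elim: s => [|j s IH].
  by have := lcT; congr locally_closed; apply/seteqP; split=> x //= _; constructor.
have := lcI (h j) IH; congr locally_closed; apply/seteqP; split=> x.
  by move=> [] ? ?; constructor.
by move=> /= H; inversion H.
Qed.

Lemma lc_forall (J : finType) (Q : J -> set (affpt k n)) :
  (forall j, locally_closed (Q j)) -> locally_closed [set x | forall j, Q j x].
Proof.
move=> h; have := lc_all (enum J) h; congr locally_closed; apply/seteqP; split=> x /=.
  by move=> /List.Forall_forall H j; apply: H; have := mem_enum J j;
    elim: (enum J) => //= a s IH; rewrite inE => /orP[/eqP ->|/IH]; [left|right].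
by move=> H; apply/List.Forall_forall.
Qed.

Lemma lc_exists (J : finType) (f : J -> affpt k n -> k) :
  (forall j, polyf (f j)) -> locally_closed [set x | exists j, f j x <> 0].
Proof.
move=> h; pose p j := projT1 (cid (h j)); have hp j x : f j x = (p j).@[x].
  by rewrite /p; case: cid.
exists [::], [seq p j | j <- enum J]; apply/seteqP; split=> x /=.
  by move=> [j nz]; split=> // z; apply: nz; rewrite hp; apply: z; apply: map_f; rewrite mem_enum.
move=> [_ nz]; apply: contrapT => h'; apply: nz => _ /mapP [j _ ->].
by rewrite -hp; apply: contrapT => nz; apply: h'; exists j.
Qed.

Lemma polyf_sum (J : Type) (r : seq J) (F : J -> affpt k n -> k) :
  (forall j, polyf (F j)) -> polyf (fun x => \sum_(j <- r) F j x).
Proof.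
move=> h; pose p j := projT1 (cid (h j)); have hp j x : F j x = (p j).@[x].
  by rewrite /p; case: cid.
by exists (\sum_(j <- r) p j) => x; rewrite raddf_sum; apply: eq_bigr => j _; rewrite hp.
Qed.

End Closure.

Lemma polyf_comp n m (h : affpt k n -> affpt k m) g :
  (forall i, polyf (fun x => h x i)) -> polyf g -> polyf (g \o h).
Proof.
move=> hh [q hq]; pose p i := projT1 (cid (hh i)); have hp i x : h x i = (p i).@[x].
  by rewrite /p; case: cid.
exists (mmap (fun c => c%:MP) p q) => x; rewrite /= hq.
rewrite /mmap raddf_sum mevalE /=; apply: eq_bigr => e _.
rewrite mevalM mevalC; congr (_ * _); rewrite /mmap1 rmorph_prod; apply: eq_bigr => i _.
by rewrite rmorphXn /= hp.
Qed.

Lemma lc_preimage n m (h : affpt k n -> affpt k m) S :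
  (forall i, polyf (fun x => h x i)) -> locally_closed S -> locally_closed (h @^-1` S).
Proof.
move=> hh [ps [qs ->]].
have pb (p : {mpoly k[m]}) : {p' : {mpoly k[n]} | forall x, p'.@[x] = p.@[h x]}.
  apply: cid; have [p' hp'] := @polyf_comp _ _ h (fun y => p.@[y]) hh (ex_intro _ p (fun=> erefl)).
  by exists p' => x; rewrite -hp'.
exists [seq sval (pb p) | p <- ps], [seq sval (pb p) | p <- qs].
have E rs : h @^-1` zeros rs = zeros [seq sval (pb p) | p <- rs].
  apply/seteqP; split=> x /= z.
    by move=> _ /mapP [p pr ->]; rewrite (svalP (pb p)); exact: z.
  by move=> p pr; rewrite -(svalP (pb p)); apply: z; exact: map_f.
by rewrite -!E.
Qed.

End LocallyClosed.

Section Classes.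
Variable k : fieldType.

Lemma vclass_iso (X Y : fspace k) : isomorphic X Y -> vclass X = vclass Y.
Proof.
move=> iso; rewrite /vclass; congr (xget _ _); apply/seteqP; split=> v [V h ->]; exists V => //.
  exact: isomorphic_trans iso.
exact: isomorphic_trans (isomorphic_sym iso).
Qed.

Lemma vclassE (V : variety k) (X : fspace k) : isomorphic (vspace V) X ->
  vclass X = pgen (@vrel k) V.
Proof.
move=> iso; apply: xget_unique; first by exists V.
move=> _ [W h ->]; apply: pres_eq; apply: RC_rel; apply: VR_iso.
exact: isomorphic_trans h (isomorphic_sym iso).
Qed.

(** The generators of the Grothendieck ring live on sets of sequences of scalars, so the structure
    of X is carried to the image of an injection into them. *)
Lemma variety_of (X : fspace k) (e : pt X -> seq k) : injective e -> is_variety X ->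
  exists V : variety k, isomorphic (vspace V) X.
Proof.
move=> inj vX; pose P : set (seq k) := range e.
have hP x : P (e x) by exists x.
pose h x : {s | P s} := exist P (e x) (hP x).
pose h' (s : {s | P s}) : pt X := s2val (cid2 (proj2_sig s)).
have a : cancel h h' by move=> x; apply: inj; rewrite /h'; case: cid2.
have b : cancel h' h by move=> s; apply: sig_eq; rewrite /h /= /h'; case: cid2.
pose Y := @FSpace k {s | P s} [set V | zopen (h @^-1` V)] (fun V => [set f : {s | P s} -> k | reg
  (h @^-1` V) (f \o h)]).
have mh : @is_morphism k X Y h by [].
have mh' : @is_morphism k Y X h'.
  move=> V oV; have E : h @^-1` (h' @^-1` V) = V by apply/seteqP; split=> x /=; rewrite a.
  split; first by rewrite /= E.
  move=> g rg /=; rewrite E; have -> // : (g \o h') \o h = g by apply/funext => x /=; rewrite a.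
have iso : isomorphic X Y by exists h, h'.
exists (@Variety k P _ _ (isomorphic_variety iso vX)).
exact: isomorphic_sym.
Qed.

Definition vcl n (S : set (affpt k n)) : Groth k := vclass (asp S).

Lemma lc_var n (S : set (affpt k n)) : locally_closed S ->
  exists V : variety k, isomorphic (vspace V) (asp S).
Proof.
move=> lS; apply: (@variety_of (asp S) (fun x : {x | S x} => [seq sval x i | i <- enum 'I_n]));
  last exact: asp_variety.
move=> x y e; apply: sig_eq; apply/funext => i.
have /eq_in_map h := e; apply: h.
by rewrite mem_enum.
Qed.

Lemma vcl_cut n (S : set (affpt k n)) (f : affpt k n -> k) : locally_closed S -> polyf f ->
  vcl S = vcl (S `&` [set x | f x = 0]) + vcl (S `&` [set x | f x <> 0]).
Proof.
move=> lS pf; have [X [g [g' [a b mg mg']]]] := lc_var lS.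
have [V hV] := lc_var (lcI lS (lc_eq0 pf)); have [W hW] := lc_var (lcI lS (lc_neq0 pf)).
rewrite /vcl (vclassE hV) (vclassE hW) (@vclassE X) //; last by exists g, g'.
rewrite /pgen -[RHS]/(pres_add _ _) pres_addE; apply: pres_eq; apply: RC_rel.
apply: (@VR_cut _ _ _ _ [set x | f (sval (g x)) = 0]).
- have := mg [set x | f (sval x) <> 0]; case=> //.
  move=> [x Sx] /= fx; have [p hp] := pf; exists p; first by rewrite -hp; exact/eqP.
  by move=> y py; apply/eqP; rewrite hp.
- apply: isomorphic_trans hV _; apply: isomorphic_trans (isomorphic_sym (induced_asp _ _)) _.
  by apply: (@induced_isomorphic k (asp S) (vspace X) _ _ g' g) => // x /=; rewrite b.
- apply: isomorphic_trans hW _; apply: isomorphic_trans (isomorphic_sym (induced_asp _ _)) _.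
  by apply: (@induced_isomorphic k (asp S) (vspace X) _ _ g' g) => // x /=; rewrite b.
Qed.

(** Cutting the empty set into two empty pieces shows that its class v satisfies v = v + v. *)
Lemma vcl_set0 n : vcl (@set0 (affpt k n)) = 0.
Proof.
have := vcl_cut (lc_set0 k n) (polyf_cst n 0); rewrite !set0I => /eqP.
by rewrite -subr_eq subrr => /eqP.
Qed.

Lemma vcl_prod n m (S : set (affpt k n)) (T : set (affpt k m)) :
  locally_closed S -> locally_closed T -> vcl (Sprod S T) = vcl S * vcl T.
Proof.
move=> lS lT; have lP : locally_closed (Sprod S T).
  apply: (@lcI k _ (@lpart k n m @^-1` S) (@rpart k n m @^-1` T)); apply: lc_preimage => // i;
    exact: polyf_coord.
have [P hP] := lc_var lP; have [V hV] := lc_var lS; have [W hW] := lc_var lT.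
rewrite /vcl (vclassE hV) (vclassE hW) (vclassE hP).
rewrite /pgen -[RHS]/(pres_mul _ _) pres_mulE; apply: pres_eq; apply: RC_rel; apply: VR_prod.
apply: isomorphic_trans hP _; apply: isomorphic_trans (asp_prod _ _) _.
exact: prod_isomorphic (isomorphic_sym hV) (isomorphic_sym hW).
Qed.

Lemma asp_setT n : isomorphic (asp [set: affpt k n]) (affine_space k n).
Proof.
exists sval, (fun x => exist setT x I); split=> //.
- by move=> [x []].
- move=> V oV; split; first by move=> [x []] /= /oV [p px hp]; exists p => // -[y []] /= /hp.
  by move=> f rff [x []] /= /rff [p [q [qx hq]]]; exists p, q; split=> // -[y []] /=; exact: hq.
- move=> V oV; split; first by move=> x /= /oV [p px hp]; exists p => // y /= py; exact: hp.
  by move=> f rff x /= /rff [p [q [qx hq]]]; exists p, q; split=> // y /=; exact: hq.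
Qed.

Lemma vcl_pt : vcl [set: affpt k 0] = 1.
Proof.
have [V hV] := lc_var (lcT k 0); rewrite /vcl (vclassE hV); apply: pres_eq; apply: RC_rel.
by apply: VR_pt; exact: isomorphic_trans hV (asp_setT _).
Qed.

Lemma vcl_line : vcl [set: affpt k 1] = Lef k.
Proof. exact: vclass_iso (asp_setT _). Qed.

Lemma vcl_affine n : vcl [set: affpt k n] = Lef k ^+ n.
Proof.
elim: n => [|n IH]; first exact: vcl_pt.
rewrite exprS -IH -vcl_line -vcl_prod; [|exact: lcT|exact: lcT].
by rewrite /vcl; congr (vclass (asp _)); apply/seteqP; split.
Qed.

Lemma vcl_iso n m (S : set (affpt k n)) (T : set (affpt k m)) h h' :
  (forall x, S x -> T (h x)) -> (forall y, T y -> S (h' y)) ->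
  (forall x, S x -> h' (h x) = x) -> (forall y, T y -> h (h' y) = y) ->
  (forall i, rf S (fun x => h x i)) -> (forall i, rf T (fun y => h' y i)) ->
  vcl S = vcl T.
Proof. by move=> *; apply: vclass_iso; exact: (@asp_isomorphic _ _ _ _ _ h h'). Qed.

(** The cells on which each polynomial of [ps] either vanishes or has no zero. The scissor relation
    only cuts off a closed piece; refining by atoms extends additivity to arbitrary partitions into
    locally closed sets. *)
Fixpoint atoms n (ps : seq {mpoly k[n]}) : seq (set (affpt k n)) :=
  if ps is p :: ps' then
    [seq A `&` [set x | p.@[x] = 0] | A <- atoms ps'] ++
    [seq A `&` [set x | p.@[x] <> 0] | A <- atoms ps']
  else [:: setT].

Lemma vcl_atoms n (ps : seq {mpoly k[n]}) S : locally_closed S ->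
  vcl S = \sum_(A <- atoms ps) vcl (S `&` A).
Proof.
elim: ps S => [|p ps IH] S lS; first by rewrite big_seq1 setIT.
have pp : polyf (fun x => p.@[x]) by exists p.
rewrite (vcl_cut lS pp) IH ?(IH (_ `&` _)) /=; last 2 first.
- exact: lcI lS (lc_neq0 pp).
- exact: lcI lS (lc_eq0 pp).
rewrite big_cat /= !big_map; congr (_ + _); apply: eq_bigr => A _.
  by rewrite -setIA (setIC A).
by rewrite -setIA (setIC A).
Qed.

Lemma atoms_sat n (ps : seq {mpoly k[n]}) A x y : A \in atoms ps -> A x -> A y ->
  forall p, p \in ps -> p.@[x] = 0 -> p.@[y] = 0.
Proof.
elim: ps A => [|q ps IH] A //=; rewrite mem_cat => /orP[] /mapP [B Bps ->] [Bx qx] [By qy] p;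
  rewrite inE => /orP[/eqP -> //|pps]; exact: (IH B).
Qed.

(** C is a union of [atoms ps]. *)
Definition sat n (ps : seq {mpoly k[n]}) (C : set (affpt k n)) :=
  forall x y, (forall p, p \in ps -> (p.@[x] = 0) <-> (p.@[y] = 0)) -> C x -> C y.

Lemma sat_sub n (ps qs : seq {mpoly k[n]}) C : {subset ps <= qs} -> sat ps C -> sat qs C.
Proof. by move=> s h x y e; apply: h => p pps; apply: e; exact: s. Qed.

Lemma lc_sat n (S : set (affpt k n)) : locally_closed S -> exists ps, sat ps S.
Proof.
move=> [ps [qs ->]]; exists (ps ++ qs) => x y e [zx nz]; split.
  by move=> p pps; apply/e; [rewrite mem_cat pps|exact: zx].
by move=> z; apply: nz => q qqs; apply/e; [rewrite mem_cat qqs orbT|exact: z].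
Qed.

Lemma fin_sat n (J : finType) (S : J -> set (affpt k n)) : (forall j, locally_closed (S j)) ->
  exists ps, forall j, sat ps (S j).
Proof.
move=> lS; pose ps j := projT1 (cid (lc_sat (lS j))).
have hps j : sat (ps j) (S j) by rewrite /ps; case: cid.
exists (flatten [seq ps j | j <- enum J]) => j; apply: sat_sub (hps j) => p pj.
by apply/flattenP; exists (ps j) => //; apply: map_f; rewrite mem_enum.
Qed.

(** An atom that meets C lies in exactly one piece, so after refining the pieces by atoms the sum no
    longer depends on the partition. *)
Lemma vcl_partition_atoms n (J : finType) (S : J -> set (affpt k n)) C ps :
  (forall j, locally_closed (S j)) -> (forall j, sat ps (S j)) ->
  (forall i j x, S i x -> S j x -> i = j) -> C = \bigcup_j S j ->
  \sum_j vcl (S j) = \sum_(A <- atoms ps) vcl (C `&` A).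
Proof.
move=> lS sS triv eC.
under eq_bigr => j _ do rewrite (vcl_atoms ps (lS j)).
rewrite exchange_big /=; apply: eq_big_seq => A Aps.
have [[x [Cx Ax]]|none] := pselect (exists x, (C `&` A) x); last first.
  rewrite big1 => [|j _]; first by rewrite -(vcl_set0 n); congr vcl; apply/seteqP;
    split=> // x xA; case: none; exists x.
  rewrite -(vcl_set0 n); congr vcl; apply/seteqP; split=> // x [Sx Ax]; apply: none; exists x.
  by split=> //; rewrite eC; exists j.
have [j _ Sjx] : (\bigcup_j S j) x by rewrite -eC.
have AS y : A y -> S j y.
  by move=> Ay; apply: (sS j) Sjx => p pps; split; apply: (atoms_sat Aps _ _ pps).
rewrite (bigD1 j) //= big1 ?addr0 => [|i ij].
  congr vcl; apply/seteqP; split=> y [h Ay]; split=> //; first by rewrite eC; exists j.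
  exact: AS.
rewrite -(vcl_set0 n); congr vcl; apply/seteqP; split=> // y [Sy /AS Sjy].
by move/eqP: ij; apply; exact: triv Sy Sjy.
Qed.

Lemma vcl_partition n (J : finType) (S : J -> set (affpt k n)) C :
  locally_closed C -> (forall j, locally_closed (S j)) ->
  (forall i j x, S i x -> S j x -> i = j) -> C = \bigcup_j S j ->
  vcl C = \sum_j vcl (S j).
Proof.
move=> lC lS triv eC; have [ps hps] := fin_sat lS.
by rewrite (vcl_partition_atoms lS hps triv eC) -vcl_atoms.
Qed.

(** Any two partitions of C are compared on the atoms of all the polynomials involved, so the value
    selected by [xget] is the one given by any partition. *)
Lemma cclassE n r (S : 'I_r -> set (affpt k n)) C : (forall j, locally_closed (S j)) ->
  trivIset setT S -> C = \bigcup_i S i -> cclass C = \sum_i vcl (S i).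
Proof.
have tr r' (S' : 'I_r' -> set (affpt k n)) : trivIset setT S' -> forall i j x, S' i x -> S' j x
  -> i = j.
  by move=> /trivIsetP h i j x Si Sj; apply/eqP/negPn/negP => ij;
    have /seteqP [/(_ x) h' _] := h i j I I ij; exact: h'.
move=> lS tS eC; apply: xget_unique.
  by exists r, S; split=> //; apply: eq_bigr => i _; rewrite inducedE.
move=> _ [r' [S' [lS' tS' eC' ->]]]; under eq_bigr => i _ do rewrite inducedE.
have [ps hps] := fin_sat lS; have [ps' hps'] := fin_sat lS'.
rewrite -[LHS]/(\sum_i vcl (S' i)).
rewrite (@vcl_partition_atoms _ _ S' C (ps ++ ps')) //; last 2 first.
- by move=> j; apply: sat_sub (hps' j) => p h; rewrite mem_cat h orbT.
- exact: tr.
rewrite (@vcl_partition_atoms _ _ S C (ps ++ ps')) //; last exact: tr.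
by move=> j; apply: sat_sub (hps j) => p h; rewrite mem_cat h.
Qed.

Lemma cclass_lc n (C : set (affpt k n)) : locally_closed C -> cclass C = vcl C.
Proof.
move=> lC; rewrite (@cclassE _ 1 (fun=> C)) ?big_ord1 //.
  by apply/trivIsetP => i j; rewrite !ord1 eqxx.
by apply/seteqP; split=> x; [exists ord0|case].
Qed.

(** C is a union of cells with prescribed vanishing pattern for the polynomials that define its
    possibly overlapping pieces; indexing the cells by boolean vectors makes them disjoint. *)
Lemma constructible_partition n (C : set (affpt k n)) : constructible C ->
  exists r (S : 'I_r -> set (affpt k n)),
  [/\ forall j, locally_closed (S j), trivIset setT S & C = \bigcup_i S i].
Proof.
move=> [r [S [lS eC]]]; have [ps hps] := fin_sat lS.
have sC : sat ps C by move=> x y e; rewrite eC => -[j _ Sx]; exists j => //; exact: hps Sx.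
pose E := {ffun 'I_(size ps) -> bool}.
pose A (s : E) : set (affpt k n) := [set x | forall i, ((tnth (in_tuple ps) i).@[x] == 0) = s i].
have lA s : locally_closed (A s).
  apply: lc_forall => i; have pp : polyf (fun x => (tnth (in_tuple ps) i).@[x]) by exists (tnth
    (in_tuple ps) i).
  case: (s i); [have := lc_eq0 pp|have := lc_neq0 pp]; congr locally_closed; apply/seteqP;
    split=> x /=.
  - by move=> ->; exact: eqxx.
  - by move/eqP.
  - by move/eqP/negbTE.
  - by move/negbT/eqP.
have AC s x : A s x -> C x -> A s `<=` C.
  move=> Ax Cx y Ay; apply: sC Cx => p /(nthP 0) [i hi <-].
  have := Ax (Ordinal hi); have := Ay (Ordinal hi); rewrite !(tnth_nth 0) /= => <- e.
  by split=> /eqP h; apply/eqP; rewrite -?e // e.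
exists #|E|, (fun i => C `&` A (enum_val i)); split.
- move=> j; have [[x [Cx Ax]]|none] := pselect (exists x, (C `&` A (enum_val j)) x).
    by rewrite setIC setIidl //; exact: AC Ax Cx.
  have -> : C `&` A (enum_val j) = set0 by apply/seteqP; split=> // x h; apply: none; exists x.
  exact: lc_set0.
- apply/trivIsetP => i j _ _ ij; apply/seteqP; split=> // x [[_ Ai] [_ Aj]].
  move/eqP: ij; apply; apply: enum_val_inj; apply/ffunP => l; by rewrite -Ai Aj.
- apply/seteqP; split=> [x Cx|x [i _ []] //].
  pose s : E := [ffun i => (tnth (in_tuple ps) i).@[x] == 0].
  by exists (enum_rank s) => //; split=> // i; rewrite enum_rankK ffunE.
Qed.

End Classes.

(** * Motivic measure *)

Section LocalizationTheory.
Variables (A : comPzRingType) (S : set A).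

Let to_locD : {morph @to_loc A S : a b / a + b}.
Proof.
move=> a b; rewrite /to_loc /pgen -[RHS]/(pres_add _ _) pres_addE.
by apply: pres_eq; apply: RC_rel; exact: LR_add.
Qed.

Let to_locB : {morph @to_loc A S : a b / a - b}.
Proof. by move=> a b; have := to_locD (a - b) b; rewrite subrK => ->; rewrite addrK. Qed.

Let to_locM : monoid_morphism (@to_loc A S).
Proof.
split=> [|a b]; first by apply: pres_eq; apply: RC_rel; exact: LR_one.
rewrite /to_loc /pgen -[RHS]/(pres_mul _ _) pres_mulE.
by apply: pres_eq; apply: RC_rel; exact: LR_mul.
Qed.

HB.instance Definition _ := GRing.isZmodMorphism.Build A (localization S) (@to_loc A S) to_locB.
HB.instance Definition _ := GRing.isMonoidMorphism.Build A (localization S) (@to_loc A S) to_locM.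

Lemma to_loc_unit s : S s -> exists b : localization S, to_loc S s * b = 1.
Proof.
move=> Ss; exists (pgen (@locrel A S) (LocInv (exist _ s Ss))).
rewrite /to_loc /pgen -[LHS]/(pres_mul _ _) pres_mulE.
apply: pres_eq; apply: RC_rel; exact: (LR_inv (exist _ s Ss)).
Qed.

End LocalizationTheory.

Lemma cinvP (A : comPzRingType) (a : A) : (exists b, a * b = 1) -> a * cinv a = 1.
Proof. exact: xgetPex. Qed.

Lemma cinv_eq (A : comPzRingType) (a b c : A) : (exists u, a * u = 1) -> b * a = c -> b = c *
  cinv a.
Proof. by move=> h <-; rewrite -mulrA cinvP // mulr1. Qed.

(** * Jets as points with two blocks of coordinates *)

Section Coordinates.
Variable k : fieldType.

(** Points are built from and read as two sequences, so that formulas for coefficients of series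
    apply without ordinals; coordinates out of range read as 0. *)
Definition mkpt n1 n2 (x y : nat -> k) : affpt k (n1 + n2) :=
  fun i => match fintype.split i with inl j => x j | inr j => y j end.
Arguments mkpt n1 n2 x y i : clear implicits.
Definition xs n1 n2 (z : affpt k (n1 + n2)) (m : nat) : k :=
  if insub m is Some j then z (lshift n2 j) else 0.
Definition ys n1 n2 (z : affpt k (n1 + n2)) (m : nat) : k :=
  if insub m is Some j then z (rshift n1 j) else 0.

Lemma xs_mk n1 n2 x y m : xs (mkpt n1 n2 x y) m = if (m < n1)%N then x m else 0.
Proof.
rewrite /xs; case: insubP => [j -> jm|/negbTE -> //].
by rewrite /mkpt (unsplitK (inl _ j)) jm.
Qed.

Lemma ys_mk n1 n2 x y m : ys (mkpt n1 n2 x y) m = if (m < n2)%N then y m else 0.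
Proof.
rewrite /ys; case: insubP => [j -> jm|/negbTE -> //].
by rewrite /mkpt (unsplitK (inr _ j)) jm.
Qed.

Lemma mkpt_eq n1 n2 x y x' y' : (forall m, (m < n1)%N -> x m = x' m) ->
  (forall m, (m < n2)%N -> y m = y' m) -> mkpt n1 n2 x y = mkpt n1 n2 x' y'.
Proof. by move=> hx hy; apply/funext => i; rewrite /mkpt; case: fintype.split => j;
  [exact: hx|exact: hy]. Qed.

Lemma mkptK n1 n2 (z : affpt k (n1 + n2)) : mkpt n1 n2 (xs z) (ys z) = z.
Proof.
apply/funext => i; rewrite /mkpt -[in RHS](splitK i); case: fintype.split => j /=;
by rewrite /xs /ys valK.
Qed.

Lemma polyf_xs n1 n2 m : polyf (fun z : affpt k (n1 + n2) => xs z m).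
Proof.
rewrite /xs; case: insubP => [j _ _|_]; [exact: polyf_coord|exact: polyf_cst].
Qed.

Lemma polyf_ys n1 n2 m : polyf (fun z : affpt k (n1 + n2) => ys z m).
Proof.
rewrite /ys; case: insubP => [j _ _|_]; [exact: polyf_coord|exact: polyf_cst].
Qed.

Lemma polyf_mk n n1 n2 (x y : affpt k n -> nat -> k) :
  (forall m, (m < n1)%N -> polyf (fun z => x z m)) -> (forall m, (m < n2)%N -> polyf (fun z => y
    z m)) ->
  forall i, polyf (fun z => mkpt n1 n2 (x z) (y z) i).
Proof. by move=> hx hy i; rewrite /mkpt; case: fintype.split => j; [exact: hx|exact: hy]. Qed.

Lemma rf_mk n n1 n2 (S : set (affpt k n)) (x y : affpt k n -> nat -> k) :
  (forall m, (m < n1)%N -> rf S (fun z => x z m)) -> (forall m, (m < n2)%N -> rf S (fun z => y z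
    m)) ->
  forall i, rf S (fun z => mkpt n1 n2 (x z) (y z) i).
Proof. by move=> hx hy i; rewrite /mkpt; case: fintype.split => j; [exact: hx|exact: hy]. Qed.

Lemma polyf_if n (b : bool) (f g : affpt k n -> k) : polyf f -> polyf g -> polyf (fun z => if b
  then f z else g z).
Proof. by case: b. Qed.

(** The condition C on the coefficients that follow i vanishing ones of x and j vanishing ones of y,
    as a set of longer jets. *)
Definition lift (n1 n2 i j N1 N2 : nat) (C : set (affpt k (n1 + n2))) : set (affpt k (N1 + N2)) :=
  [set z | [/\ forall m, (m < i)%N -> xs z m = 0, forall m, (m < j)%N -> ys z m = 0 &
     C (mkpt n1 n2 (fun m => xs z (i + m)) (fun m => ys z (j + m)))]].

Lemma lc_lift n1 n2 i j N1 N2 C : locally_closed C -> locally_closed (@lift n1 n2 i j N1 N2 C).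
Proof.
move=> lC.
have l1 : locally_closed [set z : affpt k (N1 + N2) | forall m : 'I_i, xs z m = 0].
  by apply: (@lc_forall k _ 'I_i (fun m => [set z | xs z m = 0])) => m; apply: lc_eq0;
    exact: polyf_xs.
have l2 : locally_closed [set z : affpt k (N1 + N2) | forall m : 'I_j, ys z m = 0].
  by apply: (@lc_forall k _ 'I_j (fun m => [set z | ys z m = 0])) => m; apply: lc_eq0;
    exact: polyf_ys.
have l3 := lc_preimage (polyf_mk (fun m (_ : (m < n1)%N) => polyf_xs N1 N2 (i + m)) (fun m (_ :
  (m < n2)%N) => polyf_ys N1 N2 (j + m))) lC.
have := lcI (lcI l1 l2) l3; congr locally_closed; apply/seteqP; split=> z.
  by move=> [[h1 h2] h3]; split=> // m hm; [exact: (h1 (Ordinal hm))|exact: (h2 (Ordinal hm))].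
by move=> [h1 h2 h3]; split=> //; split=> m; [exact: h1|exact: h2].
Qed.

(** The coordinates fall into zeros, a point of C, and d1 + d2 free ones. *)
Lemma vcl_lift n1 n2 i j d1 d2 C : locally_closed C ->
  vcl (@lift n1 n2 i j (i + n1 + d1) (j + n2 + d2) C) = vcl C * Lef k ^+ (d1 + d2).
Proof.
move=> lC; rewrite -vcl_affine -vcl_prod //; last exact: lcT.
set N1 := (i + n1 + d1)%N; set N2 := (j + n2 + d2)%N.
pose h (z : affpt k (N1 + N2)) : affpt k (n1 + n2 + (d1 + d2)) :=
  ljoin (mkpt n1 n2 (fun m => xs z (i + m)) (fun m => ys z (j + m)))
        (mkpt d1 d2 (fun m => xs z (i + n1 + m)) (fun m => ys z (j + n2 + m))).
(* Concatenation of a zeros, b values of f, and then g. *)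
pose px a b (f : nat -> k) (g : nat -> k) : nat -> k := fun m =>
  if (m < a)%N then 0 else if (m < a + b)%N then f (m - a)%N else g (m - (a + b))%N : k.
pose h' (w : affpt k (n1 + n2 + (d1 + d2))) : affpt k (N1 + N2) :=
  mkpt N1 N2 (px i n1 (xs (lpart w)) (xs (rpart w))) (px j n2 (ys (lpart w)) (ys (rpart w))).
have px1 a b f g m : (m < b)%N -> px a b f g (a + m)%N = f m.
  by move=> hm; rewrite /px ltnNge leq_addr /= ltn_add2l hm addKn.
have px2 a b f g m : px a b f g (a + b + m)%N = g m.
  by rewrite /px !ltnNge leq_addr -addnA leq_addr /= addnA addKn.
have E w m : (m < n1)%N -> xs (h' w) (i + m) = xs (lpart w) m.
  by move=> hm; rewrite xs_mk px1 // ifT //; rewrite /N1; lia.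
have E' w m : (m < n2)%N -> ys (h' w) (j + m) = ys (lpart w) m.
  by move=> hm; rewrite ys_mk px1 // ifT //; rewrite /N2; lia.
apply: (@vcl_iso _ _ _ _ _ h h').
- by move=> z [_ _ Cz]; split=> //; rewrite lpartK.
- move=> w [Cw _]; split.
  + by move=> m hm; rewrite xs_mk /px hm if_same.
  + by move=> m hm; rewrite ys_mk /px hm if_same.
  + by move: Cw; congr C; rewrite -[LHS]mkptK; apply: mkpt_eq => m hm; rewrite ?E ?E'.
- move=> z [z1 z2 _]; rewrite /h' /h lpartK rpartK -[RHS]mkptK; apply: mkpt_eq => m hm.
  + rewrite /px; case: ltnP => h1; first by rewrite z1.
    by case: ltnP => h2; rewrite xs_mk ifT ?subnKC //; rewrite /N1 in hm; lia.
  + rewrite /px; case: ltnP => h1; first by rewrite z2.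
    by case: ltnP => h2; rewrite ys_mk ifT ?subnKC //; rewrite /N2 in hm; lia.
- move=> w _; rewrite /h -[RHS]ljoinK; congr ljoin.
  + by rewrite -[RHS]mkptK; apply: mkpt_eq => m hm; rewrite ?E ?E'.
  + rewrite -[RHS]mkptK; apply: mkpt_eq => m hm.
      by rewrite xs_mk px2 ifT //; rewrite /N1; lia.
    by rewrite ys_mk px2 ifT //; rewrite /N2; lia.
- move=> l; apply: polyf_rf; rewrite /h /ljoin; case: fintype.split => a.
    by apply: polyf_mk => m _; [exact: polyf_xs|exact: polyf_ys].
  by apply: polyf_mk => m _; [exact: polyf_xs|exact: polyf_ys].
- have pl g : polyf g -> polyf (fun w : affpt k (n1 + n2 + (d1 + d2)) => g (lpart w)).
    by apply: polyf_comp => a; exact: polyf_coord.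
  have pr g : polyf g -> polyf (fun w : affpt k (n1 + n2 + (d1 + d2)) => g (rpart w)).
    by apply: polyf_comp => a; exact: polyf_coord.
  move=> l; apply: polyf_rf; apply: polyf_mk => m _; rewrite /px.
    apply: polyf_if; first exact: polyf_cst.
    apply: polyf_if; first exact: (pl (fun z => xs z (m - i)%N) (polyf_xs _ _ _)).
    exact: (pr (fun z => xs z (m - (i + n1))%N) (polyf_xs _ _ _)).
  apply: polyf_if; first exact: polyf_cst.
  apply: polyf_if; first exact: (pl (fun z => ys z (m - j)%N) (polyf_ys _ _ _)).
  exact: (pr (fun z => ys z (m - (j + n2))%N) (polyf_ys _ _ _)).
Qed.

End Coordinates.
Arguments mkpt {k} n1 n2 x y i.
Arguments lift {k n1 n2} i j N1 N2 C _.

Section Measure.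
Variable k : fieldType.
Local Notation ell := (cinv (Lloc k)).

Lemma Lloc_unit : Lloc k * ell = 1.
Proof. by apply: cinvP; exact: to_loc_unit. Qed.

Lemma LpowN m : Lpow k (- m%:Z) = ell ^+ m.
Proof. by case: m => [|m] //; rewrite oppr0 /= !expr0. Qed.

Lemma LlocXV m : Lloc k ^+ m * ell ^+ m = 1.
Proof. by rewrite -exprMn Lloc_unit expr1n. Qed.

Definition trunc_arc n1 n2 (z : affpt k (n1 + n2)) : arc k :=
  (Fps (fun m => if m is m'.+1 then xs z m' else 0), Fps (fun m => if m is m'.+1 then ys z m'
    else 0)).

Lemma trunc_arc0 n1 n2 (z : affpt k (n1 + n2)) : arcs0 (trunc_arc z).
Proof. by []. Qed.

Lemma jetE n phi : @jet k n phi = mkpt n n (fun m => coef phi.1 m.+1) (fun m => coef phi.2 m.+1).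
Proof. by []. Qed.

Lemma jet_trunc n n1 n2 (z : affpt k (n1 + n2)) : @jet k n (trunc_arc z) = mkpt n n (xs z) (ys z).
Proof. by []. Qed.

Lemma cclass_lift n N (C : set (affpt k (n + n))) : constructible C ->
  cclass (lift 0 0 (n + N) (n + N) C) = cclass C * Lef k ^+ (N + N).
Proof.
move=> /constructible_partition [r [S [lS tS eC]]].
rewrite (cclassE lS tS eC) (@cclassE _ _ _ (fun i => lift 0 0 (n + N) (n + N) (S i))).
- by rewrite mulr_suml; apply: eq_bigr => i _; exact: (@vcl_lift _ _ _ 0 0).
- by move=> j; exact: lc_lift.
- apply/trivIsetP => i j _ _ ij; apply/seteqP; split=> // z [[_ _ Si] [_ _ Sj]].
  by have /trivIsetP/(_ i j I I ij)/seteqP [h _] := tS; exact: (h _ (conj Si Sj)).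
- apply/seteqP; split=> z.
    by move=> [h1 h2]; rewrite eC => -[i _ Si]; exists i.
  by move=> [i _ [h1 h2 h3]]; split=> //; rewrite eC; exists i.
Qed.

(** Two presentations of the same set of arcs, at levels n and n', are lifted to level n + n'. There
    both give the set of jets whose truncated arc belongs to the set, and the powers of L gained by
    lifting cancel against the normalization. *)
Lemma motmeasE n (C : set (affpt k (n + n))) : constructible C ->
  motmeas (cylinder C) = to_loc [set Lef k] (cclass C) * ell ^+ (n + n).
Proof.
move=> cC; apply: xget_unique.
  by exists n, C; split=> //; rewrite LpowN mul2n -addnn.
move=> _ [n' [C' [cC' e ->]]]; rewrite LpowN mul2n -addnn.
have key m (D : set (affpt k (m + m))) N : constructible D ->
   to_loc [set Lef k] (cclass D) * ell ^+ (m + m) =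
   to_loc [set Lef k] (cclass (lift 0 0 (m + N) (m + N) D)) * ell ^+ (m + N + (m + N)).
  move=> cD; rewrite cclass_lift // rmorphM rmorphXn /= -/(Lloc k) addnACA (exprD ell (m + m) (N
    + N)).
  by rewrite -!mulrA; congr (_ * _); rewrite mulrCA LlocXV mulr1.
rewrite (key _ _ n cC') (key _ _ n' cC).
suff: lift 0 0 (n + n') (n + n') C = lift 0 0 (n + n') (n + n') C' by rewrite addnC => ->.
have E m N1 N2 (D : set (affpt k (m + m))) : lift 0 0 N1 N2 D = [set z | cylinder D (trunc_arc z)].
  apply/seteqP; split=> z; first by move=> [_ _ Dz]; split; [exact: trunc_arc0|exact: Dz].
  by move=> [_ Dz]; split.
by rewrite !E e.
Qed.

(** [phi = (t^(i+1) X, t^(j+1) Y)] with the first coefficients of X and Y in [C]. *)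
Definition jets_in n1 n2 i j (C : set (affpt k (n1 + n2))) : set (arc k) :=
  [set phi | [/\ arcs0 phi, forall m, (m < i)%N -> coef phi.1 m.+1 = 0,
     forall m, (m < j)%N -> coef phi.2 m.+1 = 0 &
     C (mkpt n1 n2 (fun m => coef phi.1 (i + m).+1) (fun m => coef phi.2 (j + m).+1))]].

Lemma lc_constructible n (C : set (affpt k n)) : locally_closed C -> constructible C.
Proof.
by move=> lC; exists 1, (fun=> C); split=> //; apply/seteqP; split=> x; [exists ord0|case].
Qed.

Lemma motmeas_lc n (C : set (affpt k (n + n))) : locally_closed C ->
  motmeas (cylinder C) = to_loc [set Lef k] (vcl C) * ell ^+ (n + n).
Proof. by move=> lC; rewrite motmeasE ?cclass_lc //; exact: lc_constructible. Qed.

(** The exponent counts the coefficients that the condition sees: i + n1 of x and j + n2 of y. *)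
Lemma motmeas_jets n1 n2 i j (C : set (affpt k (n1 + n2))) : locally_closed C ->
  motmeas (jets_in i j C) = to_loc [set Lef k] (vcl C) * ell ^+ (i + n1 + (j + n2)).
Proof.
(* Cylinders use equally many coefficients of x and of y; this level is large enough for both. *)
move=> lC; pose N := (i + n1 + (j + n2))%N.
have -> : jets_in i j C = @cylinder k N (lift i j N N C).
  apply/seteqP; split=> phi.
    move=> [a0 h1 h2 h3]; split=> //; rewrite /= jetE; split.
    + by move=> m hm; rewrite xs_mk h1 // if_same.
    + by move=> m hm; rewrite ys_mk h2 // if_same.
    + move: h3; congr C; apply: mkpt_eq => m hm; rewrite ?xs_mk ?ys_mk ifT //; rewrite /N; lia.
  move=> [a0] /=; rewrite jetE => -[h1 h2 h3]; split=> //.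
  + move=> m hm; have := h1 _ hm; rewrite xs_mk ifT //; rewrite /N; lia.
  + move=> m hm; have := h2 _ hm; rewrite ys_mk ifT //; rewrite /N; lia.
  + move: h3; congr C; apply: mkpt_eq => m hm; rewrite ?xs_mk ?ys_mk ifT //; rewrite /N; lia.
rewrite motmeas_lc; last exact: lc_lift.
have -> : vcl (lift i j N N C) = vcl C * Lef k ^+ (j + n2 + (i + n1)).
  have gen N' : N' = (j + n2 + (i + n1))%N ->
      vcl (lift i j N N' C) = vcl C * Lef k ^+ (j + n2 + (i + n1)) by move=> ->; exact: vcl_lift.
  by apply: gen; rewrite /N addnC.
rewrite rmorphM rmorphXn /= -mulrA; congr (_ * _).
by rewrite -/(Lloc k) [(j + n2 + _)%N]addnC -/N exprD mulrA LlocXV mul1r.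
Qed.

Lemma motmeas_set0 : motmeas (@set0 (arc k)) = 0.
Proof.
have -> : @set0 (arc k) = @cylinder k 0 set0 by apply/seteqP; split=> // phi [].
by rewrite motmeas_lc ?vcl_set0 ?rmorph0 ?mul0r //; exact: lc_set0.
Qed.

Definition lcyl n (A : set (arc k)) := exists2 C, locally_closed C & A = @cylinder k n C.

Lemma motmeas_partition n (J : finType) (A : J -> set (arc k)) B :
  lcyl n B -> (forall j, lcyl n (A j)) -> (forall i j phi, A i phi -> A j phi -> i = j) ->
  B = \bigcup_j A j -> motmeas B = \sum_j motmeas (A j).
Proof.
move=> [C lC eC] hA triv eB.
pose D j := s2val (cid2 (hA j)).
have lD j : locally_closed (D j) by rewrite /D; case: cid2.
have eD j : A j = cylinder (D j) by rewrite /D; case: cid2.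
have cE (E : set (affpt k (n + n))) z : cylinder E (trunc_arc z) <-> E z.
  by rewrite /cylinder /= jet_trunc mkptK; split=> [[] //|]; split.
rewrite eC motmeas_lc // (@vcl_partition _ _ _ D C) //; last 2 first.
- by move=> i j x Di Dj; apply: (triv i j (trunc_arc x)); rewrite eD cE.
- apply/seteqP; split=> z.
    move=> /cE; rewrite -eC eB => -[j _]; rewrite eD => /cE Dz; by exists j.
  by move=> [j _ Dz]; apply/cE; rewrite -eC eB; exists j => //; rewrite eD; apply/cE.
rewrite rmorph_sum mulr_suml; apply: eq_bigr => j _.
by rewrite eD motmeas_lc.
Qed.

End Measure.

(** * Power series and arcs *)

Section PowerSeries.
Variable A : comPzRingType.
Implicit Types f g x y : fps A.

(** The two conventions differ by one: [cong n] controls the coefficient of t^n, [ordge n] does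
    not. *)
Definition cong n f g := forall m, (m <= n)%N -> coef f m = coef g m.
Definition ordge n f := forall m, (m < n)%N -> coef f m = 0.

Lemma cong_refl n f : cong n f f. Proof. by []. Qed.
Lemma cong_sym n f g : cong n f g -> cong n g f. Proof. by move=> h m hm; rewrite h. Qed.
Lemma cong_trans n g f h : cong n f g -> cong n g h -> cong n f h.
Proof. by move=> a b m hm; rewrite a ?b. Qed.

Lemma congM n f f' g g' : cong n f f' -> cong n g g' -> cong n (f * g) (f' * g').
Proof.
move=> hf hg m hm; apply: eq_bigr => i _; rewrite hf ?hg //; first lia.
by have := ltn_ord i; lia.
Qed.

Lemma congD n f f' g g' : cong n f f' -> cong n g g' -> cong n (f + g) (f' + g').
Proof. by move=> hf hg m hm; rewrite /= hf ?hg. Qed.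

Lemma congX n f f' a : cong n f f' -> cong n (f ^+ a) (f' ^+ a).
Proof. by move=> h; elim: a => [|a IH] //; rewrite !exprS; exact: congM. Qed.

Lemma coef_sum (J : Type) (r : seq J) (P : pred J) (F : J -> fps A) n :
  coef (\sum_(j <- r | P j) F j) n = \sum_(j <- r | P j) coef (F j) n.
Proof. by apply: (big_morph (fun f => coef f n)). Qed.

Lemma coefD f g n : coef (f + g) n = coef f n + coef g n. Proof. by []. Qed.
Lemma coefN f n : coef (- f) n = - coef f n. Proof. by []. Qed.
Lemma coef0 n : coef (0 : fps A) n = 0. Proof. by []. Qed.
Lemma coef1 n : coef (1 : fps A) n = (n == 0%N)%:R. Proof. by []. Qed.
Lemma coef_mul f g n : coef (f * g) n = \sum_(i < n.+1) coef f i * coef g (n - i)%N.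
Proof. by []. Qed.

Lemma coef_term c i m : coef (fps_term c i : fps A) m = if m == i then c else 0.
Proof. by []. Qed.

Lemma sum_pick N i (F : nat -> A) : (i < N)%N ->
  (forall a, a != i -> F a = 0) -> \sum_(a < N) F a = F i.
Proof.
move=> iN F0; rewrite (bigD1 (Ordinal iN)) //= big1 ?addr0 // => a ai.
by apply: F0; apply: contraNneq ai => ai; apply/eqP/val_inj.
Qed.

Lemma coef_termM c i f m :
  coef (fps_term c i * f) m = if (m < i)%N then 0 else c * coef f (m - i)%N.
Proof.
rewrite coef_mul; case: ltnP => h.
  by rewrite big1 // => j _; rewrite coef_term ifN ?mul0r //; have := ltn_ord j;
    apply: contraTneq => ->; lia.
rewrite (bigD1 (inord i)) //= inordK // eqxx big1 ?addr0 // => j ji.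
rewrite ifN ?mul0r //; apply: contraNneq ji => <-; apply/eqP/val_inj; rewrite /= inordK //.
Qed.

Lemma fps_term_mul c d i j : (fps_term c i * fps_term d j : fps A) = fps_term (c * d) (i + j).
Proof.
apply: fpsP => m; rewrite coef_termM !coef_term; case: ltnP => h; first by rewrite ifN //; lia.
have -> : (m - i == j)%N = (m == i + j)%N by lia.
by case: ifP => //; rewrite mulr0.
Qed.

Lemma fps_termX c i n : (fps_term c i : fps A) ^+ n = fps_term (c ^+ n) (i * n).
Proof.
elim: n => [|n IH]; last by rewrite !exprS IH fps_term_mul mulnS.
by rewrite muln0 !expr0; apply: fpsP => m; rewrite coef_term coef1; case: eqP.
Qed.

Lemma fps_term_1 : fps_term 1 0 = 1 :> fps A.
Proof. by apply: fpsP => m; rewrite coef_term coef1; case: eqP. Qed.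

Lemma fps_termD c d i : (fps_term (c + d) i : fps A) = fps_term c i + fps_term d i.
Proof. by apply: fpsP => m; rewrite coefD !coef_term; case: eqP => _; rewrite ?addr0. Qed.

Lemma coef_cstM c f m : coef (fps_term c 0 * f) m = c * coef f m.
Proof. by rewrite coef_termM subn0. Qed.

Lemma lead_mul i j f g : ordge i f -> ordge j g ->
  ordge (i + j) (f * g) /\ coef (f * g) (i + j) = coef f i * coef g j.
Proof.
move=> hf hg; split=> [m hm|]; rewrite coef_mul.
  rewrite big1 // => l _; have [li|li] := ltnP l i; first by rewrite hf ?mul0r.
  by rewrite hg ?mulr0 //; have := ltn_ord l; lia.
rewrite (bigD1 (inord i)) //= inordK ?ltnS ?leq_addr // addKn big1 ?addr0 // => l hl.
have [li|li] := ltnP l i; first by rewrite hf ?mul0r.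
have ne : nat_of_ord l <> i by move=> e; case/eqP: hl; apply/val_inj; rewrite /= inordK //; lia.
by rewrite hg ?mulr0 //; have := ltn_ord l; lia.
Qed.

Lemma lead_exp i f a : ordge i f ->
  ordge (i * a) (f ^+ a) /\ coef (f ^+ a) (i * a) = coef f i ^+ a.
Proof.
move=> hf; elim: a => [|a [IH1 IH2]]; first by rewrite muln0 expr0; split.
by rewrite !exprS mulnS; have [h ->] := lead_mul hf IH1; rewrite IH2.
Qed.

Lemma lead_mono i j x y a b : ordge i x -> ordge j y ->
  ordge (i * a + j * b) (x ^+ a * y ^+ b) /\
  coef (x ^+ a * y ^+ b) (i * a + j * b) = coef x i ^+ a * coef y j ^+ b.
Proof.
move=> hx hy; have [h1 e1] := lead_exp a hx; have [h2 e2] := lead_exp b hy.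
by have [h ->] := lead_mul h1 h2; rewrite e1 e2.
Qed.

Lemma orderP f n : order f = Some n <-> coef f n != 0 /\ ordge n f.
Proof.
rewrite /order; case: pselect => [ex|nex].
  case: ex_minnP => m m0 mmin; split=> [[<-]|[n0 on]].
    split=> // l lm; apply/eqP/negPn/negP => /mmin; lia.
  congr Some; apply/eqP; rewrite eqn_leq mmin // leqNgt; apply/negP => /on e.
  by rewrite e eqxx in m0.
by split=> // -[n0 _]; case: nex; exists n.
Qed.

(** Passes from the indexing of a Cauchy product by total degree to a square of independent indices,
    the terms outside the triangle being zero. *)
Lemma triangle_sum n (F : nat -> nat -> A) :
  (forall a b, (n < a + b)%N -> F a b = 0) ->
  \sum_(a < n.+1) \sum_(i < a.+1) F i (a - i)%N = \sum_(a < n.+1) \sum_(b < n.+1) F a b.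
Proof.
move=> F0; transitivity (\sum_(a < n.+1) \sum_(i < n.+1 | (i <= a)%N) F i (a - i)%N).
  by apply: eq_bigr => a _; rewrite (big_ord_narrow_leq (leq_ord a)).
rewrite (exchange_big_dep predT) //=; apply: eq_bigr => i _.
rewrite -(big_mkord (fun a => i <= a)%N (fun a => F i (a - i)%N)).
rewrite -(big_mkord predT (fun b => F i b)).
rewrite (@big_cat_nat _ _ _ i) //=; last exact: ltnW.
rewrite big_nat_cond big1 ?add0r; last by move=> a; lia.
rewrite -{1}[nat_of_ord i]add0n big_addn.
rewrite [RHS](@big_cat_nat _ _ _ (n.+1 - i)) //=; last exact: leq_subr.
rewrite [X in _ = _ + X]big_nat_cond [X in _ = _ + X]big1 ?addr0; last first.
  by move=> b h; apply: F0; have := ltn_ord i; lia.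
rewrite big_nat_cond [RHS]big_nat_cond; apply: eq_big => [b|b h]; last by rewrite addnK.
by rewrite leq_addl.
Qed.

End PowerSeries.

(** * Substitution of arcs into series, and the Newton map on series *)

Section Substitution.
Variable k : comPzRingType.
Implicit Types (f g : fps2 k) (x y u v : fps k).

Definition ev x y f : fps k := subst2 id x y f.

Lemma mono_small x y a b m : ordge 1 x -> ordge 1 y -> (m < a + b)%N -> coef (x ^+ a * y ^+ b) m
  = 0.
Proof. by move=> hx hy hm; have [] := lead_mono a b hx hy; rewrite !mul1n => h _; exact: h. Qed.

(** For x and y without constant term, monomials of degree above m do not reach the coefficient m,
    so the range of summation may be enlarged to a bound common to several coefficients. *)
Lemma evE M x y f m : ordge 1 x -> ordge 1 y -> (m <= M)%N ->
  coef (ev x y f) m = \sum_(a < M.+1) \sum_(b < M.+1) coef (coef f a) b * coef (x ^+ a * y ^+ b) m.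
Proof.
move=> hx hy hm; rewrite /ev /subst2 /=.
have H (F : nat -> k) : (forall a, (m < a)%N -> F a = 0) -> \sum_(a < m.+1) F a = \sum_(a < M.+1)
  F a.
  move=> F0; rewrite (big_ord_widen M.+1 F) ?ltnS // big_mkcond /=; apply: eq_bigr => a _.
  by case: ltnP => // ma; rewrite F0.
rewrite (H (fun a => \sum_(b < m.+1) coef (coef f a) b * coef (x ^+ a * y ^+ b) m)).
  apply: eq_bigr => a _.
  rewrite (H (fun b => coef (coef f a) b * coef (x ^+ a * y ^+ b) m)) // => b mb.
  by rewrite mono_small ?mulr0 //; lia.
by move=> a ma; rewrite big1 // => b _; rewrite mono_small ?mulr0 //; lia.
Qed.

Lemma evD x y f g : ev x y (f + g) = ev x y f + ev x y g.
Proof.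
apply: fpsP => m; rewrite coefD /ev /subst2 /= -big_split; apply: eq_bigr => a _ /=.
by rewrite -big_split; apply: eq_bigr => b _ /=; rewrite mulrDl.
Qed.

Lemma ev0 x y : ev x y 0 = 0.
Proof. by apply: fpsP => m /=; rewrite big1 // => a _; rewrite big1 // => b _; rewrite mul0r. Qed.

(** Up to degree n both values are finite sums over exponents, and the coefficients of f * g form a
    double convolution, which two uses of [triangle_sum] open up. *)
Lemma evM x y f g : ordge 1 x -> ordge 1 y -> ev x y (f * g) = ev x y f * ev x y g.
Proof.
move=> hx hy; apply: fpsP => n.
pose P f := \sum_(a < n.+1) \sum_(b < n.+1) fps_term (coef (coef f a) b) 0 * (x ^+ a * y ^+ b).
have cP f' : cong n (ev x y f') (P f').
  move=> m hm; rewrite (evE _ hx hy hm) coef_sum; apply: eq_bigr => a _.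
  by rewrite coef_sum; apply: eq_bigr => b _; rewrite coef_cstM.
rewrite (congM (cP f) (cP g) (leqnn n)) (evE _ hx hy (leqnn n)).
pose G a a' : k := \sum_(b < n.+1) \sum_(b' < n.+1) coef (coef f a) b * coef (coef g a') b' *
  coef (x ^+ (a + a') * y ^+ (b + b')) n.
transitivity (\sum_(a < n.+1) \sum_(a' < n.+1) G a a').
  rewrite -triangle_sum; last first.
    by move=> a a' h; rewrite /G big1 // => b _; rewrite big1 // => b' _;
      rewrite mono_small ?mulr0 //; lia.
  apply: eq_bigr => a _; rewrite /G.
  transitivity (\sum_(b < n.+1) \sum_(i < a.+1) \sum_(j < b.+1) coef (coef f i) j * coef (coef g
    (a - i)%N) (b - j)%N * coef (x ^+ a * y ^+ b) n).
    apply: eq_bigr => b _; rewrite coef_mul coef_sum mulr_suml; apply: eq_bigr => i _.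
    by rewrite coef_mul mulr_suml.
  rewrite exchange_big /=; apply: eq_bigr => i _.
  rewrite -(@triangle_sum _ _ (fun b b' => coef (coef f i) b * coef (coef g (a - i)%N) b' * coef
    (x ^+ (i + (a - i)) * y ^+ (b + b')) n)).
    apply: eq_bigr => b _; apply: eq_bigr => j _; rewrite !subnKC //.
      by rewrite -ltnS. by rewrite -ltnS.
  by move=> b b' h; rewrite mono_small ?mulr0 //; lia.
rewrite /P mulr_suml coef_sum; apply: eq_bigr => a _.
rewrite mulr_sumr coef_sum; apply: eq_bigr => a' _; rewrite /G.
rewrite mulr_suml coef_sum; apply: eq_bigr => b _.
rewrite mulr_sumr coef_sum; apply: eq_bigr => b' _.
by rewrite mulrACA fps_term_mul coef_cstM mulrACA -!exprD.
Qed.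

Lemma ev_sum x y (J : Type) (r : seq J) (F : J -> fps2 k) :
  ev x y (\sum_(j <- r) F j) = \sum_(j <- r) ev x y (F j).
Proof. by apply: (big_morph (ev x y)); [exact: evD|exact: ev0]. Qed.

Lemma ev_mono x y c i j : ordge 1 x -> ordge 1 y ->
  ev x y (fps_term (fps_term c j) i) = fps_term c 0 * (x ^+ i * y ^+ j).
Proof.
move=> hx hy; apply: fpsP => m; rewrite (@evE (m + i + j)) //; last lia.
rewrite coef_cstM; set M := (m + i + j)%N.
rewrite (@sum_pick _ M.+1 i (fun a => \sum_(b < M.+1) coef (coef (fps_term (fps_term c j) i) a) b *
        coef (x ^+ a * y ^+ b) m)); last 2 first.
- by rewrite /M; lia.
- by move=> a /negbTE ai; rewrite big1 // => b _; rewrite (coef_term _ i) ai mul0r.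
rewrite coef_term eqxx (@sum_pick _ M.+1 j (fun b => coef (fps_term c j) b * coef (x ^+ i * y ^+
  b) m)).
- by rewrite coef_term eqxx.
- by rewrite /M; lia.
- by move=> a /negbTE ai; rewrite coef_term ai mul0r.
Qed.

Lemma ev_cst x y c : ordge 1 x -> ordge 1 y -> ev x y (fps_term (fps_term c 0) 0) = fps_term c 0.
Proof. by move=> hx hy; rewrite ev_mono // !expr0 !mulr1. Qed.

Lemma ev1 x y : ordge 1 x -> ordge 1 y -> ev x y 1 = 1.
Proof. by move=> hx hy; have := ev_cst 1 hx hy; rewrite !fps_term_1. Qed.

Lemma evX x y f n : ordge 1 x -> ordge 1 y -> ev x y (f ^+ n) = ev x y f ^+ n.
Proof. by move=> hx hy; elim: n => [|n IH]; rewrite ?ev1 // !exprS evM // IH. Qed.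

Lemma ev_x x y : ordge 1 x -> ordge 1 y -> ev x y (fps_term 1 1) = x.
Proof. by move=> hx hy; have := ev_mono 1 1 0 hx hy; rewrite !fps_term_1 mul1r mulr1. Qed.

Lemma ev_y x y : ordge 1 x -> ordge 1 y -> ev x y (fps_term (fps_term 1 1) 0) = y.
Proof. by move=> hx hy; rewrite ev_mono // fps_term_1 !mul1r. Qed.

(** The two coordinates of the Newton map at an arc, with [e] standing for (p', q'). *)
Definition ncoord1 p (e : nat * nat) (mu : k) (x1 : fps k) := fps_term (mu ^+ e.2) 0 * x1 ^+ p.
Definition ncoord2 q (e : nat * nat) (mu : k) (x1 y1 : fps k) := x1 ^+ q * (y1 + fps_term (mu ^+
  e.1) 0).

Lemma ev_cong n x y x' y' f : cong n x x' -> cong n y y' -> cong n (ev x y f) (ev x' y' f).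
Proof.
move=> hx hy m hm; apply: eq_bigr => a _; apply: eq_bigr => b _; congr (_ * _).
by apply: congM (hm); apply: congX.
Qed.

Lemma ev_congl n x y f g : (forall a, (a <= n)%N -> coef f a = coef g a) -> cong n (ev x y f) (ev
  x y g).
Proof.
move=> h m hm; apply: eq_bigr => a _; apply: eq_bigr => b _; rewrite h //.
by have := ltn_ord a; lia.
Qed.

End Substitution.

(** Associativity of substitution. Only finitely many monomials of f influence a given coefficient,
    and for a finite sum of monomials the claim follows because [ev] is a ring morphism. *)
Lemma ev_newton_map (k : fieldType) (p q : nat) (mu : k) (x y : fps k) (f : fps2 k) :
  (0 < p)%N -> (0 < q)%N -> ordge 1 x -> ordge 1 y ->
  ev x y (newton_map p q mu f) =
  ev (ncoord1 p (newton_exps p q) mu x) (ncoord2 q (newton_exps p q) mu x y) f.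
Proof.
move=> p0 q0 hx hy; rewrite /newton_map; set e := newton_exps p q.
set u := fps_term _ p; set v := fps_term _ q.
have eu : ev x y u = ncoord1 p e mu x.
  have -> : u = fps_term (fps_term (mu ^+ e.2) 0) 0 * fps_term 1 1 ^+ p.
    by rewrite fps_termX fps_term_mul expr1n mulr1 mul1n.
  by rewrite evM // evX // ev_cst // ev_x.
have ev' : ev x y v = ncoord2 q e mu x y.
  have -> : v = fps_term 1 1 ^+ q * (fps_term (fps_term 1 1) 0 + fps_term (fps_term (mu ^+ e.1)
    0) 0).
    by rewrite fps_termX -fps_termD fps_term_mul expr1n mul1r mul1n addn0.
  by rewrite evM // evX // evD ev_cst // ev_x // ev_y.
have ou : ordge 1 (ncoord1 p e mu x).
  by move=> [|//] _; have [h _] := lead_exp p hx; rewrite coef_cstM h ?mulr0 // mul1n.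
have ov : ordge 1 (ncoord2 q e mu x y).
  have [h _] := lead_exp q hx; have h0 : ordge 0 (y + fps_term (mu ^+ e.1) 0) by [].
  by have [h1 _] := lead_mul h h0; move=> m hm; apply: h1; lia.
have u1 : ordge 1 u by move=> [|//] _; rewrite coef_term; case: eqP => // e0; rewrite -e0 in p0.
have v1 : ordge 1 v by move=> [|//] _; rewrite coef_term; case: eqP => // e0; rewrite -e0 in q0.
apply: fpsP => n.
(* Since p and q are positive, u and v are divisible by x1, so this finite sum agrees with the image
   of f in every degree at most n in x1. *)
pose P := \sum_(a < n.+1) \sum_(b < n.+1) fps_term (fps_term (coef (coef f a) b) 0) 0 * (u ^+ a *
  v ^+ b).
have cP : forall m, (m <= n)%N -> coef (subst2 (fun c => fps_term c 0) u v f) m = coef P m.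
  move=> m hm; rewrite /P coef_sum /=.
  have H (F : nat -> fps k) : (forall a, (m < a)%N -> F a = 0) -> \sum_(a < m.+1) F a = \sum_(a <
    n.+1) F a.
    move=> F0; rewrite (big_ord_widen n.+1 F) ?ltnS // big_mkcond /=; apply: eq_bigr => a _.
    by case: ltnP => // ma; rewrite F0.
  rewrite (H (fun a => \sum_(b < m.+1) fps_term (coef (coef f a) b) 0 * coef (u ^+ a * v ^+ b)
    m)); last first.
    by move=> a ma; rewrite big1 // => b _; rewrite mono_small ?mulr0 //; lia.
  apply: eq_bigr => a _; rewrite coef_sum (H (fun b => fps_term (coef (coef f a) b) 0 * coef (u
    ^+ a * v ^+ b) m)); last first.
    by move=> b mb; rewrite mono_small ?mulr0 //; lia.
  by apply: eq_bigr => b _; rewrite coef_cstM.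
rewrite (ev_congl x y cP (leqnn n)) /P ev_sum (evE _ ou ov (leqnn n)) coef_sum;
  apply: eq_bigr => a _.
rewrite ev_sum coef_sum; apply: eq_bigr => b _.
by rewrite evM // evM // !evX // ev_cst // eu ev' coef_cstM.
Qed.

(** * The order of an ideal along an arc *)

Section OrderOfIdeal.
Variable k : fieldType.
Implicit Types (J G : set (fps2 k)) (phi psi : arc k).

(** The order in terms of coefficients. It may be tested on generators, and for finitely many of
    them it is a locally closed condition on finitely many coefficients of the arc. *)
Definition ord_gens G phi n :=
  (forall g, G g -> ordge n (ev phi.1 phi.2 g)) /\ exists2 g, G g & coef (ev phi.1 phi.2 g) n <> 0.

Lemma arcs0_ordge phi : arcs0 phi <-> ordge 1 phi.1 /\ ordge 1 phi.2.
Proof.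
split=> [[h1 h2]|[h1 h2]]; first by split=> -[].
by split; [exact: h1|exact: h2].
Qed.

Lemma ord_idealE J phi n : ord_ideal J phi n <-> ord_gens J phi n.
Proof.
split.
  move=> [[f Jf /orderP [f0 _]] mn]; split; last by exists f => //; exact/eqP.
  move=> g Jg; apply: contrapT => nz.
  have [m [mn' nzm]] : exists m, (m < n)%N /\ coef (ev phi.1 phi.2 g) m != 0.
    by apply: contrapT => h; apply: nz => m mn'; apply/eqP/negPn/negP => z; apply: h; exists m.
  case: (ex_minnP (ex_intro (fun m => coef (ev phi.1 phi.2 g) m != 0) m nzm)) => l l0 lmin.
  have : (n <= l)%N.
    apply: (mn _ _ Jg); apply/orderP; split=> // i il; apply/eqP/negPn/negP => /lmin; lia.
  by have := lmin _ nzm; lia.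
move=> [ge [f Jf f0]]; split.
  by exists f => //; apply/orderP; split; [exact/eqP|exact: ge].
move=> g m Jg /orderP [g0 _]; rewrite leqNgt; apply/negP => mn.
by move/eqP: g0; apply; exact: ge.
Qed.

Lemma ideal_gen_ordge G phi N : arcs0 phi ->
  (forall g, G g -> ordge N (ev phi.1 phi.2 g)) ->
  forall f, ideal_gen G f -> ordge N (ev phi.1 phi.2 f).
Proof.
move=> /arcs0_ordge [h1 h2] hG f; apply: (_ : ideal_gen G `<=` [set f | ordge N (ev phi.1 phi.2
  f)]).
apply: smallest_sub; last exact: hG.
split => /=.
- by rewrite ev0.
- by move=> a b ha hb m hm; rewrite evD coefD ha ?hb ?addr0.
- move=> a b hb; rewrite evM //; have h0 : ordge 0 (ev phi.1 phi.2 a) by [].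
  by have [h _] := lead_mul h0 hb; move=> m hm; apply: h.
Qed.

Lemma sub_ideal_gen (A : comPzRingType) (G : set A) : G `<=` ideal_gen G.
Proof. exact: sub_gen_smallest. Qed.

Lemma ord_ideal_gen G phi n : arcs0 phi -> ord_ideal (ideal_gen G) phi n <-> ord_gens G phi n.
Proof.
move=> a0; rewrite ord_idealE; split=> [[ge [f If f0]]|[ge [g Gg g0]]].
  split; first by move=> g Gg; apply: ge; exact: sub_ideal_gen.
  apply: contrapT => none; apply: f0; apply: (@ideal_gen_ordge G phi n.+1 a0 _ f If) => // g Gg m.
  rewrite ltnS leq_eqVlt => /orP[/eqP ->|mn]; last by apply: ge => //; exact: sub_ideal_gen.
  by apply: contrapT => nz; apply: none; exists g.
split; last by exists g => //; exact: sub_ideal_gen.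
exact: ideal_gen_ordge.
Qed.

Definition narc p q (mu : k) phi : arc k :=
  (ncoord1 p (newton_exps p q) mu phi.1, ncoord2 q (newton_exps p q) mu phi.1 phi.2).

Lemma ord_newton J p q mu phi n : (0 < p)%N -> (0 < q)%N -> arcs0 phi ->
  ord_ideal (newton_ideal J p q mu) phi n <-> ord_ideal J (narc p q mu phi) n.
Proof.
move=> p0 q0 a0; rewrite /newton_ideal ord_ideal_gen // ord_idealE.
have /arcs0_ordge [h1 h2] := a0.
have E f : ev phi.1 phi.2 (newton_map p q mu f) = ev (narc p q mu phi).1 (narc p q mu phi).2 f.
  exact: ev_newton_map.
split=> [[ge [_ [f Jf <-] f0]]|[ge [f Jf f0]]]; split.
- by move=> f' Jf'; rewrite -E; apply: ge; exists f'.
- by exists f; [exact: Jf|rewrite -E].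
- by move=> _ [f' Jf' <-]; rewrite E; exact: ge.
- by exists (newton_map p q mu f); [exists f|rewrite E].
Qed.

Lemma ord_ideal_cong J phi psi n : cong n phi.1 psi.1 -> cong n phi.2 psi.2 ->
  ord_ideal J phi n -> ord_ideal J psi n.
Proof.
move=> h1 h2; rewrite !ord_idealE => -[ge [f Jf f0]].
split; last by exists f; [exact: Jf|rewrite -(ev_cong f h1 h2 (leqnn n))].
by move=> g Jg m mn; rewrite -(ev_cong g h1 h2 (ltnW mn)); exact: ge.
Qed.

Definition pfam n (F : affpt k n -> fps k) := forall m, polyf (fun z => coef (F z) m).

Lemma pfamM n (F G : affpt k n -> fps k) : pfam F -> pfam G -> pfam (fun z => F z * G z).
Proof. by move=> hF hG m; apply: polyf_sum => i; apply: polyfM. Qed.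

Lemma pfamD n (F G : affpt k n -> fps k) : pfam F -> pfam G -> pfam (fun z => F z + G z).
Proof. by move=> hF hG m; apply: polyfD. Qed.

Lemma pfam_cst n f : pfam (fun _ : affpt k n => f).
Proof. by move=> m; exact: polyf_cst. Qed.

Lemma pfamX n (F : affpt k n -> fps k) a : pfam F -> pfam (fun z => F z ^+ a).
Proof.
move=> hF; elim: a => [|a IH]; first exact: pfam_cst.
move=> m; have [p hp] := pfamM hF IH m; exists p => x; rewrite -hp exprS //.
Qed.

Lemma pfam_ev n (X Y : affpt k n -> fps k) f : pfam X -> pfam Y -> pfam (fun z => ev (X z) (Y z) f).
Proof.
move=> hX hY m; apply: polyf_sum => a; apply: polyf_sum => b; apply: polyfM; first exact: polyf_cst.
by apply: pfamM; apply: pfamX.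
Qed.

Lemma lc_ord_gens n (X Y : affpt k n -> fps k) (fs : seq (fps2 k)) N : pfam X -> pfam Y ->
  locally_closed [set z | ord_gens [set` fs] (X z, Y z) N].
Proof.
move=> hX hY; pose c (i : 'I_(size fs)) m z := coef (ev (X z) (Y z) (tnth (in_tuple fs) i)) m.
have pc i m : polyf (c i m) by apply: pfam_ev.
have l1 : locally_closed [set z | forall i : 'I_(size fs), forall m : 'I_N, c i m z = 0].
  apply: (@lc_forall k _ 'I_(size fs) (fun i => [set z | forall m : 'I_N, c i m z = 0])) => i.
  by apply: (@lc_forall k _ 'I_N (fun m => [set z | c i m z = 0])) => m; apply: lc_eq0.
have l2 : locally_closed [set z | exists i : 'I_(size fs), c i N z <> 0] by apply: lc_exists.
have := lcI l1 l2; congr locally_closed; apply/seteqP; split=> z.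
  move=> [h1 [i h2]]; split; last by exists (tnth (in_tuple fs) i) => //; exact: mem_tnth.
  by move=> g /(tnthP (in_tuple fs)) [j ->] m mN; exact: (h1 j (Ordinal mN)).
move=> [h1 [g /(tnthP (in_tuple fs)) [j ->] g0]]; split; last by exists j.
by move=> i m; apply: h1 => //; exact: mem_tnth.
Qed.

End OrderOfIdeal.

(** * The Newton map on arcs *)

Section SeriesRoots.
Variable k : fieldType.
Implicit Types (w r d f g : fps k).

Lemma ordge_le n m f : (m <= n)%N -> ordge n f -> ordge m f.
Proof. by move=> mn h i im; apply: h; lia. Qed.

Lemma ordgeD n f g : ordge n f -> ordge n g -> ordge n (f + g).
Proof. by move=> hf hg m hm; rewrite coefD hf ?hg ?addr0. Qed.

Lemma ordgeN n f : ordge n f -> ordge n (- f).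
Proof. by move=> hf m hm; rewrite coefN hf ?oppr0. Qed.

Lemma ordgeM i j f g : ordge i f -> ordge j g -> ordge (i + j) (f * g).
Proof. by move=> hf hg; have [] := lead_mul hf hg. Qed.

Lemma ordgeMr n f g : ordge n g -> ordge n (f * g).
Proof. by move=> h; apply: (@ordgeM 0 n f g). Qed.

Lemma cong_ordge n f g : cong n f g <-> ordge n.+1 (f - g).
Proof.
split=> h m hm; first by rewrite coefD coefN h ?subrr.
by apply/eqP; rewrite -subr_eq0 -coefN -coefD h.
Qed.

Lemma coefM0 f g : coef (f * g) 0 = coef f 0 * coef g 0.
Proof. by rewrite coef_mul big_ord1. Qed.

Lemma coefX0 f n : coef (f ^+ n) 0 = coef f 0 ^+ n.
Proof. by elim: n => [|n IH]; [rewrite coef1|rewrite !exprS coefM0 IH]. Qed.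

Lemma cong_cancel n f g : coef g 0 != 0 -> cong n (f * g) 0 -> cong n f 0.
Proof.
move=> g0 h m; elim/ltn_ind: m => m IH mn.
have [_] := @lead_mul _ m 0 f g (fun i im => IH i im (ltnW (leq_trans im mn))) (fun i hi =>
  False_rect _ (Bool.diff_false_true hi)).
rewrite addn0 h // coef0 => /esym/eqP; rewrite mulf_eq0 (negbTE g0) orbF => /eqP.
exact.
Qed.

(** The derivative p r^(p-1) may be replaced by p, because r - 1 is divisible by t and d by t^(s+1);
    the quadratic term in d is of even higher order. *)
Lemma newton_step s r d p : coef r 0 = 1 -> ordge s.+1 d ->
  ordge s.+2 ((r - d) ^+ p - r ^+ p + p%:R * d).
Proof.
move=> r0 hd; elim: p => [|p IH]; first by rewrite !expr0 subrr mul0r addr0.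
(* The error for p + 1 consists of the inherited error, two products of d with series without
   constant term, and a multiple of d^2. *)
have -> : (r - d) ^+ p.+1 - r ^+ p.+1 + p.+1%:R * d =
  (r - d) * ((r - d) ^+ p - r ^+ p + p%:R * d) + (- (d * (r ^+ p - 1))) + (- (p%:R * (d * (r -
    1)))) + p%:R * (d * d).
  by rewrite !exprS -natr1; ring.
have h1 (g : fps k) : coef g 0 = 1 -> ordge 1 (g - 1).
  by move=> g0 [|//] _; rewrite coefD coefN g0 coef1 subrr.
apply: ordgeD; first apply: ordgeD; first apply: ordgeD.
- exact: ordgeMr.
- by apply: ordgeN; rewrite -addn1; apply: ordgeM => //; apply: h1; rewrite coefX0 r0 expr1n.
- by apply: ordgeN; apply: ordgeMr; rewrite -addn1; apply: ordgeM => //; apply: h1.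
- by apply: ordgeMr; apply: (@ordge_le (s.+1 + s.+1)); [lia|exact: ordgeM].
Qed.

(** Newton's method for [r ^+ p = w], with the derivative frozen at [r = 1]. *)
Definition root_iter p w s : fps k := iter s (fun r => r - fps_term (p%:R^-1) 0 * (r ^+ p - w)) 1.

Lemma root_iterP p w s : (p%:R : k) != 0 -> coef w 0 = 1 ->
  coef (root_iter p w s) 0 = 1 /\ cong s (root_iter p w s ^+ p) w.
Proof.
move=> p0 w0; elim: s => [|s [IH1 IH2]].
  by rewrite coef1; split=> // -[|//] _; rewrite expr1n coef1 w0.
rewrite /root_iter iterS -/(root_iter p w s); set r := root_iter p w s in IH1 IH2 *.
set d := fps_term _ 0 * _.
have hd : ordge s.+1 d by apply: ordgeMr; apply/cong_ordge.
split; first by rewrite coefD coefN hd // IH1 subr0.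
apply/cong_ordge; have := newton_step p IH1 hd; congr ordge.
have -> : p%:R * d = r ^+ p - w.
  have -> : (p%:R : fps k) = fps_term p%:R 0.
    elim: p {p0 r IH1 IH2 d hd} => [|p IH]; first by apply: fpsP => m; rewrite coef_term if_same.
    by rewrite -!natr1 IH fps_termD fps_term_1.
  by rewrite /d mulrA fps_term_mul mulfV // fps_term_1 mul1r.
by rewrite addrA subrK.
Qed.

(** The cofactor of f - g in f^p - g^p has constant term p f(0)^(p-1), which is nonzero, and can be
    cancelled. *)
Lemma cong_root_uniq n p f g : (p%:R : k) != 0 -> coef f 0 != 0 -> coef f 0 = coef g 0 ->
  cong n (f ^+ p) (g ^+ p) -> cong n f g.
Proof.
move=> p0 f0 e h; apply/cong_ordge => m hm.
apply: (@cong_cancel n _ (\sum_(i < p) f ^+ (p.-1 - i) * g ^+ i)) => //; last first.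
  case: p p0 h => [|p] p0 h; first by rewrite eqxx in p0.
  by rewrite -subrXX; apply/cong_ordge; rewrite subr0; apply/cong_ordge.
rewrite coef_sum (eq_bigr (fun=> coef f 0 ^+ p.-1)) => [|i _]; last first.
  by rewrite coefM0 !coefX0 -e -exprD; congr (_ ^+ _); have := ltn_ord i; lia.
by rewrite sumr_const card_ord -mulr_natl mulf_neq0 // expf_neq0.
Qed.

(** The inverse of w modulo t^(l+1) when w(0) = 1, written so that its coefficients are visibly
    polynomials in those of w. *)
Definition geom_inv l w : fps k := \sum_(i < l.+1) (1 - w) ^+ i.

Lemma geom_invP l w : coef w 0 = 1 -> cong l (w * geom_inv l w) 1.
Proof.
move=> w0; have h1 : ordge 1 (1 - w) by move=> [|//] _; rewrite coefD coefN coef1 w0 subrr.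
have -> : w * geom_inv l w = 1 - (1 - w) ^+ l.+1.
  have /= e := @subrX1 (fps k) (1 - w) l.+1.
  have -> : w * geom_inv l w = - ((1 - w - 1) * geom_inv l w) by ring.
  by rewrite -e opprB.
apply/cong_ordge; have [h _] := lead_exp l.+1 h1; rewrite mul1n in h.
by have := ordgeN h; congr ordge; ring.
Qed.

Lemma geom_inv0 l w : coef w 0 = 1 -> coef (geom_inv l w) 0 = 1.
Proof. by move=> w0; have := geom_invP w0 (leq0n l); rewrite coefM0 w0 mul1r. Qed.

Section Families.
Variables (n : nat) (S : set (affpt k n)).
Implicit Types F G : affpt k n -> fps k.

Definition rfam F := forall m, rf S (fun z => coef (F z) m).

Lemma rfamM F G : rfam F -> rfam G -> rfam (fun z => F z * G z).
Proof. by move=> hF hG m; apply: rf_sum => i; apply: rfM. Qed.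

Lemma rfamD F G : rfam F -> rfam G -> rfam (fun z => F z + G z).
Proof. by move=> hF hG m; apply: rfD. Qed.

Lemma rfam_cst f : rfam (fun=> f).
Proof. by move=> m; exact: rf_cst. Qed.

Lemma rfamN F : rfam F -> rfam (fun z => - F z).
Proof.
move=> hF m; have := rfM (@rf_cst k n S (-1)) (hF m); apply: rf_ext => x _.
by rewrite coefN mulN1r.
Qed.

Lemma rfam_ext F G : (forall z, S z -> F z = G z) -> rfam F -> rfam G.
Proof. by move=> e h m; have := h m; apply: rf_ext => x Sx; rewrite e. Qed.

Lemma rfamX F a : rfam F -> rfam (fun z => F z ^+ a).
Proof.
move=> hF; elim: a => [|a IH]; first exact: rfam_cst.
by have := rfamM hF IH; apply: rfam_ext => z _; rewrite exprS.
Qed.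

Lemma rfam_scal (c : affpt k n -> k) F : rf S c -> rfam F -> rfam (fun z => fps_term (c z) 0 * F z).
Proof.
move=> hc hF m; have := rfM hc (hF m); apply: rf_ext => x _; by rewrite coef_cstM.
Qed.

Lemma rfam_root p s F : rfam F -> rfam (fun z => root_iter p (F z) s).
Proof.
move=> hF; elim: s => [|s IH]; first exact: rfam_cst.
have := rfamD IH (rfamN (rfam_scal (@rf_cst k n S (p%:R^-1)) (rfamD (rfamX p IH) (rfamN hF)))).
exact: rfam_ext.
Qed.

Lemma rfam_inv l F : rfam F -> rfam (fun z => geom_inv l (F z)).
Proof.
move=> hF; rewrite /geom_inv; elim: l.+1 => [|j IH].
  by apply: (rfam_ext _ (rfam_cst 0)) => z _; rewrite big_ord0.
have := rfamD IH (rfamX j (rfamD (rfam_cst 1) (rfamN hF))).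
by apply: rfam_ext => z _; rewrite big_ord_recr.
Qed.

End Families.

End SeriesRoots.

(** * The Newton map as an isomorphism of jet spaces *)

Section ChangeOfVariables.
Variables (k : fieldType) (p q : nat) (e : nat * nat) (mu : k) (l : nat).
Hypotheses (p0 : (p%:R : k) != 0) (mu0 : mu != 0) (pe : (p * e.1 = q * e.2 + 1)%N).
(** A condition on arcs that depends on the coefficients up to l only: later either the order along
    the ideal, or the trivial condition with l = 0. *)
Variable O : arc k -> Prop.
Hypothesis O_cong : forall phi psi, cong l phi.1 psi.1 -> cong l phi.2 psi.2 -> O phi -> O psi.
Hypothesis O_lc : forall n (X Y : affpt k n -> fps k), pfam X -> pfam Y ->
  locally_closed [set z | O (X z, Y z)].
Variables i j : nat.
Local Notation cst c := (fps_term c 0).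
Local Notation Tpow i := (fps_term (1 : k) i).

Definition serX n1 n2 (z : affpt k (n1 + n2)) : fps k := Fps (xs z).
Definition serY n1 n2 (z : affpt k (n1 + n2)) : fps k := Fps (ys z).
Definition serV n1 n2 (z : affpt k (n1 + n2)) : fps k :=
  Fps (fun m => if m is m'.+1 then ys z m' else mu ^+ e.1).

(** On the target x = t^i X and y = t^j Y; on the source x1 is a power of t times X
    and y1 = V - mu^p'. *)
Definition target : set (affpt k (l.+1 + l.+1)) :=
  [set w | [/\ xs w 0 <> 0, ys w 0 <> 0, ys w 0 ^+ p = mu * xs w 0 ^+ q &
     O (Tpow i * serX w, Tpow j * serY w)]].
Definition source : set (affpt k (l.+1 + l)) :=
  [set z | xs z 0 <> 0 /\ O (Tpow i * (cst (mu ^+ e.2) * serX z ^+ p), Tpow j * (serX z ^+ q *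
    serV z))].

Lemma pfam_serX n1 n2 : pfam (@serX n1 n2). Proof. by move=> m; exact: polyf_xs. Qed.
Lemma pfam_serY n1 n2 : pfam (@serY n1 n2). Proof. by move=> m; exact: polyf_ys. Qed.
Lemma pfam_serV n1 n2 : pfam (@serV n1 n2).
Proof. by move=> [|m]; [exact: polyf_cst|exact: polyf_ys]. Qed.

Lemma lc_target : locally_closed target.
Proof.
have l1 := lc_neq0 (@polyf_xs k l.+1 l.+1 0); have l2 := lc_neq0 (@polyf_ys k l.+1 l.+1 0).
have pf : polyf (fun w : affpt k (l.+1 + l.+1) => coef (serY w ^+ p + cst (- mu) * serX w ^+ q) 0).
  by apply: pfamD; [apply: pfamX; exact: pfam_serY|apply: pfamM; [exact: pfam_cst|apply: pfamX;
    exact: pfam_serX]].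
have l3 := O_lc (pfamM (@pfam_cst k _ (Tpow i)) (@pfam_serX l.+1 l.+1)) (pfamM (@pfam_cst k _
  (Tpow j)) (@pfam_serY l.+1 l.+1)).
have E w : coef (serY w ^+ p + cst (- mu) * serX w ^+ q) 0 = ys w 0 ^+ p - mu * xs w 0 ^+ q.
  by rewrite coefD coef_cstM !coefX0 mulNr.
have := lcI (lcI l1 l2) (lcI (lc_eq0 pf) l3); congr locally_closed; apply/seteqP; split=> w.
  move=> [[a b] [c d]]; split=> //.
  by have {}c : coef (serY w ^+ p + cst (- mu) * serX w ^+ q) 0 = 0 := c; apply/eqP;
    rewrite -subr_eq0 -E c.
by move=> [a b c d]; split=> //; split=> //; rewrite /mkset E c subrr.
Qed.

Lemma lc_source : locally_closed source.
Proof.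
have l1 := lc_neq0 (@polyf_xs k l.+1 l 0).
apply: (lcI l1); apply: O_lc; apply: pfamM; try exact: pfam_cst; apply: pfamM.
- exact: pfam_cst.
- by apply: pfamX; exact: pfam_serX.
- by apply: pfamX; exact: pfam_serX.
- exact: pfam_serV.
Qed.

(** The p-th and q-th powers of X(0) determine X(0), because p p' - q q' = 1; then X is determined
    as a p-th root, and V by division by X^q. *)
Lemma newton_inj (X X' V V' : fps k) : coef X 0 != 0 -> coef X' 0 != 0 ->
  coef V 0 = mu ^+ e.1 -> coef V' 0 = mu ^+ e.1 ->
  cong l (X ^+ p) (X' ^+ p) -> cong l (X ^+ q * V) (X' ^+ q * V') ->
  cong l X X' /\ cong l V V'.
Proof.
move=> X0 X'0 V0 V'0 hp hq.
have ep : coef X 0 ^+ p = coef X' 0 ^+ p by have := hp 0 isT; rewrite !coefX0.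
have eq : coef X 0 ^+ q = coef X' 0 ^+ q.
  have := hq 0 isT; rewrite !coefM0 !coefX0 V0 V'0 => /mulIf; apply.
  by rewrite expf_neq0.
have e0 : coef X 0 = coef X' 0.
  apply: (@mulfI _ (coef X 0 ^+ (q * e.2))); first by rewrite expf_neq0.
  by rewrite -exprSr -addn1 -pe exprM ep {1}exprM eq -!exprM -exprSr -addn1 pe.
have hX := cong_root_uniq p0 X0 e0 hp; split=> //.
apply/cong_ordge => m hm; apply: (@cong_cancel _ l _ (X' ^+ q)) => //;
  first by rewrite coefX0 expf_neq0.
have -> : (V - V') * X' ^+ q = X' ^+ q * V + - (X' ^+ q * V') by ring.
apply: (@cong_trans _ _ (X ^+ q * V + - (X' ^+ q * V'))).
  by apply: congD => //; apply: congM => //; apply: congX; exact: cong_sym.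
by move=> m' hm'; rewrite coefD coefN hq ?subrr.
Qed.

(** The solution c of mu^q' c^p = a and c^q mu^p' = b. With a' = c^p and b' = c^q it is c^(p p' - q
    q') = a'^p' / b'^q'. *)
Definition inv_c (a b : k) := (a / mu ^+ e.2) ^+ e.1 / (b / mu ^+ e.1) ^+ e.2.

Lemma inv_cP a b : a != 0 -> b != 0 -> b ^+ p = mu * a ^+ q ->
  [/\ inv_c a b != 0, mu ^+ e.2 * inv_c a b ^+ p = a & inv_c a b ^+ q * mu ^+ e.1 = b].
Proof.
move=> a0 b0 h; set a' := a / mu ^+ e.2; set b' := b / mu ^+ e.1.
have a'0 : a' != 0 by rewrite mulf_neq0 // invr_eq0 expf_neq0.
have b'0 : b' != 0 by rewrite mulf_neq0 // invr_eq0 expf_neq0.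
(* Division by the powers of mu turns the equation b^p = mu a^q into b'^p = a'^q, since p p' = q q'
   + 1. *)
have h' : b' ^+ p = a' ^+ q.
  rewrite /b' /a' !exprMn !exprVn h -!exprM (mulnC e.1) pe (mulnC e.2) addn1 exprS.
  by rewrite invfM mulrACA mulfV // mul1r.
have ea : a' * mu ^+ e.2 = a by rewrite /a' mulfVK // expf_neq0.
have eb : b' * mu ^+ e.1 = b by rewrite /b' mulfVK // expf_neq0.
rewrite /inv_c -/a' -/b'; split.
- by rewrite mulf_neq0 ?invr_eq0 ?expf_neq0.
- rewrite exprMn exprVn -!exprM (mulnC e.1) pe (mulnC e.2) [b' ^+ _]exprM h' -exprM addn1 exprS.
  by rewrite -mulrA mulfV ?mulr1 ?expf_neq0 // mulrC.
- rewrite exprMn exprVn -!exprM (mulnC e.1) exprM -h' -exprM pe addn1 exprS (mulnC e.2).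
  by rewrite mulfK ?expf_neq0.
Qed.

(** The root is extracted from X divided by its constant term; the constant factor of the solution
    is supplied by [inv_c]. *)
Definition inv_X (X Y : fps k) : fps k :=
  cst (inv_c (coef X 0) (coef Y 0)) * root_iter p (cst (coef X 0)^-1 * X) l.
Definition inv_V (X Y : fps k) : fps k :=
  cst (inv_c (coef X 0) (coef Y 0) ^+ q)^-1 * (geom_inv l (root_iter p (cst (coef X 0)^-1 * X) l
    ^+ q) * Y).

Lemma cstM (c d : k) : cst c * cst d = cst (c * d) :> fps k.
Proof. by rewrite fps_term_mul. Qed.
Lemma cstX (c : k) a : cst c ^+ a = cst (c ^+ a) :> fps k.
Proof. by rewrite fps_termX. Qed.

Lemma inv_XVP X Y : coef X 0 != 0 -> coef Y 0 != 0 -> coef Y 0 ^+ p = mu * coef X 0 ^+ q ->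
  [/\ coef (inv_X X Y) 0 != 0, coef (inv_V X Y) 0 = mu ^+ e.1,
      cong l (cst (mu ^+ e.2) * inv_X X Y ^+ p) X & cong l (inv_X X Y ^+ q * inv_V X Y) Y].
Proof.
move=> X0 Y0 h; have [c0 ca cb] := inv_cP X0 Y0 h.
have w0 : coef (cst (coef X 0)^-1 * X) 0 = 1 by rewrite coef_cstM mulVf.
have [r0 rp] := root_iterP l p0 w0.
rewrite /inv_X /inv_V; set c := inv_c _ _ in c0 ca cb *; set r := root_iter _ _ _ in r0 rp *.
have rq0 : coef (r ^+ q) 0 = 1 by rewrite coefX0 r0 expr1n.
split.
- by rewrite coef_cstM r0 mulr1.
- by rewrite coef_cstM coefM0 geom_inv0 // mul1r -cb mulKf // expf_neq0.
- rewrite exprMn cstX mulrA cstM ca.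
  apply: (@cong_trans _ _ (cst (coef X 0) * (cst (coef X 0)^-1 * X))); first exact: congM.
  by rewrite mulrA cstM mulfV // fps_term_1 mul1r.
- rewrite exprMn cstX mulrACA cstM mulfV ?expf_neq0 // fps_term_1 mul1r mulrA.
  apply: (@cong_trans _ _ (1 * Y)); last by rewrite mul1r.
  by apply: congM => //; exact: geom_invP.
Qed.

(** The truncated Newton map and its truncated inverse are mutually inverse. The source has one
    coordinate less because the constant term of V is fixed, the target one equation more. The
    inverse is regular: besides polynomials in the coefficients it only divides by functions that
    have no zero on the target. *)
Lemma vcl_source_target : vcl source = vcl target.
Proof.
pose hx (z : affpt k (l.+1 + l)) := cst (mu ^+ e.2) * serX z ^+ p.
pose hy (z : affpt k (l.+1 + l)) := serX z ^+ q * serV z.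
pose h z : affpt k (l.+1 + l.+1) := mkpt l.+1 l.+1 (coef (hx z)) (coef (hy z)).
pose gx (w : affpt k (l.+1 + l.+1)) := inv_X (serX w) (serY w).
pose gy (w : affpt k (l.+1 + l.+1)) := inv_V (serX w) (serY w).
pose h' w : affpt k (l.+1 + l) := mkpt l.+1 l (coef (gx w)) (fun m => coef (gy w) m.+1).
have hX z : cong l (serX (h z)) (hx z) by move=> m hm; rewrite /= xs_mk ltnS hm.
have hY z : cong l (serY (h z)) (hy z) by move=> m hm; rewrite /= ys_mk ltnS hm.
have gX w : cong l (serX (h' w)) (gx w) by move=> m hm; rewrite /= xs_mk ltnS hm.
have gV w : target w -> cong l (serV (h' w)) (gy w).
  move=> [/eqP x0 /eqP y0 xy _]; have [_ v0 _ _] := @inv_XVP (serX _) (serY _) x0 y0 xy.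
  by move=> [|m] hm /=; [rewrite -v0|rewrite ys_mk hm].
have hT z : source z -> target (h z).
  move=> [x0 Oz]; have xz : xs (h z) 0 = mu ^+ e.2 * xs z 0 ^+ p.
    by have := hX z 0 isT; rewrite /hx coef_cstM coefX0.
  have yz : ys (h z) 0 = xs z 0 ^+ q * mu ^+ e.1.
    by have := hY z 0 isT; rewrite /hy coefM0 coefX0.
  split.
  - by apply/eqP; rewrite xz mulf_neq0 ?expf_neq0 //; apply/eqP.
  - by apply/eqP; rewrite yz mulf_neq0 ?expf_neq0 //; apply/eqP.
  - rewrite xz yz !exprMn -!exprM (mulnC e.1) pe (mulnC e.2) (mulnC q) addn1 exprS.
    by rewrite mulrC -!mulrA.
  - by apply: O_cong Oz; apply: congM => //=; apply: cong_sym.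
have hS w : target w -> source (h' w).
  move=> tw; have [/eqP x0 /eqP y0 xy Ow] := tw; have [X0 V0 cX cY] := @inv_XVP (serX _) (serY _)
    x0 y0 xy.
  split; first by apply/eqP; have /= -> := gX w 0 isT.
  apply: O_cong Ow; apply: congM => //=; apply: cong_sym.
    by apply: (cong_trans _ cX); apply: congM => //; apply: congX; exact: gX.
  by apply: (cong_trans _ cY); apply: congM; [apply: congX; exact: gX|exact: gV].
apply: (@vcl_iso _ _ _ _ _ h h') => //.
- move=> z sz; have tz := hT _ sz; have [/eqP x0 /eqP y0 xy _] := tz.
  have [X0 V0 cX cY] := @inv_XVP (serX _) (serY _) x0 y0 xy; have [/eqP z0 _] := sz.
  have := @newton_inj (serX z) (gx (h z)) (serV z) (gy (h z)) z0 X0 erefl V0.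
  case=> [||eX eV].
  + apply: (@cong_trans _ _ (cst (mu ^+ e.2)^-1 * hx z)).
      by rewrite /hx mulrA cstM mulVf ?expf_neq0 // fps_term_1 mul1r.
    apply: (@cong_trans _ _ (cst (mu ^+ e.2)^-1 * (cst (mu ^+ e.2) * gx (h z) ^+ p))).
      apply: congM => //; apply: cong_sym; exact: cong_trans cX (hX z).
    by rewrite mulrA cstM mulVf ?expf_neq0 // fps_term_1 mul1r.
  + by apply: cong_sym; exact: cong_trans cY (hY z).
  rewrite -[RHS]mkptK; apply: mkpt_eq => m hm.
    by rewrite -eX.
  by rewrite -eV.
- move=> w tw; have [/eqP x0 /eqP y0 xy _] := tw; have [X0 V0 cX cY] := @inv_XVP (serX _) (serY
  _) x0 y0 xy.
  rewrite -[RHS]mkptK; apply: mkpt_eq => m hm.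
    have : cong l (hx (h' w)) (serX w).
      by apply: cong_trans cX; apply: congM => //; apply: congX; exact: gX.
    exact.
  have : cong l (hy (h' w)) (serY w).
    by apply: cong_trans cY; apply: congM; [apply: congX; exact: gX|exact: gV].
  exact.
- apply: rf_mk => m _; apply: polyf_rf; rewrite /hx /hy.
    by apply: pfamM; [exact: pfam_cst|apply: pfamX; exact: pfam_serX].
  by apply: pfamM; [apply: pfamX; exact: pfam_serX|exact: pfam_serV].
- have rX0 : rf target (fun w => coef (serX w) 0) by apply: polyf_rf; exact: pfam_serX.
  have rY0 : rf target (fun w => coef (serY w) 0) by apply: polyf_rf; exact: pfam_serY.
  have rX : rfam target (@serX l.+1 l.+1) by move=> m; apply: polyf_rf; exact: pfam_serX.
  have rY : rfam target (@serY l.+1 l.+1) by move=> m; apply: polyf_rf; exact: pfam_serY.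
  have rc : rf target (fun w => inv_c (coef (serX w) 0) (coef (serY w) 0)).
    apply: rfM; first by apply: rf_exp; apply: rfM => //; exact: rf_cst.
    apply: rfV; last by apply: rf_exp; apply: rfM => //; exact: rf_cst.
    by move=> w [_ /eqP y0 _ _]; rewrite expf_neq0 // mulf_neq0 // invr_eq0 expf_neq0.
  have rr : rfam target (fun w => root_iter p (cst (coef (serX w) 0)^-1 * serX w) l).
    apply: rfam_root; apply: rfam_scal => //; apply: rfV => // w [/eqP x0 _ _ _]; exact: x0.
  apply: rf_mk => m _.
    exact: (rfam_scal rc rr).
  apply: (rfam_scal (c := fun w => (inv_c (coef (serX w) 0) (coef (serY w) 0) ^+ q)^-1)).
    apply: rfV; last exact: rf_exp.
    move=> w [/eqP x0 /eqP y0 xy _]; have [c0 _ _] := inv_cP x0 y0 xy.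
    by rewrite expf_neq0.
  by apply: rfamM => //; apply: rfam_inv; exact: rfamX.
Qed.

End ChangeOfVariables.

(** * Measures of cells of arcs *)

Section CellMeasures.
Variable k : fieldType.
Local Notation ell := (cinv (Lloc k)).
Local Notation cst c := (fps_term c 0).
Local Notation Tpow i := (fps_term (1 : k) i).

Lemma cong_shift l i (f : fps k) (x : nat -> k) : (0 < i)%N -> ordge i f ->
  (forall m, (m < l.+1)%N -> x m = coef f (i + m)) ->
  cong l (Tpow i * Fps x) f.
Proof.
move=> i0 hf hx m hm; rewrite coef_termM; case: ltnP => mi; first by rewrite hf.
by rewrite mul1r /= hx ?subnKC //; lia.
Qed.

Lemma vcl_nonzero_line : vcl [set x : affpt k 1 | x ord0 <> 0] = Lef k - 1.
Proof.
apply/eqP; rewrite eq_sym subr_eq; apply/eqP.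
rewrite -[LHS]vcl_line (vcl_cut (lcT k 1) (@polyf_coord k 1 ord0)) !setTI addrC; congr (_ + _).
rewrite -(vcl_pt k); apply: (@vcl_iso _ _ _ _ _ (fun _ _ => 0) (fun _ _ => 0)) => //.
- by move=> x /= x0; apply/funext => i; rewrite ord1.
- by move=> y _; apply/funext => -[].
- by move=> i; exact: rf_cst.
- by move=> i; exact: rf_cst.
Qed.

Lemma vcl_nonzero (b : bool) : vcl [set x : affpt k b | forall i, x i <> 0] = (Lef k - 1) ^+ b.
Proof.
case: b; last by rewrite expr0 -(vcl_pt k); congr (@vcl k 0 _); apply/seteqP; split=> // x _ [].
rewrite expr1 -vcl_nonzero_line; congr vcl; apply/seteqP; split=> x /=; first exact.
by move=> x0 i; rewrite ord1.
Qed.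

Lemma lc_nonzero n : locally_closed [set x : affpt k n | forall i, x i <> 0].
Proof.
by apply: (@lc_forall k n 'I_n (fun i => [set x | x i <> 0])) => i; apply: lc_neq0;
  exact: polyf_coord.
Qed.

(** A flag that is off leaves the order merely bounded below, as needed for the last index n + 1. *)
Definition cell (b1 b2 : bool) i j : set (arc k) :=
  [set phi | [/\ ordge i phi.1, ordge j phi.2, b1 -> coef phi.1 i <> 0 & b2 -> coef phi.2 j <> 0]].

(** Of the order i + 1 only i coefficients are forced to vanish, the constant term being zero
    anyway; a flag that is on adds a nonzero leading coefficient, which gives a factor L - 1 and one
    more coefficient in the exponent. *)
Lemma motmeas_cell b1 b2 i j :
  motmeas (cell b1 b2 i.+1 j.+1) = (Lloc k - 1) ^+ (b1 + b2) * ell ^+ (i + b1 + (j + b2)).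
Proof.
pose C : set (affpt k (b1 + b2)) := [set x | forall i, x i <> 0].
have -> : cell b1 b2 i.+1 j.+1 = jets_in i j C.
  apply/seteqP; split=> phi.
    move=> [h1 h2 h3 h4]; split.
    - by split; [exact: h1|exact: h2].
    - by move=> m hm; exact: h1.
    - by move=> m hm; exact: h2.
    - move=> a; rewrite /mkpt; case: fintype.split => c.
        by have := ltn_ord c; case: b1 h3 {a C} c => h3 c //= hc; case: c hc => -[|//] _ _ /=;
          rewrite addn0; exact: h3.
      by have := ltn_ord c; case: b2 h4 {a C} c => h4 c //= hc; case: c hc => -[|//] _ _ /=;
        rewrite addn0; exact: h4.
  move=> [/arcs0_ordge [a1 a2] h1 h2 h3]; split.
  - by move=> [|m] hm; [exact: a1|exact: h1].
  - by move=> [|m] hm; [exact: a2|exact: h2].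
  - move=> hb; have hb1 : (0 < b1)%N by rewrite hb.
    by have := h3 (lshift b2 (Ordinal hb1)); rewrite /mkpt (unsplitK (inl _ (Ordinal hb1))) /=
      addn0.
  - move=> hb; have hb1 : (0 < b2)%N by rewrite hb.
    by have := h3 (rshift b1 (Ordinal hb1)); rewrite /mkpt (unsplitK (inr _ (Ordinal hb1))) /=
      addn0.
rewrite motmeas_jets; last exact: lc_nonzero.
congr (_ * _); have -> : C = Sprod [set x : affpt k b1 | forall i, x i <> 0] [set x : affpt k b2
  | forall i, x i <> 0].
  apply/seteqP; split=> x; first by move=> h; split=> a; exact: h.
  move=> [h1 h2] a; rewrite -[x]ljoinK /ljoin; case: fintype.split => c; [exact: h1|exact: h2].
rewrite vcl_prod; [|exact: lc_nonzero|exact: lc_nonzero].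
by rewrite !vcl_nonzero -exprD rmorphXn rmorphB rmorph1.
Qed.

Section Newton.
Variables (p q : nat) (mu : k).
Hypotheses (p0 : (p%:R : k) != 0) (pp : (0 < p)%N) (qp : (0 < q)%N) (mu0 : mu != 0).
Local Notation e := (newton_exps p q).
Hypothesis pe : (p * e.1 = q * e.2 + 1)%N.
Variable l : nat.
Variable O : arc k -> Prop.
Hypothesis O_cong : forall phi psi, cong l phi.1 psi.1 -> cong l phi.2 psi.2 -> O phi -> O psi.
Hypothesis O_lc : forall n (X Y : affpt k n -> fps k), pfam X -> pfam Y ->
  locally_closed [set z | O (X z, Y z)].

Definition root_cell i j : set (arc k) :=
  cell true true i j `&` [set phi | coef phi.2 j ^+ p = mu * coef phi.1 i ^+ q].

Lemma motmeas_target i j : (0 < i)%N -> (0 < j)%N ->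
  motmeas (root_cell i j `&` O) =
  to_loc [set Lef k] (vcl (@target k p q mu l O i j)) * ell ^+ (i + l + (j + l)).
Proof.
case: i => // i _; case: j => // j _.
have -> : root_cell i.+1 j.+1 `&` O = jets_in i j (@target k p q mu l O i.+1 j.+1).
  apply/seteqP; split=> phi.
    move=> [[[h1 h2 /(_ isT) h3 /(_ isT) h4] h5] hO]; split.
    - by split; [exact: h1|exact: h2].
    - by move=> m hm; exact: h1.
    - by move=> m hm; exact: h2.
    - split; rewrite ?xs_mk ?ys_mk ?addn0 //.
      apply: O_cong hO; apply: cong_sym; apply: cong_shift => // m hm;
      by rewrite ?xs_mk ?ys_mk hm.
  move=> [/arcs0_ordge [a1 a2] h1 h2 []]; rewrite ?xs_mk ?ys_mk ?addn0 /= => x0 y0 xy hO.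
  have o1 : ordge i.+1 phi.1 by move=> [|m] hm; [exact: a1|exact: h1].
  have o2 : ordge j.+1 phi.2 by move=> [|m] hm; [exact: a2|exact: h2].
  split; first by split.
  apply: O_cong hO; apply: cong_shift => // m hm; by rewrite ?xs_mk ?ys_mk hm.
rewrite motmeas_jets; last exact: lc_target.
by congr (_ * _ ^+ _); lia.
Qed.

Lemma motmeas_source i : (0 < i)%N ->
  motmeas ([set phi | [/\ arcs0 phi, ordge i phi.1 & coef phi.1 i <> 0]] `&` [set phi | O (narc p
    q mu phi)]) =
  to_loc [set Lef k] (vcl (@source k p q e mu l O (p * i) (q * i))) * ell ^+ (i + l + l).
Proof.
case: i => // i _.
pose Z (phi : arc k) := mkpt l.+1 l (fun m => coef phi.1 (i + m).+1) (fun m => coef phi.2 (0 +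
  m).+1).
have key (phi : arc k) : ordge i.+1 phi.1 -> ordge 1 phi.2 ->
  cong l (narc p q mu phi).1 (Tpow (p * i.+1) * (cst (mu ^+ e.2) * serX (Z phi) ^+ p)) /\
  cong l (narc p q mu phi).2 (Tpow (q * i.+1) * (serX (Z phi) ^+ q * serV e mu (Z phi))).
  move=> o1 o2; have cX : cong l (Tpow i.+1 * serX (Z phi)) phi.1.
    by apply: cong_shift => // m hm; rewrite xs_mk hm.
  have cV : cong l (serV e mu (Z phi)) (phi.2 + cst (mu ^+ e.1)).
    by move=> [|m] hm; rewrite coefD coef_term /=; [rewrite o2 ?add0r|rewrite ys_mk hm addr0].
  split; apply: cong_sym.
    have -> : Tpow (p * i.+1) * (cst (mu ^+ e.2) * serX (Z phi) ^+ p) = cst (mu ^+ e.2) * (Tpow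
      i.+1 * serX (Z phi)) ^+ p.
      by rewrite exprMn fps_termX expr1n (mulnC p); ring.
    by apply: congM => //; exact: congX.
  have -> : Tpow (q * i.+1) * (serX (Z phi) ^+ q * serV e mu (Z phi)) = (Tpow i.+1 * serX (Z
    phi)) ^+ q * serV e mu (Z phi).
    by rewrite exprMn fps_termX expr1n (mulnC q); ring.
  by apply: congM => //; exact: congX.
set A := (X in motmeas X); have -> : A = jets_in i 0 (@source k p q e mu l O (p * i.+1) (q * i.+1)).
  apply/seteqP; split=> phi.
    move=> [[a0 h1 h3] hO]; have /arcs0_ordge [_ o2] := a0; have [k1 k2] := key _ h1 o2.
    split=> //; first by move=> m hm; exact: h1.
    split; first by rewrite xs_mk /= addn0.
    exact: O_cong hO.
  move=> [a0 h1 h2 []]; rewrite xs_mk /= addn0 => x0 hO.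
  have /arcs0_ordge [a1 o2] := a0.
  have o1 : ordge i.+1 phi.1 by move=> [|m] hm; [exact: a1|exact: h1].
  have [k1 k2] := key _ o1 o2.
  by split=> //; apply: O_cong hO; apply: cong_sym.
rewrite motmeas_jets; last exact: lc_source.
by rewrite add0n -addSnnS.
Qed.

(** The exponent is the difference between the p i + q i + 2 l coefficients seen on the target and
    the i + 2 l on the source. It is also the order of the Jacobian, which up to a constant is
    x1^(p+q-1). *)
Lemma motmeas_newton i : (0 < i)%N ->
  motmeas (root_cell (p * i) (q * i) `&` O) =
  motmeas ([set phi | [/\ arcs0 phi, ordge i phi.1 & coef phi.1 i <> 0]] `&` [set phi | O (narc p
    q mu phi)])
   * ell ^+ ((p + q).-1 * i).
Proof.
move=> i0; rewrite motmeas_target ?muln_gt0 ?pp ?qp // motmeas_source //.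
rewrite -mulrA -exprD (@vcl_source_target k p q e mu l) //; congr (_ * _ ^+ _).
by case: p pp => // p' _; rewrite addSn /= mulnDl mulSn; lia.
Qed.

End Newton.

(** For l = 0 and the trivial condition, the source is a line without its origin, parametrized by
    the leading coefficient of x1. *)
Lemma motmeas_root_cell p q mu i j : (p%:R : k) != 0 -> (0 < p)%N -> (0 < q)%N -> mu != 0 ->
  (p * (newton_exps p q).1 = q * (newton_exps p q).2 + 1)%N -> (0 < i)%N -> (0 < j)%N ->
  motmeas (root_cell p q mu i j) = (Lloc k - 1) * ell ^+ (i + j).
Proof.
move=> p0 pp qp mu0 pe i0 j0.
have cT : forall phi psi : arc k, cong 0 phi.1 psi.1 -> cong 0 phi.2 psi.2 -> True -> True by [].
have lT n (X Y : affpt k n -> fps k) : pfam X -> pfam Y -> locally_closed [set z : affpt k n |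
  True].
  by move=> _ _; exact: lcT.
have -> : root_cell p q mu i j = root_cell p q mu i j `&` (fun=> True) by apply/seteqP;
  split=> [x|x []].
rewrite (motmeas_target p0 pp qp mu0 pe cT lT i0 j0).
rewrite -(@vcl_source_target k p q (newton_exps p q) mu 0) //.
have -> : (i + 0 + (j + 0))%N = (i + j)%N by rewrite !addn0.
congr (_ * _).
have -> : vcl (@source k p q (newton_exps p q) mu 0 (fun=> True) i j) = vcl [set x : affpt k true
  | forall i, x i <> 0].
  congr vcl; apply/seteqP; split=> x; last by move=> h; split=> //; rewrite /xs;
    case: insubP => // a _ _; exact: h.
  move=> [+ _] a; rewrite /xs; case: insubP => // b _ b0.
  by have -> : a = lshift 0 b by apply/val_inj; rewrite /= ord1; case: (a) => -[].
by rewrite (vcl_nonzero true) expr1 rmorphB rmorph1.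
Qed.

End CellMeasures.

(** * The Newton polygon *)

Section HullCombinatorics.
Variable A : set (nat * nat).
Implicit Types (F : face) (u v w : nat * nat) (vs : seq (nat * nat)).

Definition supports F := forall u, A u -> (fN F <= fp F * u.1 + fq F * u.2)%N.

(** Two supporting lines through v whose normals turn counterclockwise from [F1] to [F2]. The
    normals (1, 0) and (0, 1) of the unbounded faces are normalized. The last two fields hold
    because v is at least one lattice step away from the other end of a compact face; they force
    [fq F1] = 0 when v.1 = 0 and [fp F2] = 0 when v.2 = 0. *)
Record corner F1 F2 v : Prop := Corner {
  corner_in : A v;
  corner_s1 : supports F1;
  corner_s2 : supports F2;
  corner_N1 : fN F1 = (fp F1 * v.1 + fq F1 * v.2)%N;
  corner_N2 : fN F2 = (fp F2 * v.1 + fq F2 * v.2)%N;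
  corner_det : (fq F1 * fp F2 < fp F1 * fq F2)%N;
  corner_p1 : fq F1 = 0%N -> fp F1 = 1%N;
  corner_q2 : fp F2 = 0%N -> fq F2 = 1%N;
  corner_v1 : (fq F1 <= v.1)%N;
  corner_v2 : (fp F2 <= v.2)%N
}.

(** The chain of vertices after v, where F is the face that reaches v from the left. *)
Fixpoint hull_from F v vs : Prop :=
  match vs with
  | [::] => corner F (Face 0 1 v.2) v
  | w :: vs' => [/\ (v.1 < w.1)%N, (w.2 < v.2)%N, corner F (compact_face v w) v &
                 hull_from (compact_face v w) w vs']
  end.

(** The witness is the lattice length of the edge, the gcd of its width and height. *)
Lemma compact_faceP v w : (v.1 < w.1)%N -> (w.2 < v.2)%N -> exists g,
  [/\ (0 < g)%N, (v.2 - w.2 = fp (compact_face v w) * g)%N,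
   (w.1 - v.1 = fq (compact_face v w) * g)%N,
   (0 < fp (compact_face v w))%N /\ (0 < fq (compact_face v w))%N &
   coprime (fp (compact_face v w)) (fq (compact_face v w))].
Proof.
move=> h1 h2; pose g := gcdn (v.2 - w.2) (w.1 - v.1).
have g0 : (0 < g)%N by rewrite gcdn_gt0 subn_gt0 h2.
have e1 : (v.2 - w.2 = fp (compact_face v w) * g)%N by rewrite divnK // dvdn_gcdl.
have e2 : (w.1 - v.1 = fq (compact_face v w) * g)%N by rewrite divnK // dvdn_gcdr.
exists g; split=> //.
  by split; rewrite lt0n; apply/eqP => z; move: e1 e2; rewrite z mul0n; lia.
rewrite /coprime -(eqn_pmul2r g0) mul1n muln_gcdl -e1 -e2 //.
Qed.

Lemma fN_compact v w : fN (compact_face v w) = (fp (compact_face v w) * v.1 + fq (compact_face v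
  w) * v.2)%N.
Proof. by []. Qed.

(** Among the points below [v] take those of steepest descent, and among these the lowest. *)
Lemma steepest v : (forall u, A u -> (u.2 < v.2)%N -> (v.1 < u.1)%N) ->
  (exists2 u, A u & (u.2 < v.2)%N) ->
  exists w, [/\ A w, (w.2 < v.2)%N &
    forall u, A u -> (u.2 < v.2)%N ->
     ((w.1 - v.1) * (v.2 - u.2) <= (u.1 - v.1) * (v.2 - w.2))%N /\
     ((u.2 < w.2)%N -> ((w.1 - v.1) * (v.2 - u.2) < (u.1 - v.1) * (v.2 - w.2))%N)].
Proof.
(* The denominators v.2 - u.2 of the inverse slopes all divide v.2!, so [r] compares them as natural
   numbers. As u.2 < v.2, [key] encodes the lexicographic order on (r u, u.2). *)
move=> right [u0 Au0 u0v]; pose r u := ((u.1 - v.1) * (v.2`! %/ (v.2 - u.2)))%N.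
pose key u := (r u * v.2 + u.2)%N.
have kr u : (u.2 < v.2)%N -> (r u * (v.2 - u.2) = (u.1 - v.1) * v.2`!)%N.
  by move=> uv; rewrite /r -mulnA divnK // dvdn_fact // subn_gt0 uv leq_subr.
pose P n := `[< exists u, [/\ A u, (u.2 < v.2)%N & key u = n] >].
have exP : exists n, P n by exists (key u0); apply/asboolP; exists u0.
case: (ex_minnP exP) => n /asboolP [w [Aw wv kw]] nmin; exists w; split=> // u Au uv.
have kle : (key w <= key u)%N by rewrite kw; apply: nmin; apply/asboolP; exists u.
have rle : (r w <= r u)%N.
  rewrite leqNgt; apply/negP => lt.
  have : (r u * v.2 + v.2 <= r w * v.2)%N by rewrite addnC -mulSn leq_mul2r lt orbT.
  by rewrite /key in kle; lia.
have f0 : (0 < v.2`!)%N by exact: fact_gt0.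
have e1 : ((w.1 - v.1) * (v.2 - u.2) * v.2`! = r w * ((v.2 - w.2) * (v.2 - u.2)))%N.
  by rewrite mulnAC -kr // -!mulnA.
have e2 : ((u.1 - v.1) * (v.2 - w.2) * v.2`! = r u * ((v.2 - w.2) * (v.2 - u.2)))%N.
  by rewrite mulnAC -kr // -mulnA (mulnC (v.2 - u.2)%N).
split; first by rewrite -(leq_pmul2r f0) e1 e2 leq_mul2r rle orbT.
move=> uw; rewrite -(ltn_pmul2r f0) e1 e2 ltn_pmul2r; last by rewrite muln_gt0 !subn_gt0 wv.
rewrite ltn_neqAle rle andbT; apply/eqP => e.
by move: kle; rewrite /key e leq_add2l; lia.
Qed.

(** Induction on the height of v. The last hypothesis says that v is the lowest point on the line of
    F, which makes the next normal turn strictly. *)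
Lemma hull_exists n F v : (v.2 <= n)%N -> A v -> supports F ->
  fN F = (fp F * v.1 + fq F * v.2)%N -> (0 < fp F)%N -> (fq F = 0%N -> fp F = 1%N) ->
  (fq F <= v.1)%N -> (forall u, A u -> (u.2 < v.2)%N -> (fN F < fp F * u.1 + fq F * u.2)%N) ->
  exists vs, hull_from F v vs.
Proof.
elim: n F v => [|n IH] F v vn Av sF eN p0 q0 qv low.
  exists [::]; apply: Corner => //=; try by [lia|rewrite mul0n mul1n].
  by move=> u _ /=; lia.
have [[u0 Au0 u0v]|none] := pselect (exists2 u, A u & (u.2 < v.2)%N); last first.
  have s2 : supports (Face 0 1 v.2).
    by move=> u Au /=; rewrite mul0n mul1n add0n leqNgt; apply/negP => uv; apply: none; exists u.
  by clear none; exists [::]; apply: Corner => //=; lia.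
have right u : A u -> (u.2 < v.2)%N -> (v.1 < u.1)%N.
  move=> Au uv; have := low _ Au uv; rewrite eN => h.
  have : (fq F * u.2 <= fq F * v.2)%N by rewrite leq_mul2l (ltnW uv) orbT.
  move=> h'; have : (fp F * v.1 < fp F * u.1)%N by lia.
  by rewrite ltn_pmul2l.
have [w [Aw wv hw]] := steepest right (ex_intro2 _ _ u0 Au0 u0v).
have vw := right _ Aw wv.
have [g [g0 e1 e2 [P0 Q0] co]] := compact_faceP vw wv.
set S := compact_face v w in e1 e2 P0 Q0 co *.
have det : (fq F * fp S < fp F * fq S)%N.
  rewrite -(ltn_pmul2r g0) -!mulnA -e1 -e2; have := low _ Aw wv; rewrite eN !mulnBr => h.
  have : (fp F * v.1 <= fp F * w.1)%N by rewrite leq_mul2l (ltnW vw) orbT.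
  have : (fq F * w.2 <= fq F * v.2)%N by rewrite leq_mul2l (ltnW wv) orbT.
  by lia.
have eS : fN S = (fp S * v.1 + fq S * v.2)%N by [].
have eS' : fN S = (fp S * w.1 + fq S * w.2)%N.
  rewrite eS; have -> : w.1 = (v.1 + fq S * g)%N by lia.
  have -> : v.2 = (w.2 + fp S * g)%N by lia.
  by rewrite !mulnDr; lia.
(* For points below v this is the choice of w; for points above and to the right it is clear; for
   points above and to the left it follows from the line of F, which is steeper. *)
have sS : supports S.
  move=> u Au; rewrite eS; have [uv|vu] := ltnP u.2 v.2.
    have [h _] := hw _ Au uv; move: h; rewrite e1 e2 => h.
    have : (fq S * (v.2 - u.2) <= (u.1 - v.1) * fp S)%N.
      by rewrite -(leq_pmul2r g0); lia.
    have := right _ Au uv => h2 h3.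
    have -> : u.1 = (v.1 + (u.1 - v.1))%N by lia.
    have -> : v.2 = (u.2 + (v.2 - u.2))%N by lia.
    by rewrite !mulnDr; lia.
  have [ul|lu] := leqP v.1 u.1; first by rewrite leq_add // leq_mul2l ?ul ?vu orbT.
  have := sF _ Au; rewrite eN => h.
  have h1 : (fp F * (v.1 - u.1) <= fq F * (u.2 - v.2))%N.
    have h1 : (fp F * u.1 <= fp F * v.1)%N by rewrite leq_mul2l (ltnW lu) orbT.
    by rewrite !mulnBr; lia.
  have h2 : (fp S * (v.1 - u.1) <= fq S * (u.2 - v.2))%N.
    rewrite -(leq_pmul2l p0).
    apply: (@leq_trans (fp S * (fq F * (u.2 - v.2)))).
      by rewrite mulnCA leq_mul2l h1 orbT.
    by rewrite !mulnA leq_mul2r [(fp S * _)%N]mulnC (ltnW det) orbT.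
  have -> : v.1 = (u.1 + (v.1 - u.1))%N by lia.
  have -> : u.2 = (v.2 + (u.2 - v.2))%N by lia.
  by rewrite !mulnDr; lia.
have wQ : (fq S <= w.1)%N.
  have : (fq S * 1 <= fq S * g)%N by rewrite leq_mul2l g0 orbT.
  by lia.
have vP : (fp S <= v.2)%N.
  have : (fp S * 1 <= fp S * g)%N by rewrite leq_mul2l g0 orbT.
  by lia.
have [|||vs hvs] := IH S w _ Aw sS eS' P0 _ wQ.
- by lia.
- by move=> z; rewrite z in Q0.
- move=> u Au uw; have uv : (u.2 < v.2)%N by lia.
  have [_ /(_ uw)] := hw _ Au uv; rewrite e1 e2 => h.
  have : (fq S * (v.2 - u.2) < (u.1 - v.1) * fp S)%N.
    by rewrite -(ltn_pmul2r g0); lia.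
  have := right _ Au uv => h2 h3; rewrite eS.
  have -> : u.1 = (v.1 + (u.1 - v.1))%N by lia.
  have -> : v.2 = (u.2 + (v.2 - u.2))%N by lia.
  by rewrite !mulnDr; lia.
exists (w :: vs); split=> //; split=> //.
by move=> z; rewrite z in P0.
Qed.

(** The chain starts at the lowest point among those of smallest abscissa. *)
Lemma hull_start : (exists u, A u) -> exists v vs, hull_from (Face 1 0 v.1) v vs.
Proof.
move=> [u0 Au0].
pose P1 n := `[< exists2 u, A u & u.1 = n >].
have ex1 : exists n, P1 n by exists u0.1; apply/asboolP; exists u0.
case: (ex_minnP ex1) => a /asboolP [u1 Au1 u1a] amin.
pose P2 n := `[< A (a, n) >].
have ex2 : exists n, P2 n by exists u1.2; apply/asboolP; rewrite -u1a; case: (u1) Au1.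
case: (ex_minnP ex2) => b /asboolP Aab bmin.
have left u : A u -> (a <= u.1)%N by move=> Au; apply: amin; apply/asboolP; exists u.
exists (a, b); apply: (@hull_exists b) => //=.
- by move=> u Au /=; rewrite mul1n mul0n addn0; exact: left.
- by rewrite mul1n mul0n addn0.
- move=> u Au ub; rewrite mul1n mul0n addn0 ltn_neqAle left // andbT; apply/eqP => e.
  have : (b <= u.2)%N by apply: bmin; apply/asboolP; rewrite e; case: (u) Au.
  by lia.
Qed.

Lemma compact_faces_cons v w vs : compact_faces (v :: w :: vs) = compact_face v w ::
  compact_faces (w :: vs).
Proof. by rewrite /compact_faces /= -[1%N]add1n iotaDl -map_comp. Qed.

Lemma hull_fromP F v vs : hull_from F v vs -> forall i, (i <= size vs)%N ->
  let Fs := F :: rcons (compact_faces (v :: vs)) (Face 0 1 (last v vs).2) in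
  corner (nth (Face 0 0 0) Fs i) (nth (Face 0 0 0) Fs i.+1) (nth (0, 0)%N (v :: vs) i).
Proof.
elim: vs F v => [|w vs IH] F v; first by move=> h [|//] _.
move=> [h1 h2 h3 h4] i; rewrite compact_faces_cons; case: i => [|i] hi //.
exact: (IH _ _ h4).
Qed.

Lemma hull_from_sorted F v vs : hull_from F v vs ->
  path (fun u v : nat * nat => (u.1 < v.1) && (v.2 < u.2))%N v vs.
Proof.
elim: vs F v => [|w vs IH] F v //= [h1 h2 _ h4]; rewrite h1 h2; exact: IH h4.
Qed.

End HullCombinatorics.

(** * The vertices of the Newton diagram *)

Section ConvexHull.
Variable R : realType.
Implicit Types (z a b : R^o * R^o) (D : set (R^o * R^o)).

Lemma convexP D : @convex_set R (R^o * R^o)%type D <->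
  forall a b (t : R), D a -> D b -> 0 <= t -> t <= 1 -> D (t *: a + (1 - t) *: b).
Proof.
split=> [h a b t Da Db t0 t1|h a b t /set_mem Da /set_mem Db].
  by have := h a b (Itv01 t0 t1) (mem_set Da) (mem_set Db) => /set_mem.
by apply/mem_set; apply: h.
Qed.

Lemma smallest_convex G : @convex_set R (R^o * R^o)%type (smallest (@convex_set R (R^o *
  R^o)%type) G).
Proof.
apply/convexP => a b t Ga Gb t0 t1 M [cM GM]; move/convexP: (cM); apply => //.
  by apply: Ga.
by apply: Gb.
Qed.

Variable k : fieldType.
Variable fs : seq (fps2 k).
Definition gen_supp : set (nat * nat) := [set u | exists2 f, f \in fs & supp f u].
Local Notation D := (@newton_diagram k R fs).
Definition pt_of (u : nat * nat) : R^o * R^o := (u.1%:R, u.2%:R).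

Lemma D_gen u x y : gen_supp u -> 0 <= x -> 0 <= y -> D (u.1%:R + x, u.2%:R + y).
Proof. by move=> [f ffs sf] x0 y0; apply: sub_gen_smallest; exists f, u, x, y. Qed.

Lemma D_pt u : gen_supp u -> D (pt_of u).
Proof. by move=> Au; have := D_gen Au (lexx 0) (lexx 0); rewrite !addr0. Qed.

Lemma D_supports F z : supports gen_supp F -> D z ->
  (fN F)%:R <= (fp F)%:R * z.1 + (fq F)%:R * z.2.
Proof.
move=> sF; apply: (_ : D `<=` [set z : R^o * R^o | (fN F)%:R <= (fp F)%:R * z.1 + (fq F)%:R * z.2]).
apply: smallest_sub.
  apply/convexP => a b t /= ha hb t0 t1.
  have := ler_wpM2l t0 ha; have := ler_wpM2l (_ : 0 <= 1 - t) hb; rewrite subr_ge0 => /(_ t1).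
  rewrite /GRing.scale /=; lra.
move=> _ [f [u [x [y [ffs fu x0 y0 ->]]]]] /=.
have := sF u (ex_intro2 _ _ f ffs fu); rewrite -(ler_nat R) natrD !natrM.
have := mulr_ge0 (ler0n R (fp F)) x0; have := mulr_ge0 (ler0n R (fq F)) y0; lra.
Qed.

Lemma pair_eq (T T' : Type) (z w : T * T') : z.1 = w.1 -> z.2 = w.2 -> z = w.
Proof. by case: z w => x y [x' y'] /= -> ->. Qed.

Lemma midpoint_not_vertex z x y : D (z.1 - x, z.2 - y) -> D (z.1 + x, z.2 + y) -> (x != 0) || (y
  != 0) ->
  ~ is_vertex D z.
Proof.
move=> d1 d2 nz [_ h].
have [e1 e2] : (z.1 - x, z.2 - y) = (z.1 + x, z.2 + y) :> R^o * R^o.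
  apply: (h _ _ (1/2) d1 d2); [by lra|by lra|].
  by apply: pair_eq; rewrite /GRing.scale /= /GRing.scale /=; lra.
have x0 : x = 0 by clear - e1; lra.
have y0 : y = 0 by clear - e2; lra.
by move: nz; rewrite x0 y0 eqxx.
Qed.

(** Both ends of the chord are raised by the height c of z above it. *)
Lemma D_segment v w z : gen_supp v -> gen_supp w -> (v.1 < w.1)%N ->
  (v.1%:R : R) <= z.1 -> z.1 <= w.1%:R ->
  (w.1%:R - v.1%:R) * z.2 >= (w.1%:R - z.1) * v.2%:R + (z.1 - v.1%:R) * w.2%:R -> D z.
Proof.
move=> Av Aw vw z0 z1 hz.
have d0 : 0 < (w.1%:R - v.1%:R : R) by rewrite subr_gt0 ltr_nat.
pose t := (w.1%:R - z.1) / (w.1%:R - v.1%:R) : R.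
have et : t * (w.1%:R - v.1%:R) = w.1%:R - z.1 by rewrite /t mulfVK // gt_eqF.
have t0 : 0 <= t by rewrite divr_ge0 ?subr_ge0 // ltW // -subr_gt0.
have t1 : t <= 1 by rewrite ler_pdivrMr // mul1r; lra.
pose c := z.2 - (t * v.2%:R + (1 - t) * w.2%:R).
have c0 : 0 <= c.
  rewrite -(pmulr_rge0 _ d0) /c.
  have -> : (w.1%:R - v.1%:R) * (z.2 - (t * v.2%:R + (1 - t) * w.2%:R)) =
    (w.1%:R - v.1%:R) * z.2 - (t * (w.1%:R - v.1%:R)) * v.2%:R - ((w.1%:R - v.1%:R) - t * (w.1%:R
      - v.1%:R)) * w.2%:R by ring.
  by rewrite et; lra.
have cD : @convex_set R (R^o * R^o)%type D := @smallest_convex _; move/convexP in cD.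
have := cD _ _ t (D_gen Av (lexx 0) c0) (D_gen Aw (lexx 0) c0) t0 t1.
congr (D _); apply/esym; apply: pair_eq; rewrite /GRing.scale /= /GRing.scale /=;
  last by rewrite /c; ring.
have -> : t * (v.1%:R + 0) + (1 - t) * (w.1%:R + 0) = w.1%:R - t * (w.1%:R - v.1%:R) by ring.
by rewrite et; ring.
Qed.

(** A vertex z over an edge cannot lie strictly above it, being then the midpoint of a vertical
    segment in the diagram, nor in its interior. Beyond the last vertex v, the reflection of v in z
    stays in the quadrant at v. *)
Lemma hull_vertex_in F v vs z : hull_from gen_supp F v vs -> is_vertex D z -> v.1%:R <= z.1 ->
  exists2 u, u \in v :: vs & z = pt_of u.
Proof.
move=> + vz; have Dz := vz.1; elim: vs F v => [|w vs IH] F v /=.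
  move=> c vz1; exists v; rewrite ?inE //.
  have := D_supports (corner_s2 c) Dz; rewrite /= mul0r mul1r add0r => vz2.
  have [/andP[/eqP x0 /eqP y0]|nz] := boolP ((z.1 - v.1%:R == 0) && (z.2 - v.2%:R == 0)).
    by apply: pair_eq => /=; lra.
  have := @midpoint_not_vertex z (z.1 - v.1%:R) (z.2 - v.2%:R).
  rewrite negb_and in nz => /(_ _ _ nz) []; last exact: vz.
    have -> : (z.1 - (z.1 - v.1%:R), z.2 - (z.2 - v.2%:R)) = pt_of v by congr pair; ring.
    by apply: D_pt; exact: (corner_in c).
  have -> : (z.1 + (z.1 - v.1%:R), z.2 + (z.2 - v.2%:R)) = (v.1%:R + 2 * (z.1 - v.1%:R), v.2%:R +
    2 * (z.2 - v.2%:R)) by congr pair; ring.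
  by apply: D_gen; [exact: (corner_in c)|lra|lra].
move=> [h1 h2 c hw] vz1.
have [wz|zw] := lerP w.1%:R z.1.
  by have [u ui ->] := IH _ _ hw wz; exists u => //; rewrite inE ui orbT.
have Aw : gen_supp w by case: vs hw {IH} => [|? ?] /=; [exact: corner_in|case=> _ _ /corner_in].
have Av := corner_in c.
have [g [g0 e1 e2 [P0 Q0] co]] := compact_faceP h1 h2.
have := D_supports (corner_s2 c) Dz; rewrite fN_compact natrD !natrM.
set P := (fp _)%:R; set Q := (fq _)%:R => sz.
have G0 : 0 < g%:R :> R by rewrite ltr0n.
have E1 : v.2%:R - w.2%:R = P * g%:R :> R by rewrite -natrM -e1 natrB // ltnW.
have E2 : w.1%:R - v.1%:R = Q * g%:R :> R by rewrite -natrM -e2 natrB // ltnW.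
have Q0' : 0 < Q :> R by rewrite ltr0n.
have P0' : 0 < P :> R by rewrite ltr0n.
have sz' : P * g%:R * v.1%:R + Q * g%:R * v.2%:R <= P * g%:R * z.1 + Q * g%:R * z.2.
  by have := ler_wpM2r (ltW G0) sz; lra.
have Dtop y : (w.1%:R - v.1%:R) * y >= (w.1%:R - z.1) * v.2%:R + (z.1 - v.1%:R) * w.2%:R -> D
  (z.1, y).
  by move=> hy; apply: (D_segment Av Aw h1) => //=; exact: ltW.
(* The height of the edge over the abscissa of z. *)
pose y0 := v.2%:R - P / Q * (z.1 - v.1%:R).
have ey : Q * g%:R * y0 = Q * g%:R * v.2%:R - P * g%:R * (z.1 - v.1%:R).
  by rewrite /y0; field; rewrite gt_eqF.
have y0z : y0 <= z.2 by rewrite -(ler_pM2l (mulr_gt0 Q0' G0)) ey; lra.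
have v2e : v.2%:R = w.2%:R + P * g%:R by rewrite -E1; ring.
have [ez|ne] := eqVneq z.2 y0; last first.
  have := @midpoint_not_vertex z 0 (z.2 - y0).
  rewrite !addr0 !subr0 subr_eq0 ne orbT => /(_ _ _ isT) []; last exact: vz.
    apply: Dtop; rewrite E2; have -> : z.2 - (z.2 - y0) = y0 by ring.
    by rewrite ey; nra.
  apply: Dtop; rewrite E2; have : Q * g%:R * y0 <= Q * g%:R * z.2 by rewrite ler_pM2l // mulr_gt0.
  by rewrite ey; nra.
have [ev|nv] := eqVneq z.1 v.1%:R.
  exists v; first by rewrite inE eqxx.
  by apply: pair_eq => //=; rewrite ez /y0 ev subrr mulr0 subr0.
have dwv : 0 < w.1%:R - v.1%:R :> R by rewrite subr_gt0 ltr_nat.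
pose t := (w.1%:R - z.1) / (w.1%:R - v.1%:R).
have et : t * (w.1%:R - v.1%:R) = w.1%:R - z.1 by rewrite /t mulfVK // gt_eqF.
have vz1' : v.1%:R < z.1 by rewrite lt_neqAle eq_sym nv.
have [e _] : pt_of v = pt_of w; last by move: h1; rewrite -(ltr_nat R) e ltxx.
apply: (vz.2 _ _ t (D_pt Av) (D_pt Aw)).
- by rewrite divr_gt0 // subr_gt0.
- by rewrite ltr_pdivrMr // mul1r; lra.
- apply: pair_eq; rewrite /pt_of /GRing.scale /= /GRing.scale /=.
    have -> : t * v.1%:R + (1 - t) * w.1%:R = w.1%:R - t * (w.1%:R - v.1%:R) by ring.
    by rewrite et; ring.
  rewrite ez; apply: (mulfI (lt0r_neq0 (mulr_gt0 Q0' G0))); rewrite ey.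
  have -> : Q * g%:R * (t * v.2%:R + (1 - t) * w.2%:R) = t * (Q * g%:R) * (v.2%:R - w.2%:R) + Q *
    g%:R * w.2%:R by ring.
  by rewrite -E2 et E1 E2; nra.
Qed.

(** Both ends of a segment through v must lie on both supporting lines, and these meet in one point
    because the determinant is nonzero. *)
Lemma corner_vertex F1 F2 v : corner gen_supp F1 F2 v -> is_vertex D (pt_of v).
Proof.
move=> c; split; first by apply: D_pt; exact: (corner_in c).
move=> a b t Da Db t0 t1 e.
have e1 : v.1%:R = t * a.1 + (1 - t) * b.1 by have := congr1 fst e.
have e2 : v.2%:R = t * a.2 + (1 - t) * b.2 by have := congr1 snd e.
have tight F : supports gen_supp F -> fN F = (fp F * v.1 + fq F * v.2)%N ->
   (fp F)%:R * a.1 + (fq F)%:R * a.2 = (fN F)%:R /\ (fp F)%:R * b.1 + (fq F)%:R * b.2 = (fN F)%:R.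
  move=> sF eN; have sa := D_supports sF Da; have sb := D_supports sF Db.
  have E : (fN F)%:R = t * ((fp F)%:R * a.1 + (fq F)%:R * a.2) + (1 - t) * ((fp F)%:R * b.1 + (fq
    F)%:R * b.2).
    by rewrite {1}eN natrD !natrM e1 e2; ring.
  have sa' := ler_wpM2l (ltW t0) sa; have t1' : 0 < 1 - t by rewrite subr_gt0.
  have sb' := ler_wpM2l (ltW t1') sb.
  split; apply/eqP; rewrite eq_le; apply/andP; split=> //.
    by rewrite -(ler_pM2l t0); lra.
  by rewrite -(ler_pM2l t1'); lra.
have [a1 b1] := tight _ (corner_s1 c) (corner_N1 c).
have [a2 b2] := tight _ (corner_s2 c) (corner_N2 c).
have d0 : (fp F1)%:R * (fq F2)%:R - (fq F1)%:R * (fp F2)%:R != 0 :> R.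
  by rewrite gt_eqF // subr_gt0 -!natrM ltr_nat; exact: (corner_det c).
case: a b {Da Db e e1 e2 tight} a1 a2 b1 b2 => [x y] [x' y'] /= a1 a2 b1 b2.
congr pair; apply: (mulfI d0); [transitivity ((fq F2)%:R * (fN F1)%:R - (fq F1)%:R * (fN F2)%:R :
  R)|transitivity ((fp F1)%:R * (fN F2)%:R - (fp F2)%:R * (fN F1)%:R : R)].
- by rewrite -a1 -a2; ring.
- by rewrite -b1 -b2; ring.
- by rewrite -a1 -a2; ring.
- by rewrite -b1 -b2; ring.
Qed.

(** A strictly sorted list is determined by the set of its elements, here the vertices. *)
Lemma newton_verticesE v vs : hull_from gen_supp (Face 1 0 v.1) v vs ->
  newton_vertices R fs = v :: vs.
Proof.
move=> h; pose lt2 := (fun u v : nat * nat => (u.1 < v.1) && (v.2 < u.2))%N.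
have lt_tr : transitive lt2 by move=> b a c /andP[h1 h2] /andP[h3 h4]; apply/andP; split; lia.
have lt_irr : irreflexive lt2 by move=> a; rewrite /lt2 ltnn.
have vE : is_vertex D = [set z | exists2 u, u \in v :: vs & z = pt_of u].
  apply/seteqP; split=> z.
    move=> vz; apply: (hull_vertex_in h vz).
    have s1 : supports gen_supp (Face 1 0 v.1) by case: (vs) h => [|? ?] /=;
      [exact: corner_s1|case=> _ _ /corner_s1].
    by have := D_supports s1 vz.1; rewrite /= mul1r mul0r addr0.
  move=> [u /(nthP (0, 0)%N) [i hi <-] ->].
  exact: corner_vertex (hull_fromP h (ltnSE hi)).
apply: xget_unique; first by split; [exact: (hull_from_sorted h)|exact: vE].
move=> vs' [s' e']; apply: (irr_sorted_eq lt_tr lt_irr) => //; first exact: (hull_from_sorted h).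
have inj (a b : nat * nat) : pt_of a = pt_of b -> a = b.
  by case: a b => [a1 a2] [b1 b2] [] /eqP + /eqP; rewrite !eqr_nat => /eqP -> /eqP ->.
move: e'; rewrite vE => e u; apply/idP/idP => hu.
  have : [set z | exists2 u, u \in v :: vs & z = pt_of u] (pt_of u) by rewrite e; exists u.
  by move=> [w hw /inj ->].
have : [set z | exists2 v0 : nat * nat, v0 \in vs' & z = (v0.1%:R, v0.2%:R)] (pt_of u) by rewrite
  -e; exists u.
by move=> [w hw /inj ->].
Qed.

End ConvexHull.

(** * Face polynomials *)

Section CornerLines.
Variable A : set (nat * nat).

(** Moving left from v along the line of [F2] leaves the half-plane of [F1], by the sign of the
    determinant. The next lemma is the mirror image. *)
Lemma corner_line2 F1 F2 v u : corner A F1 F2 v -> A u ->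
  (fp F2 * u.1 + fq F2 * u.2 = fN F2)%N -> (v.1 <= u.1)%N.
Proof.
move=> c Au eu; rewrite leqNgt; apply/negP => uv.
have e := corner_N2 c; have d := corner_det c.
have vu2 : (v.2 <= u.2)%N.
  rewrite leqNgt; apply/negP => h.
  have h1 : (fp F2 * u.1 <= fp F2 * v.1)%N by rewrite leq_mul2l (ltnW uv) orbT.
  have h2 : (fq F2 * u.2 < fq F2 * v.2)%N by rewrite ltn_pmul2l //; lia.
  by lia.
have := corner_s1 c Au; rewrite (corner_N1 c) => s.
pose a := (v.1 - u.1)%N; pose b := (u.2 - v.2)%N.
have e1 : v.1 = (u.1 + a)%N by rewrite /a; lia.
have e2 : u.2 = (v.2 + b)%N by rewrite /b; lia.
have a0 : (0 < a)%N by rewrite /a; lia.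
move: s eu; rewrite e e1 e2 !mulnDr => s eu.
have h1 : (fp F2 * a = fq F2 * b)%N by lia.
have h2 : (fp F1 * a <= fq F1 * b)%N by lia.
have h3 : (fq F2 * (fp F1 * a) <= fq F2 * (fq F1 * b))%N by rewrite leq_mul2l h2 orbT.
have h4 : (fq F2 * (fq F1 * b) = fq F1 * fp F2 * a)%N by rewrite mulnCA -h1; lia.
have h5 : (fq F1 * fp F2 * a < fp F1 * fq F2 * a)%N by rewrite ltn_pmul2r.
by lia.
Qed.

Lemma corner_line1 F1 F2 v u : corner A F1 F2 v -> A u ->
  (fp F1 * u.1 + fq F1 * u.2 = fN F1)%N -> (v.2 <= u.2)%N.
Proof.
move=> c Au eu; rewrite leqNgt; apply/negP => uv.
have e := corner_N1 c; have d := corner_det c.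
have vu2 : (v.1 <= u.1)%N.
  rewrite leqNgt; apply/negP => h.
  have h1 : (fq F1 * u.2 <= fq F1 * v.2)%N by rewrite leq_mul2l (ltnW uv) orbT.
  have h2 : (fp F1 * u.1 < fp F1 * v.1)%N by rewrite ltn_pmul2l //; lia.
  by lia.
have := corner_s2 c Au; rewrite (corner_N2 c) => s.
pose a := (v.2 - u.2)%N; pose b := (u.1 - v.1)%N.
have e1 : v.2 = (u.2 + a)%N by rewrite /a; lia.
have e2 : u.1 = (v.1 + b)%N by rewrite /b; lia.
have a0 : (0 < a)%N by rewrite /a; lia.
move: s eu; rewrite e e1 e2 !mulnDr => s eu.
have h1 : (fq F1 * a = fp F1 * b)%N by lia.
have h2 : (fq F2 * a <= fp F2 * b)%N by lia.
have h3 : (fp F1 * (fq F2 * a) <= fp F1 * (fp F2 * b))%N by rewrite leq_mul2l h2 orbT.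
have h4 : (fp F1 * (fp F2 * b) = fq F1 * fp F2 * a)%N by rewrite mulnCA -h1; lia.
have h5 : (fq F1 * fp F2 * a < fp F1 * fq F2 * a)%N by rewrite ltn_pmul2r.
by lia.
Qed.

(** The last field confines the points of A on the line of S to the segment from v to w. *)
Record edge v w S : Prop := Edge {
  edge_v : A v; edge_w : A w; edge_lt1 : (v.1 < w.1)%N; edge_lt2 : (w.2 < v.2)%N;
  edge_S : S = compact_face v w; edge_sup : supports A S;
  edge_l : forall u, A u -> (fp S * u.1 + fq S * u.2 = fN S)%N -> (v.1 <= u.1)%N /\ (w.2 <= u.2)%N
}.

Lemma hull_edge F v vs : hull_from A F v vs -> forall S, List.In S (compact_faces (v :: vs)) ->
  exists v w, edge v w S.
Proof.
elim: vs F v => [|w vs IH] F v; first by move=> _ S [].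
move=> [h1 h2 h3 h4] S; rewrite compact_faces_cons => -[<-|hS]; last exact: (IH _ _ h4).
have [F2 c2] : exists F2, corner A (compact_face v w) F2 w.
  by case: vs h4 {IH} => [|x vs] /= ; [exists (Face 0 1 w.2)|case=> _ _ c _;
    exists (compact_face w x)].
exists v, w; split=> //.
- exact: (corner_in h3).
- exact: (corner_in c2).
- exact: (corner_s2 h3).
- by move=> u Au eu; split; [exact: (corner_line2 h3)|exact: (corner_line1 c2)].
Qed.

End CornerLines.

Section BivariatePolynomials.
Variable k : fieldType.
Implicit Types (F G H K P : {poly {poly k}}) (g h : {poly k}).

Definition ev2 (s t : k) P : k := (map_poly (horner_eval s) P).[t].

Lemma ev2D s t P Q : ev2 s t (P + Q) = ev2 s t P + ev2 s t Q.
Proof. by rewrite /ev2 rmorphD hornerD. Qed.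
Lemma ev2M s t P Q : ev2 s t (P * Q) = ev2 s t P * ev2 s t Q.
Proof. by rewrite /ev2 rmorphM hornerM. Qed.
Lemma ev20 s t : ev2 s t 0 = 0. Proof. by rewrite /ev2 rmorph0 horner0. Qed.
Lemma ev21 s t : ev2 s t 1 = 1. Proof. by rewrite /ev2 rmorph1 hornerC. Qed.

Lemma ev2_mono s t c a b : ev2 s t (mono2 c a b) = c * (s ^+ a * t ^+ b).
Proof.
rewrite /mono2 ev2M /ev2 map_polyC rmorphXn /= map_polyX hornerC hornerXn.
by rewrite /horner_eval hornerZ hornerXn mulrA.
Qed.

Lemma ev2E s t P : ev2 s t P = \sum_(b < size P) (P`_b).[s] * t ^+ b.
Proof.
rewrite /ev2 (horner_coef_wide _ (size_poly _ _)); apply: eq_bigr => b _.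
by rewrite coef_map.
Qed.

Lemma ev2_subst s t q p P : ev2 s t (subst_pow q p P) = ev2 (s ^+ q) (t ^+ p) P.
Proof.
rewrite /ev2 /subst_pow map_comp_poly horner_comp rmorphXn /= map_polyX hornerXn -map_poly_comp.
congr (_ .[_]); apply: eq_map_poly => g /=.
by rewrite /horner_eval horner_comp hornerXn.
Qed.

Lemma coef_mono2 c a b y x : (mono2 c a b)`_y`_x = if (y == b) && (x == a) then c else 0 :> k.
Proof.
rewrite /mono2 coefCM coefXn; case: eqP => _ /=; last by rewrite mulr0 poly.coef0.
by rewrite mulr1 coefZ coefXn; case: eqP; rewrite ?mulr1 ?mulr0.
Qed.

Lemma mono2M c c' a a' b b' : mono2 c a b * mono2 c' a' b' = mono2 (c * c') (a + a') (b + b') :>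
  {poly {poly k}}.
Proof.
rewrite /mono2 mulrACA -exprD -rmorphM /=; congr (_%:P * _).
by rewrite -scalerAl -scalerAr scalerA -exprD.
Qed.

Lemma subst_pow_mono q p c a b : subst_pow q p (mono2 c a b) = mono2 c (q * a) (p * b) :> {poly
  {poly k}}.
Proof.
rewrite /subst_pow /mono2 rmorphM rmorphXn /= map_polyC map_polyX /= comp_polyM comp_polyC
  comp_Xn_poly.
by rewrite comp_polyZ comp_Xn_poly -!exprM.
Qed.

Lemma subst_powM q p F G : subst_pow q p (F * G) = subst_pow q p F * subst_pow q p G.
Proof. by rewrite /subst_pow rmorphM comp_polyM. Qed.

Lemma subst_powC q p (c : k) : subst_pow q p c%:P%:P = c%:P%:P.
Proof. by rewrite /subst_pow map_polyC /= comp_polyC comp_polyC. Qed.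

Lemma subst_pow1 q p : subst_pow q p 1 = 1 :> {poly {poly k}}.
Proof. exact: (subst_powC q p 1). Qed.

Lemma subst_pow_sum q p (J : Type) (r : seq J) (Q : J -> {poly {poly k}}) :
  subst_pow q p (\sum_(j <- r) Q j) = \sum_(j <- r) subst_pow q p (Q j).
Proof. by rewrite /subst_pow rmorph_sum raddf_sum. Qed.

Lemma homogeneous_coef d K b : homogeneous d K ->
  K`_b = if (b <= d)%N then (K`_b).[1] *: 'X^(d - b) else 0.
Proof.
move=> hK; have key : K`_b = if (b <= d)%N then (K`_b)`_(d - b) *: 'X^(d - b) else 0.
  apply/polyP => x; have [e0|nz] := eqVneq (K`_b)`_x 0.
    case: leqP => bd; last by rewrite poly.coef0.
    by rewrite coefZ coefXn; case: eqP => [<-|_]; rewrite ?mulr0 // e0 mul0r.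
  have e := hK x b nz; rewrite ifT; last by rewrite -e leq_addl.
  by rewrite -e addnK coefZ coefXn eqxx mulr1.
rewrite {1}key; case: leqP => bd //; congr (_ *: _).
by rewrite [in RHS]key bd hornerZ hornerXn expr1n mulr1.
Qed.

Definition homogenize d g : {poly {poly k}} := \sum_(j < d.+1) mono2 g`_j (d - j) j.

Lemma coef_homogenize d g b : (homogenize d g)`_b = if (b <= d)%N then g`_b *: 'X^(d - b) else 0.
Proof.
rewrite poly.coef_sum; have E j : (mono2 g`_j (d - j) j)`_b = if b == j then g`_j *: 'X^(d - j)
  else 0.
  by rewrite /mono2 coefCM coefXn; case: eqP; rewrite ?mulr1 ?mulr0.
under eq_bigr => j _ do rewrite E.
case: leqP => bd.
  rewrite (bigD1 (Ordinal (bd : (b < d.+1)%N))) //= eqxx big1 ?addr0 // => j jb.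
  by rewrite ifN //; apply: contraNneq jb => e; apply/eqP/val_inj.
by rewrite big1 // => j _; rewrite ifN //; have := ltn_ord j; apply: contraTneq => <-; lia.
Qed.

Lemma homogenize0 g : homogenize 0 g = (g`_0)%:P%:P.
Proof. by rewrite /homogenize big_ord1 /mono2 !expr0 mulr1 alg_polyC. Qed.

Lemma homogenize_homogeneous d g : homogeneous d (homogenize d g).
Proof.
move=> a b; rewrite coef_homogenize; case: leqP => bd; last by rewrite poly.coef0 eqxx.
have [ea _|ne] := eqVneq a (d - b)%N; first by rewrite ea subnK.
by rewrite coefZ coefXn (negbTE ne) mulr0 eqxx.
Qed.

Lemma homogenizeM d e g h : (size g <= d.+1)%N -> (size h <= e.+1)%N -> homogenize (d + e) (g *
  h) = homogenize d g * homogenize e h.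
Proof.
move=> sg sh; apply/polyP => b; rewrite coef_homogenize [RHS]coefM.
have T (i : 'I_b.+1) : (homogenize d g)`_i * (homogenize e h)`_(b - i) = (g`_i * h`_(b - i)) *:
  'X^(d + e - b).
  rewrite !coef_homogenize; have [id|id] := leqP i d; last first.
    by rewrite mul0r [g`_i]nth_default ?mul0r ?scale0r //; apply: leq_trans sg _.
  have [ie|ie] := leqP (b - i) e; last first.
    by rewrite mulr0 [h`__]nth_default ?mulr0 ?scale0r //; apply: leq_trans sh _.
  rewrite -scalerAl -scalerAr scalerA -exprD; congr (_ *: 'X^_).
  by have := ltn_ord i; lia.
rewrite (eq_bigr _ (fun i _ => T i)) -scaler_suml -coefM; case: leqP => // bd.
rewrite nth_default ?scale0r //; apply: leq_trans (size_polyMleq _ _) _; lia.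
Qed.

Lemma homogenize_dehom d g : (size g <= d.+1)%N -> map_poly (horner_eval 1) (homogenize d g) = g.
Proof.
move=> sg; apply/polyP => b; rewrite coef_map coef_homogenize /=; case: leqP => bd.
  by rewrite /horner_eval hornerZ hornerXn expr1n mulr1.
by rewrite rmorph0 nth_default //; apply: leq_trans sg _.
Qed.

Lemma homogenize_neq0 d g : (size g <= d.+1)%N -> g != 0 -> homogenize d g != 0.
Proof. by move=> sg; apply: contraNneq => e; rewrite -(homogenize_dehom sg) e rmorph0. Qed.

Lemma size_homogenize d g : size g = d.+1 -> size (homogenize d g) = d.+1 /\ lead_coef
  (homogenize d g) = (lead_coef g)%:P.
Proof.
move=> sg; have e : (homogenize d g)`_d = (lead_coef g)%:P.
  by rewrite coef_homogenize leqnn subnn expr0 lead_coefE sg /= -[RHS]mulr1 mul_polyC.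
have l0 : lead_coef g != 0 by rewrite lead_coef_eq0 -size_poly_eq0 sg.
have s : size (homogenize d g) = d.+1.
  apply/eqP; rewrite eqn_leq; apply/andP; split; last first.
    by rewrite ltnNge; apply: contra_neqN (l0) => h; apply/eqP; rewrite -polyC_eq0 -e nth_default.
  by apply/leq_sizeP => j jd; rewrite coef_homogenize ifN // -ltnNge.
by split=> //; rewrite lead_coefE s.
Qed.

Lemma coef_initial S (f : fps2 k) y x : (0 < fp S)%N -> (0 < fq S)%N ->
  (initial S f)`_y`_x = if (fp S * x + fq S * y == fN S)%N then coef (coef f x) y else 0.
Proof.
move=> p0 q0; rewrite /initial poly.coef_sum poly.coef_sum.
under eq_bigr => a _ do rewrite poly.coef_sum poly.coef_sum.
have [e|ne] := eqVneq (fp S * x + fq S * y)%N (fN S); last first.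
  rewrite big1 // => a _; rewrite big1 // => b /eqP e; rewrite coef_mono2.
  by case: andP => // -[/eqP h1 /eqP h2]; rewrite -e h1 h2 eqxx in ne.
have xN : (x < (fN S).+1)%N by rewrite ltnS -e; apply: leq_trans (leq_addr _ _); exact: leq_pmull.
have yN : (y < (fN S).+1)%N by rewrite ltnS -e; apply: leq_trans (leq_addl _ _); exact: leq_pmull.
rewrite (bigD1 (Ordinal xN)) //= [X in _ + X]big1 ?addr0 => [|a ax]; last first.
  rewrite big1 // => b _; rewrite coef_mono2; case: andP => // -[_ /eqP h]; case/eqP: ax;
    exact/val_inj.
rewrite (bigD1 (Ordinal yN)) /= ?e //= [X in _ + X]big1 ?addr0 => [|b /andP[_ bx]]; last first.
  rewrite coef_mono2; case: andP => // -[/eqP h _]; case/eqP: bx; exact/val_inj.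
by rewrite coef_mono2 !eqxx.
Qed.

Lemma ev2_homogeneous d K s t : homogeneous d K -> s != 0 -> ev2 s t K = s ^+ d * ev2 1 (t / s) K.
Proof.
move=> hK s0; rewrite !ev2E mulr_sumr; apply: eq_bigr => b _.
rewrite {1}(homogeneous_coef b hK); case: leqP => bd; last first.
  by rewrite [in RHS](homogeneous_coef b hK) leqNgt bd !horner0 !mul0r mulr0.
rewrite hornerZ hornerXn exprMn exprVn mulrCA -mulrA; congr (_ * _).
rewrite mulrA mulrAC -[in RHS](subnK bd) exprD; field.
by rewrite expf_neq0.
Qed.

(** As a polynomial in y over k[x], K takes the value K(1, c) x^d at y = c x. *)
Lemma homogeneous_root d K c : homogeneous d K -> ev2 1 c K = 0 -> divides ('X - (c *: 'X)%:P) K.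
Proof.
move=> hK e0; have : root K (c *: 'X).
  apply/eqP; rewrite horner_coef.
  transitivity (ev2 1 c K *: 'X^d : {poly k}); last by rewrite e0 scale0r.
  rewrite ev2E scaler_suml; apply: eq_bigr => b _.
  rewrite {1}(homogeneous_coef b hK); case: leqP => bd; last first.
    by rewrite (homogeneous_coef b hK) leqNgt bd horner0 !mul0r scale0r.
  rewrite exprZn -scalerAl -scalerAr scalerA -exprD subnK //.
by move/factor_theorem => [H ->]; exists H; rewrite mulrC.
Qed.

(** * Existence and roots of the face polynomial *)

Section FacePolynomial.
Variables (fs : seq (fps2 k)) (S : face) (v w : nat * nat).
Let A : set (nat * nat) := [set u | exists2 f, f \in fs & supp f u].
Hypothesis eS : edge A v w S.
Local Notation p := (fp S).
Local Notation q := (fq S).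

Lemma edge_params : exists g : nat, [/\ (0 < g)%N, v.2 = (w.2 + p * g)%N, w.1 = (v.1 + q * g)%N,
  (0 < p)%N /\ (0 < q)%N & coprime p q].
Proof.
have [g] := compact_faceP (edge_lt1 eS) (edge_lt2 eS); rewrite -(edge_S eS) => -[g0 e1 e2 pq co].
by exists g; split=> //; have := edge_lt1 eS; have := edge_lt2 eS; lia.
Qed.

Lemma edge_N : fN S = (p * v.1 + q * v.2)%N.
Proof. by rewrite (edge_S eS). Qed.

(** The restriction of [f] to the face, dehomogenized: [j] counts steps from [w] to [v]. *)
Definition edge_poly (g : nat) (f : fps2 k) : {poly k} :=
  \poly_(j < g.+1) coef (coef f (v.1 + q * (g - j))) (w.2 + p * j).

(** As p and q are coprime, the lattice points of the face are reached from w in steps (-q, p).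
    Hence the initial form is x^v.1 y^w.2 times a form of degree g in x^q and y^p. *)
Lemma initialE (g : nat) f : (0 < p)%N -> (0 < q)%N -> coprime p q -> v.2 = (w.2 + p * g)%N -> f
  \in fs ->
  initial S f = mono2 1 v.1 w.2 * subst_pow q p (homogenize g (edge_poly g f)).
Proof.
move=> p0 q0 co ev fF; rewrite subst_pow_sum mulr_sumr.
under eq_bigr => j _ do rewrite subst_pow_mono mono2M mul1r.
apply/polyP => y; apply/polyP => x; rewrite coef_initial // !poly.coef_sum.
under eq_bigr => j _ do rewrite coef_mono2.
have eN := edge_N.
have [z|nz] := eqVneq (coef (coef f x) y) 0.
  rewrite z if_same big1 // => j _; case: andP => // -[/eqP h1 /eqP h2].
  by rewrite coef_poly ltn_ord -h1 -h2 z.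
case: eqP => [el|nel]; last first.
  rewrite big1 // => j _; case: andP => // -[/eqP h1 /eqP h2]; case: nel.
  rewrite eN h1 h2 ev !mulnDr.
  have : (p * (q * (g - j)) + q * (p * j) = q * (p * g))%N.
    by rewrite mulnCA -mulnDr -mulnDr subnK // -ltnS.
  by lia.
have Axy : A (x, y) by exists f.
have [/= vx wy] := edge_l eS Axy el.
have xs : (p * (x - v.1) + q * (y - w.2) = q * (p * g))%N.
  by move: el; rewrite eN ev !mulnBr mulnDr; have := leq_mul (leqnn p) vx;
    have := leq_mul (leqnn q) wy; lia.
have /dvdnP [s es] : (q %| x - v.1)%N.
  rewrite -(Gauss_dvdr _ (_ : coprime q p)); last by rewrite coprime_sym.
  by rewrite -(dvdn_addl _ (dvdn_mulr (y - w.2) (dvdnn q))) xs dvdn_mulr.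
have sg : (p * s + (y - w.2) = p * g)%N.
  apply/eqP; rewrite -(eqn_pmul2l q0) mulnDr -xs es; apply/eqP; lia.
have sle : (s <= g)%N by rewrite -(leq_pmul2l p0); lia.
have jg : (g - s < g.+1)%N by lia.
have pg : (p * (g - s) = y - w.2)%N by rewrite mulnBr; lia.
rewrite (bigD1 (Ordinal jg)) //= big1 ?addr0.
  rewrite pg subKn // subnKC // mulnC -es subnKC // !eqxx /= coef_poly jg subKn // pg !subnKC //.
  by rewrite mulnC -es subnKC.
move=> j /eqP jn; case: andP => // -[/eqP h1 /eqP h2]; case: jn; apply/val_inj => /=.
have e1 : (p * j = p * (g - s))%N by rewrite pg h1; lia.
by apply/eqP; rewrite -(eqn_pmul2l p0) e1.
Qed.

Lemma gcd_seq (T : eqType) (r : seq T) (P : T -> {poly k}) : exists2 G : {poly k},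
  forall f, f \in r -> (G %| P f)%R & forall D, (forall f, f \in r -> (D %| P f)%R) -> (D %| G)%R.
Proof.
elim: r => [|f r [G h1 h2]]; first by exists 0 => // D _; exact: dvdp0.
exists (gcdp (P f) G) => [f'|D hD].
  rewrite inE => /orP[/eqP ->|/h1 h]; first exact: dvdp_gcdl.
  exact: dvdp_trans (dvdp_gcdr _ _) h.
rewrite dvdp_gcd hD ?inE ?eqxx //=; apply: h2 => f' f'r; apply: hD; by rewrite inE f'r orbT.
Qed.

Lemma ideal_gen_eq (R0 : comPzRingType) (X Y : set R0) : (X `<=` ideal_gen Y) -> (Y `<=`
  ideal_gen X) ->
  ideal_gen X = ideal_gen Y.
Proof.
have idl (Z : set R0) : is_ideal (ideal_gen Z).
  split; first by move=> M [[]].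
  - by move=> a b ha hb M [iM ZM]; case: (iM) => _ h _; apply: h; [exact: ha|exact: hb].
  - by move=> a b hb M [iM ZM]; case: (iM) => _ _ h; apply: h; exact: hb.
by move=> XY YX; apply/seteqP; split; apply: smallest_sub.
Qed.

Lemma ideal_gen0 (R0 : comPzRingType) (X : set R0) : ideal_gen X 0.
Proof. by move=> M [[]]. Qed.

Lemma ideal_gen_mul (R0 : comPzRingType) (X : set R0) a b : ideal_gen X b -> ideal_gen X (a * b).
Proof. by move=> hb M [iM ZM]; case: (iM) => _ _ h; apply: h; exact: hb. Qed.

(** In one variable: F is the homogenization of the monic gcd G of all the edge polynomials, and the
    k_i are those of the nonzero quotients by G, in degree d = g - deg G. If d = 0 the quotient
    belonging to the vertex v is a nonzero constant, so that k_1 = 1 suffices. *)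
Lemma face_poly_exists : exists F, is_face_poly fs S F.
Proof.
have [g [g0 ev1 ew1 [p0 q0] co]] := edge_params.
pose P f := edge_poly g f.
have sP f : (size (P f) <= g.+1)%N by exact: size_poly.
have iE f : f \in fs -> initial S f = mono2 1 v.1 w.2 * subst_pow q p (homogenize g (P f)) by
  exact: initialE.
(* [f0] involves the vertex v, so its edge polynomial has degree exactly g; [f1] involves w, so its
   edge polynomial has a nonzero constant term, and y does not divide F. *)
have [f0 f0F /eqP c0] := edge_v eS; have [f1 f1F /eqP c1] := edge_w eS.
have s0 : size (P f0) = g.+1.
  apply: size_poly_eq; rewrite subnn muln0 addn0 -ev1; exact/eqP.
have t1 : (P f1)`_0 != 0.
  by rewrite coef_poly /= subn0 muln0 addn0 -ew1; exact/eqP.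
have [G1 G1d G1m] := gcd_seq fs P.
have P0 : P f0 != 0 by rewrite -size_poly_eq0 s0.
have G1n : G1 != 0 by apply: contraNneq P0 => e; have := G1d _ f0F; rewrite e dvd0p.
pose G := (lead_coef G1)^-1 *: G1.
have lG1 : (lead_coef G1)^-1 != 0 by rewrite invr_eq0 lead_coef_eq0.
have Gd f : f \in fs -> (G %| P f)%R by move=> /G1d; rewrite dvdpZl.
have Gm D : (forall f, f \in fs -> (D %| P f)%R) -> (D %| G)%R by move=> /G1m; rewrite dvdpZr.
have Gn : G != 0 by rewrite scaler_eq0 negb_or lG1.
have lG : lead_coef G = 1 by rewrite lead_coefZ mulVf // lead_coef_eq0.
pose h f := P f %/ G.
have hE f : f \in fs -> P f = G * h f by move=> /Gd /divpK e; rewrite mulrC e.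
have [e se] : exists e, size G = e.+1.
  by exists (size G).-1; rewrite prednK // lt0n size_poly_eq0.
have eg : (e <= g)%N by rewrite -ltnS -se -s0; apply: dvdp_leq => //; exact: Gd.
pose d := (g - e)%N.
have sh f : f \in fs -> (size (h f) <= d.+1)%N.
  by move=> fF; rewrite size_divp // se /= /d -subSn // leq_sub2r // sP.
have sh0 : size (h f0) = d.+1 by rewrite size_divp // se s0 /= /d subSn.
have iF f : f \in fs -> initial S f = mono2 1 v.1 w.2 * subst_pow q p (homogenize e G) *
  subst_pow q p (homogenize d (h f)).
  move=> fF; rewrite (iE _ fF) (hE _ fF) -mulrA -subst_powM -(@homogenizeM e d) ?se //;
    last exact: sh.
  by rewrite /d subnKC.
have [sF lF] := size_homogenize se; rewrite lG in lF.
have G0 : G`_0 != 0.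
  by apply: contraNneq t1 => z; rewrite hE // coefM big_ord1 z mul0r.
exists (homogenize e G), v.1, w.2.
have common : [/\ (exists e0, homogeneous e0 (homogenize e G)), homogenize e G \is monic,
    ~ divides 'X%:P (homogenize e G) & ~ divides 'X (homogenize e G)].
  split.
  - by exists e; exact: homogenize_homogeneous.
  - by apply/monicP; rewrite lF.
  - move=> [H eH]; have := congr1 (fun Q : {poly {poly k}} => (Q`_e).[0]) eH.
    rewrite coefCM hornerM hornerX mul0r coef_homogenize leqnn subnn hornerZ hornerXn expr0 mulr1
      => z.
    by have := lG; rewrite lead_coefE se /= z => /eqP; rewrite eq_sym oner_eq0.
  - move=> [H eH]; have := congr1 (fun Q : {poly {poly k}} => Q`_0) eH.
    rewrite mulrC coefMX /= coef_homogenize leq0n subn0 => /eqP.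
    by rewrite scaler_eq0 (negbTE G0) /= -size_poly_eq0 size_polyXn.
have [C1 C2 C3 C4] := common.
have [d0|dn] := eqVneq d 0%N.
  exists [:: 1]; split=> //; last by left.
  apply: ideal_gen_eq.
    move=> _ [f fF <-].
    have -> : initial S f = subst_pow q p (homogenize d (h f)) *
        (mono2 1 v.1 w.2 * subst_pow q p (homogenize e G)) by rewrite iF // mulrC.
    apply: ideal_gen_mul.
    apply: sub_gen_smallest; exists 1; first by rewrite /= inE.
    by rewrite subst_pow1 mulr1.
  move=> _ [K /= K1 <-]; move: K1; rewrite inE => /eqP ->.
  have eh : homogenize d (h f0) = ((h f0)`_0)%:P%:P.
    by rewrite d0 homogenize0.
  have c0' : (h f0)`_0 != 0 by have := lead_coefE (h f0); rewrite sh0 d0 /= => <-;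
    rewrite lead_coef_eq0 -size_poly_eq0 sh0.
  have -> : mono2 1 v.1 w.2 * subst_pow q p (homogenize e G) * subst_pow q p 1 = ((h
    f0)`_0)^-1%:P%:P * initial S f0.
    by rewrite (iF _ f0F) eh subst_pow1 subst_powC mulr1 mulrCA -!rmorphM /= mulVf // mulr1.
  by apply: ideal_gen_mul; apply: sub_gen_smallest; exists f0.
have hF0 : homogenize d (h f0) != 0.
  by apply: homogenize_neq0; rewrite ?sh0 // -size_poly_eq0 sh0.
exists [seq homogenize d (h f) | f <- fs & h f != 0]; split=> //.
  apply: ideal_gen_eq.
    move=> _ [f fF <-]; have [z|nz] := eqVneq (h f) 0.
      rewrite iF // z (_ : homogenize d 0 = 0) ?/subst_pow ?rmorph0 ?comp_poly0 ?mulr0;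
        first exact: ideal_gen0.
      by apply/polyP => b; rewrite coef_homogenize !poly.coef0 scale0r if_same.
    apply: sub_gen_smallest; exists (homogenize d (h f)); last by rewrite iF.
    by apply: map_f; rewrite mem_filter nz.
  move=> _ [K /= /mapP [f ff eK] <-]; move: ff; rewrite mem_filter => /andP[_ fF];
    rewrite eK -iF //.
  by apply: sub_gen_smallest; exists f.
right; have hf0 : h f0 != 0 by rewrite -size_poly_eq0 sh0.
have f0f : f0 \in [seq f <- fs | h f != 0] by rewrite mem_filter hf0.
split.
(* With a single nonzero quotient, the edge polynomial of [f0] would divide G, and d would be 0. *)
- rewrite size_map; case E : [seq f <- fs | h f != 0] => [|f2 [|f3 r]] //;
  first by rewrite E in f0f.
  have e2 : f0 = f2 by move: f0f; rewrite E inE => /eqP.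
  case/eqP: dn; have : (P f0 %| G)%R.
    apply: Gm => f fF; have [z|nz] := eqVneq (h f) 0; first by rewrite [P f]hE // z mulr0 dvdp0.
    have : f \in [seq f <- fs | h f != 0] by rewrite mem_filter nz.
    by rewrite E inE e2 => /eqP ->.
  by move=> /(dvdp_leq Gn); rewrite s0 se ltnS => ge; apply/eqP; rewrite /d subn_eq0.
- apply/negP => /mapP [f]; rewrite mem_filter => /andP[nz fF] /esym/eqP; apply/negP.
  by apply: homogenize_neq0 => //; exact: sh.
(* A common factor H of the k_i becomes at x = 1 a common factor of the quotients, so G H(1, y)
   divides G. The leading coefficient of H divides a nonzero constant, hence setting x = 1 preserves
   the degree in y and H is a unit. *)
- move=> H hH.
  have hH' f : f \in fs -> (map_poly (horner_eval 1) H %| h f)%R.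
    move=> fF; have [->|nz] := eqVneq (h f) 0; first exact: dvdp0.
    have [|H' eH] := hH (homogenize d (h f)); first by apply: map_f; rewrite mem_filter nz.
    by rewrite -(homogenize_dehom (sh _ fF)) eH rmorphM dvdp_mulr.
  have [|H' eH] := hH (homogenize d (h f0)); first exact: map_f.
  have [_ lh] := size_homogenize sh0.
  have lHH : lead_coef H * lead_coef H' = (lead_coef (h f0))%:P by rewrite -lead_coefM -eH lh.
  have lh0 : lead_coef (h f0) != 0 by rewrite lead_coef_eq0.
  have uH : lead_coef H \is a GRing.unit.
    apply/unitrP; exists (lead_coef H' * ((lead_coef (h f0))^-1)%:P).
    have e1 : lead_coef H * (lead_coef H' * ((lead_coef (h f0))^-1)%:P) = 1.
      by rewrite mulrA lHH -rmorphM mulfV.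
    by split=> //; rewrite mulrC.
  have [sl lc] : size (lead_coef H) = 1%N /\ (lead_coef H)`_0 != 0.
    by move: uH; rewrite poly_unitE => /andP[/eqP -> ]; rewrite unitfE.
  have ev1n : horner_eval 1 (lead_coef H) != 0.
    by rewrite /horner_eval horner_coef sl big_ord1 expr0 mulr1.
  have sH : size (map_poly (horner_eval 1) H) = size H by exact: size_map_poly_id0.
  have H0 : H != 0 by apply: contraNneq ev1n => ->; rewrite lead_coef0 /horner_eval horner0.
  have : (G * map_poly (horner_eval 1) H %| G)%R.
    by apply: Gm => f fF; rewrite [P f]hE // dvdp_mul2l //; exact: hH'.
  rewrite -{2}[G]mulr1 dvdp_mul2l // dvdp1 sH => /eqP s1.
  by rewrite poly_unitE s1 eqxx /=; move: uH; rewrite lead_coefE s1.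
- exists d; first by rewrite lt0n.
  by move=> K /mapP [f _ ->]; exact: homogenize_homogeneous.
Qed.

Lemma ideal_vanish (X : set {poly {poly k}}) s t :
  (forall P, X P -> ev2 s t P = 0) -> forall P, ideal_gen X P -> ev2 s t P = 0.
Proof.
move=> hX P; apply: (_ : ideal_gen X `<=` [set P | ev2 s t P = 0]).
apply: smallest_sub => //; split => /=.
- exact: ev20.
- by move=> a b ha hb; rewrite ev2D ha hb addr0.
- by move=> a b hb; rewrite ev2M hb mulr0.
Qed.

(** The choice in [face_poly] thus does not fall back on 0, and the properties used below hold for
    whichever polynomial is selected. *)
Lemma face_polyP : is_face_poly fs S (face_poly fs S).
Proof. exact: xgetPex face_poly_exists. Qed.

(** The zeros of an ideal do not depend on its generators, and for a, b nonzero the monomial factor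
    does not vanish. Nor do all the k_i: by [homogeneous_root] they would share the factor y - mu x
    with mu = b^p / a^q, against coprimality. *)
Lemma face_rootsP a b : a != 0 -> b != 0 ->
  (forall f, f \in fs -> ev2 a b (initial S f) = 0) <-> face_roots fs S (b ^+ p / a ^+ q).
Proof.
move=> a0 b0; have [x [y [ks [eI [[e0 he] mF] _ hks]]]] := face_polyP.
set F := face_poly fs S in eI he mF.
have s0 : a ^+ q != 0 by rewrite expf_neq0.
have t0 : b ^+ p != 0 by rewrite expf_neq0.
have EF : ev2 a b (subst_pow q p F) = 0 <-> face_roots fs S (b ^+ p / a ^+ q).
  rewrite ev2_subst (ev2_homogeneous _ he s0) /face_roots /ev2 -/F /=; split.
    move/eqP; rewrite mulf_eq0 expf_eq0 (negbTE s0) andbF /= => /eqP z.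
    by split=> //; rewrite mulf_neq0 // invr_eq0.
  by move=> [_ ->]; rewrite mulr0.
rewrite -EF; split=> h; last first.
  move=> f fF; apply: (@ideal_vanish [set mono2 1 x y * subst_pow q p F * subst_pow q p K | K in
    [set` ks]]).
    by move=> _ [K _ <-]; rewrite !ev2M h mulr0 mul0r.
  by rewrite -eI; apply: sub_gen_smallest; exists f.
have [K Kks nK] : exists2 K, K \in ks & ev2 (a ^+ q) (b ^+ p) K != 0.
  case: hks => [->|[s2 nz co [d d0 hd]]]; first by exists 1; rewrite ?inE // ev21 oner_neq0.
  apply: contrapT => none; have : 'X - ((b ^+ p / a ^+ q) *: 'X)%:P \is a @GRing.unit {poly {poly
    k}}.
    apply: co => K Kks; apply: (homogeneous_root (hd _ Kks)).
    apply/eqP/negPn/negP => nz'; apply: none; exists K => //.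
    by rewrite (ev2_homogeneous _ (hd _ Kks) s0) mulf_neq0 // expf_neq0.
  by rewrite poly_unitE size_XsubC.
have : ev2 a b (mono2 1 x y * subst_pow q p F * subst_pow q p K) = 0.
  apply: (@ideal_vanish [set initial S f | f in [set` fs]]); first by move=> _ [f fF <-]; exact: h.
  by rewrite eI; apply: sub_gen_smallest; exists K.
rewrite ev2M [ev2 a b (mono2 _ _ _ * _)]ev2M ev2_mono mul1r [ev2 a b (subst_pow q p K)]ev2_subst
  => /eqP.
by rewrite !mulf_eq0 (negbTE nK) !expf_eq0 (negbTE a0) (negbTE b0) !andbF /= orbF => /eqP.
Qed.

Lemma face_roots_finite : finite_set (face_roots fs S).
Proof.
have [x [y [ks [_ [_ mF] _ _]]]] := face_polyP.
set Q := map_poly (horner_eval 1) (face_poly fs S).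
have Qn : Q != 0.
  have h1 : horner_eval 1 (lead_coef (face_poly fs S)) != 0.
    by rewrite (monicP mF) /horner_eval hornerC oner_neq0.
  by rewrite -size_poly_eq0 size_map_poly_id0 // size_poly_eq0 -lead_coef_eq0 (monicP mF) oner_neq0.
apply: contrapT => inf; have [B BS cB] := infinite_set_fset (size Q) inf.
have rB : all (root Q) B by apply/allP => z /BS [_ z0]; exact/eqP.
by have := max_poly_roots Qn rB (fset_uniq B); rewrite ltnNge cB.
Qed.

End FacePolynomial.

End BivariatePolynomials.

(** * Generating series of cones *)

Section InverseSeries.
Variable A : comPzRingType.

Lemma fps_unit (f : fps A) : coef f 0 = 1 -> exists g, f * g = 1.
Proof.
move=> f0; have h1 : ordge 1 (1 - f) by move=> [|//] _; rewrite coefD coefN coef1 f0 subrr.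
pose G n := \sum_(i < n.+1) (1 - f) ^+ i.
have GE n : f * G n = 1 - (1 - f) ^+ n.+1.
  have /= e := @subrX1 (fps A) (1 - f) n.+1.
  have -> : f * G n = - ((1 - f - 1) * G n) by ring.
  by rewrite -e opprB.
(* The coefficient of degree n of the geometric series is final after n + 1 terms. *)
exists (Fps (fun n => coef (G n) n)); apply: fpsP => n.
have c : cong n (Fps (fun n => coef (G n) n)) (G n).
  move=> m; elim: n => [|n IH]; first by rewrite leqn0 => /eqP ->.
  rewrite leq_eqVlt => /orP[/eqP -> //|]; rewrite ltnS => mn;
    rewrite IH // /G [in RHS]big_ord_recr coefD.
  have [h _] := lead_exp n.+1 h1; rewrite [X in _ = _ + X]h ?addr0 //; lia.
rewrite (congM (@cong_refl A n f) c (leqnn n)) GE coefD coefN.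
by have [h _] := lead_exp n.+1 h1; rewrite h ?subr0 //; lia.
Qed.

Lemma fps_unit_const (c : A) : (exists b, c * b = 1) -> exists g : fps A, fps_term c 0 * g = 1.
Proof. by move=> [b cb]; exists (fps_term b 0); rewrite fps_term_mul cb fps_term_1. Qed.

Lemma coef_mul_1subT (f : fps A) c N n :
  coef (f * (1 - fps_term c N)) n = coef f n - (if (N <= n)%N then c * coef f (n - N)%N else 0).
Proof. by rewrite mulrBr mulr1 coefD coefN [f * _]mulrC coef_termM; case: ltnP. Qed.

Lemma geometric (c : A) N : (0 < N)%N ->
  Fps (fun n => if (N %| n)%N && (0 < n)%N then c ^+ (n %/ N) else 0) * (1 - fps_term c N) =
    fps_term c N.
Proof.
move=> N0; apply: fpsP => n; rewrite coef_mul_1subT coef_term /=.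
case: (leqP N n) => nN; last first.
  rewrite subr0; have [->|n0] := posnP n; first by rewrite andbF ifN //; lia.
  by rewrite gtnNdvd // ifN //; lia.
have [->|ne] := eqVneq n N.
  by rewrite dvdnn N0 divnn N0 expr1 subnn andbF mulr0 subr0.
have n0 : (0 < n - N)%N by lia.
rewrite n0 dvdn_subl // ?dvdnn // andbT; have -> : (0 < n)%N by lia.
case: ifP => [/andP[dv _]|/negbT]; last by rewrite andbT => /negbTE ->; rewrite mulr0 subrr.
rewrite dv -{1}(subnK nN) divnDr // divnn N0 addn1 exprS subrr //.
Qed.

End InverseSeries.

(** * The generating series of one cone *)

Section ConeSums.
Variables (A : comPzRingType) (L l : A) (nu : nat) (M : nat).
Hypothesis Ll : L * l = 1.

(** Measure of the arcs x(t) of order i for i <= M, and of order at least M+1 for i = M+1. *)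
Definition wt i : A := if (i <= M)%N then (L - 1) * l ^+ i else l ^+ M.

(** With h = t %/ p, the sum is over i > h. It telescopes to l^h, the last cell supplying the tail,
    and (1 - l) l^h = (L - 1) l^(h+1) is the term of the one index with t < i p <= t + p. *)
Lemma wt_row p t : (t < M.+1 * p)%N ->
  (1 - l) * (\sum_(i < M.+2) if (t < i * p)%N then wt i else 0) =
  \sum_(i < M.+2) if (t < i * p <= t + p)%N then (L - 1) * l ^+ i else 0.
Proof.
move=> tM; have p0 : (0 < p)%N by case: p tM => //; rewrite muln0.
have h0 : (t %/ p < M.+1)%N by rewrite ltn_divLR.
set h := (t %/ p)%N in h0.
have e1 i : (t < i * p)%N = (h < i)%N by rewrite -ltn_divLR.
(* The summand 1 becomes p %/ p, which [divnn] gives as the boolean 0 < p. *)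
have e2 i : (i * p <= t + p)%N = (i <= h.+1)%N by rewrite -addn1 -[1%N]/(nat_of_bool true) -p0
  -divnn -divnDr // leq_divRL.
have LX n : L * l ^+ n.+1 = l ^+ n by rewrite exprS mulrA Ll mul1r.
have tl n : (h <= n)%N -> \sum_(i < n.+1) (if (h < i)%N then (L - 1) * l ^+ i else 0) = l ^+ h -
  l ^+ n.
  elim: n => [|n IH] hn; first by move: hn; rewrite leqn0 => /eqP ->; rewrite big_ord1 subrr.
  rewrite big_ord_recr /=; case: (ltnP h n.+1) => hn'; last first.
    rewrite big1 ?addr0 => [|i _]; first by (have -> : h = n.+1 by lia); rewrite subrr.
    by rewrite ifN //; case: i => i /=; lia.
  by rewrite IH // mulrBl mul1r LX addrA subrK.
under eq_bigr do rewrite e1; rewrite big_ord_recr /= h0 /wt ltnn.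
under eq_bigr => i _ do rewrite (leq_ord i).
rewrite tl // subrK mulrBl mul1r.
under [RHS]eq_bigr => i _ do rewrite e1 e2.
rewrite (bigD1 (Ordinal (h0 : (h.+1 < M.+2)%N))) //= ltnSn /= big1 ?addr0 => [|i ne];
  first by rewrite mulrBl LX mul1r -exprS.
by rewrite ifN //; apply: contra ne => /andP[a b]; apply/eqP/val_inj => /=; lia.
Qed.

Lemma sum_shift m d (F : nat -> A) : (forall i, (i < d)%N -> F i = 0) -> (forall i, (m <= i)%N ->
  F i = 0) ->
  \sum_(i < m) F i = \sum_(i < m) F (i + d)%N.
Proof.
elim: d F => [|d IH] F F0 Fm; first by apply: eq_bigr => i _; rewrite addn0.
transitivity (\sum_(i < m) F i.+1).
  have := @big_ord_recl _ 0 +%R m F; rewrite big_ord_recr /= (F0 0) // add0r (Fm m) // addr0 => ->.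
  by apply: eq_bigr.
rewrite (IH (fun i => F i.+1)) => [|i id|i mi]; [by apply: eq_bigr => i _;
  rewrite addnS|exact: F0|].
by apply: Fm; lia.
Qed.

Variables a b : nat.

Definition plane (P : nat -> nat -> bool) n : A :=
  \sum_(i < M.+2) \sum_(j < M.+2) if P i j && (i * a + j * b == n)%N then (L - 1) ^+ 2 * l ^+ (nu
    * i + j) else 0.

(** The cutoff at M + 2 in [plane] loses no point of P that contributes to a degree at most M. *)
Definition bounded (P : nat -> nat -> bool) := forall i j, P i j -> (i * a + j * b <= M)%N -> (i
  < M.+2)%N /\ (j < M.+2)%N.

Definition sweep (P : nat -> nat -> bool) dp dq i j := P i j && ~~ [&& (dp <= i)%N, (dq <= j)%N &
  P (i - dp)%N (j - dq)%N].

(** Multiplying the generating series of P by 1 - c T^N, with c T^N the term of (dp, dq),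
    cancels all the points that are translates of points of P. *)
Lemma plane_shift P dp dq : bounded P -> (forall i j, P i j -> P (i + dp)%N (j + dq)%N) ->
  cong M (Fps (plane P) * (1 - fps_term (l ^+ (dp * nu + dq)) (dp * a + dq * b))) (Fps (plane
    (sweep P dp dq))).
Proof.
move=> bP cP n nM; rewrite coef_mul_1subT /=; apply/eqP; rewrite subr_eq; apply/eqP.
pose G i j : A := if [&& (dp <= i)%N, (dq <= j)%N, P (i - dp)%N (j - dq)%N & (i * a + j * b ==
  n)%N] then (L - 1) ^+ 2 * l ^+ (nu * i + j) else 0.
have G0 i j : (M.+2 <= i)%N || (M.+2 <= j)%N -> G i j = 0.
  move=> mij; rewrite /G; case: ifP => // /and4P[di dj /cP]; rewrite !subnK // => pij /eqP e.
  by have [] := bP _ _ pij; rewrite ?e //; lia.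
transitivity (plane (sweep P dp dq) n + \sum_(i < M.+2) \sum_(j < M.+2) G i j).
  rewrite /plane -big_split; apply: eq_bigr => i _; rewrite -big_split; apply: eq_bigr => j _ /=.
  rewrite /sweep /G; case: (_ == n) => //=; rewrite ?andbF ?andbT ?addr0 //.
  case: (boolP [&& _, _ & _]) => [/and3P[di dj h]|]; last by rewrite andbT addr0.
  by move: (cP _ _ h); rewrite !subnK // => ->; rewrite add0r.
congr (_ + _).
rewrite (@sum_shift _ dp (fun i => \sum_(j < M.+2) G i j)) => [|i id|i mi]; first last.
- by apply: big1 => j _; apply: G0; rewrite mi.
- by apply: big1 => j _; rewrite /G leqNgt id.
under eq_bigr => i _.
  rewrite (@sum_shift _ dq (fun j => G (i + dp)%N j)) => [|j jd|j mj]; first last.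
  - by apply: G0; rewrite mj orbT.
  - by rewrite /G (leqNgt dq) jd andbF.
  over.
case: leqP => nN; last first.
  apply: big1 => i _; apply: big1 => j _; rewrite /G ifN //; apply/negP => /and4P[_ _ _ /eqP e].
  by move: nN; rewrite -e !mulnDl; lia.
rewrite /plane mulr_sumr; apply: eq_bigr => i _; rewrite mulr_sumr; apply: eq_bigr => j _.
rewrite /G !leq_addl !addnK /=.
have -> : ((i + dp) * a + (j + dq) * b == n)%N = (i * a + j * b == n - (dp * a + dq * b))%N.
  by rewrite !mulnDl; apply/eqP/eqP; lia.
case: ifP => _; last by rewrite mulr0.
rewrite mulrCA -exprD; congr (_ * l ^+ _); nia.
Qed.

Variables p1 q1 p2 q2 : nat.
Hypotheses (det : (q1 * p2 < p1 * q2)%N) (p1E : q1 = 0%N -> p1 = 1%N) (q2E : p2 = 0%N -> q2 = 1%N).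
Hypotheses (q1a : (q1 <= a)%N) (p2b : (p2 <= b)%N) (ab : (0 < a + b)%N) (anu : a = 0%N -> nu = 1%N).

Definition cone i j := (j * p2 < i * q2)%N && (i * q1 < j * p1)%N.

(** What the cells of the cone contribute to the coefficient of T^n. Unlike in [plane], the last
    index carries the weight of a whole tail. *)
Definition cone_weight n : A :=
  \sum_(i < M.+2) \sum_(j < M.+2) if cone i j && (i * a + j * b == n)%N then wt i * l ^+ (nu.-1 *
    i) * wt j else 0.

(** The set P_Delta by Cramer's rule: in the basis (p1, q1), (p2, q2) the coordinates of (i, j) are
    (i q2 - j p2) / D and (j p1 - i q1) / D, and both lie in ]0, 1]. *)
Definition strip i j := (j * p2 < i * q2 <= j * p2 + (p1 * q2 - q1 * p2))%N && (i * q1 < j * p1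
  <= i * q1 + (p1 * q2 - q1 * p2))%N.

Lemma bounded_sub (P Q : nat -> nat -> bool) : (forall i j, Q i j -> P i j) -> bounded P ->
  bounded Q.
Proof. by move=> QP bP i j /QP; exact: bP. Qed.

Lemma eq_plane P Q n : (forall i j, P i j = Q i j) -> plane P n = plane Q n.
Proof. by move=> PQ; apply: eq_bigr => i _; apply: eq_bigr => j _; rewrite PQ. Qed.

Let D := (p1 * q2 - q1 * p2)%N.
Let c1 := l ^+ (p1 * nu + q1).
Let c2 := l ^+ (p2 * nu + q2).
Let N1 := (p1 * a + q1 * b)%N.
Let N2 := (p2 * a + q2 * b)%N.

(** The cone with only its first, respectively second, coordinate bounded by 1: what is left after
    multiplication by one of the two factors. *)
Definition strip1 i j := (j * p2 < i * q2 <= j * p2 + D)%N && (i * q1 < j * p1)%N.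
Definition strip2 i j := (j * p2 < i * q2)%N && (i * q1 < j * p1 <= i * q1 + D)%N.

Lemma sweep_cone1 i j : sweep cone p1 q1 i j = strip1 i j.
Proof.
rewrite /sweep /strip1 /cone; case: (ltnP (j * p2)%N (i * q2)%N) => //= h1;
  case: (ltnP (i * q1)%N (j * p1)%N) => h2; rewrite /= ?andbF //.
rewrite andbT [RHS]leqNgt; congr (~~ _); apply/idP/idP => [/and3P[di dj /andP[h _]]|h].
  by move: h; rewrite !mulnBl /D; nia.
(* A point whose first coordinate exceeds 1 dominates (p1, q1) in both entries, so the subtractions
   of natural numbers are not truncated. *)
have di : (p1 <= i)%N by rewrite leqNgt; apply/negP => ?; rewrite /D in h; nia.
have dj : (q1 <= j)%N by rewrite leqNgt; apply/negP => ?; rewrite /D in h; nia.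
by rewrite di dj /= !mulnBl; rewrite /D in h; apply/andP; split; nia.
Qed.

Lemma sweep_cone2 i j : sweep cone p2 q2 i j = strip2 i j.
Proof.
rewrite /sweep /strip2 /cone; case: (ltnP (j * p2)%N (i * q2)%N) => //= h1;
  case: (ltnP (i * q1)%N (j * p1)%N) => h2; rewrite /= ?andbF //.
rewrite [RHS]leqNgt; congr (~~ _); apply/idP/idP => [/and3P[di dj /andP[_ h]]|h].
  by move: h; rewrite !mulnBl /D; nia.
have di : (p2 <= i)%N by rewrite leqNgt; apply/negP => ?; rewrite /D in h; nia.
have dj : (q2 <= j)%N by rewrite leqNgt; apply/negP => ?; rewrite /D in h; nia.
by rewrite di dj /= !mulnBl; rewrite /D in h; apply/andP; split; nia.
Qed.

Lemma sweep_strip1 i j : sweep strip1 p2 q2 i j = strip i j.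
Proof.
have := sweep_cone2 i j; rewrite /sweep /strip1 /strip2 /strip /cone.
case: (ltnP (j * p2)%N (i * q2)%N) => //= h1; case: (ltnP (i * q1)%N (j * p1)%N) => h2;
  rewrite /= ?andbF //= -/D => e.
case: (leqP (i * q2)%N (j * p2 + D)%N) => h3 //=; rewrite -{}e; congr (~~ _).
case: (leqP p2 i) => //= di; case: (leqP q2 j) => //= dj; rewrite -andbA; congr (_ && _);
  have -> // : ((i - p2) * q2 <= (j - q2) * p2 + D)%N by rewrite !mulnBl; lia.
Qed.

Lemma sweep_strip2 i j : sweep strip2 p1 q1 i j = strip i j.
Proof.
have := sweep_cone1 i j; rewrite /sweep /strip1 /strip2 /strip /cone.
case: (ltnP (j * p2)%N (i * q2)%N) => //= h1; case: (ltnP (i * q1)%N (j * p1)%N) => h2;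
  rewrite /= ?andbF //= ?andbT -/D => e.
rewrite [RHS]andbC -{}e; case: (leqP (j * p1)%N (i * q1 + D)%N) => h3 //=; congr (~~ _).
case: (leqP p1 i) => //= di; case: (leqP q1 j) => //= dj; congr (_ && _);
  have -> : ((j - q1) * p1 <= (i - p1) * q1 + D)%N by rewrite !mulnBl; lia.
by rewrite andbT.
Qed.

Lemma cone_add1 i j : cone i j -> cone (i + p1) (j + q1).
Proof. by rewrite /cone !mulnDl => /andP[h1 h2]; apply/andP; split; nia. Qed.

Lemma strip1_add2 i j : strip1 i j -> strip1 (i + p2) (j + q2).
Proof. by rewrite /strip1 !mulnDl => /andP[/andP[h1 h2] h3]; apply/andP; split; [apply/andP;
  split|]; nia. Qed.

Lemma strip2_add1 i j : strip2 i j -> strip2 (i + p1) (j + q1).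
Proof. by rewrite /strip2 !mulnDl => /andP[h3 /andP[h1 h2]]; apply/andP; split; [|apply/andP;
  split]; nia. Qed.

Lemma cong_mul_term (f g h u v : fps A) : cong M (f * u) g -> cong M (g * v) h -> cong M (f * (u
  * v)) h.
Proof. by move=> e1 e2; rewrite mulrA; apply: cong_trans e2; apply: congM. Qed.

Hypothesis nu0 : (0 < nu)%N.

(** For a, b > 0 the equation i a + j b = n keeps i and j at most n, so the last cells do not
    occur. *)
Lemma plane_cone : (0 < a)%N -> (0 < b)%N -> cong M (Fps cone_weight) (Fps (plane cone)).
Proof.
move=> a0 b0 n nM /=; apply: eq_bigr => i _; apply: eq_bigr => j _;
  case: ifP => // /andP[/andP[h1 h2] /eqP e].
rewrite /wt !ifT; [|nia|nia]; case: nu nu0 => // m _ /=; rewrite mulSn expr2 !exprD; ring.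
Qed.

(** Here q1 = 0, p1 = nu = 1 and N1 = 0: the factor is the constant 1 - l, and for each j the sum
    over all orders i of x collapses by [wt_row]. *)
Lemma plane_strip1 : a = 0%N ->
  cong M (Fps cone_weight * (1 - fps_term c1 N1)) (Fps (plane strip1)).
Proof.
move=> a0 n nM; have q10 : q1 = 0%N by lia.
have nu1 := anu a0; have p11 := p1E q10; have DE : D = q2 by rewrite /D; nia.
rewrite /c1 /N1 q10 p11 nu1 a0 mul0n !mul1n addn0 expr1 coef_mul_1subT /= subn0 -[X in X -
  _]mul1r -mulrBl.
rewrite /cone_weight exchange_big /= mulr_sumr /plane exchange_big /=; apply: eq_bigr => j _.
rewrite a0 nu1 /=.
case: (eqVneq (j * b)%N n) => e; last first.
  by rewrite !big1 ?mulr0 // => i _; rewrite muln0 add0n (negbTE e) andbF.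
case: (posnP j) => j0.
  by rewrite !big1 ?mulr0 // => i _; rewrite /cone /strip1 j0 q10 muln0 mul0n ltnn !andbF.
have jM : (j * p2 < M.+1 * q2)%N by nia.
transitivity ((1 - l) * (\sum_(i < M.+2) if (j * p2 < i * q2)%N then wt i else 0) * wt j).
  rewrite -mulrA [X in _ = _ * X]mulr_suml; congr (_ * _); apply: eq_bigr => i _.
  rewrite muln0 e eqxx andbT /cone q10 p11 muln0 muln1 j0 andbT.
  by case: ifP; rewrite ?mul0r // mul0n expr0 mulr1.
rewrite wt_row // mulr_suml; apply: eq_bigr => i _.
rewrite muln0 e eqxx andbT /strip1 q10 p11 muln0 muln1 j0 andbT DE; case: ifP => _;
  last by rewrite mul0r.
by rewrite /wt ifT; [rewrite mul1n exprD; ring|nia].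
Qed.

(** The same for the orders j of y, with p2 = 0 and q2 = 1; the form only weights x, so nu is
    arbitrary. *)
Lemma plane_strip2 : b = 0%N ->
  cong M (Fps cone_weight * (1 - fps_term c2 N2)) (Fps (plane strip2)).
Proof.
move=> b0 n nM; have p20 : p2 = 0%N by lia.
have q21 := q2E p20; have DE : D = p1 by rewrite /D; nia.
rewrite /c2 /N2 p20 q21 b0 !mul0n !mul1n add0n expr1 coef_mul_1subT /= subn0 -[X in X - _]mul1r
  -mulrBl.
rewrite /cone_weight /= mulr_sumr /plane /=; apply: eq_bigr => i _.
rewrite b0.
case: (eqVneq (i * a)%N n) => e; last first.
  by rewrite !big1 ?mulr0 // => j _; rewrite muln0 addn0 (negbTE e) andbF.
case: (posnP i) => i0.
  by rewrite !big1 ?mulr0 // => j _; rewrite /cone /strip2 i0 p20 muln0 mul0n ltnn.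
have iM : (i * q1 < M.+1 * p1)%N by nia.
transitivity ((1 - l) * (\sum_(j < M.+2) if (i * q1 < j * p1)%N then wt j else 0) * (wt i * l ^+
  (nu.-1 * i))).
  rewrite -mulrA [X in _ = _ * X]mulr_suml; congr (_ * _); apply: eq_bigr => j _.
  rewrite muln0 addn0 e eqxx andbT /cone p20 q21 muln0 muln1 i0 /=.
  by case: ifP; rewrite ?mul0r // mulrC.
rewrite wt_row // mulr_suml; apply: eq_bigr => j _.
rewrite muln0 addn0 e eqxx andbT /strip2 p20 q21 muln0 muln1 i0 DE /=; case: ifP => _;
  last by rewrite mul0r.
rewrite /wt ifT; last by nia.
by case: nu nu0 => // m _ /=; rewrite mulSn !exprD; ring.
Qed.

Lemma bounded_cone : (0 < a)%N -> (0 < b)%N -> bounded cone.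
Proof. by move=> a0 b0 i j _ h; split; nia. Qed.

Lemma bounded_strip1 : (0 < b)%N -> bounded strip1.
Proof.
move=> b0 i j /andP[/andP[h1 h2] h3] h; rewrite /D in h2; case: (posnP a) => a0; last by split; nia.
have q10 : q1 = 0%N by lia.
have p11 := p1E q10; have DE : D = q2 by rewrite /D; nia.
rewrite -/D DE in h2; have jb : (j * p2 <= M)%N by nia.
split; last by nia.
by rewrite ltnNge; apply/negP => ?; nia.
Qed.

Lemma bounded_strip2 : b = 0%N -> bounded strip2.
Proof.
move=> b0 i j /andP[h3 /andP[h1 h2]] h; rewrite /D in h2.
have p20 : p2 = 0%N by lia.
have q21 := q2E p20; have DE : D = p1 by rewrite /D; nia.
rewrite -/D DE in h2; have ia : (i * q1 <= M)%N by nia.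
split; first by nia.
by rewrite ltnNge; apply/negP => ?; nia.
Qed.

(** The factor belonging to an unbounded direction has to be multiplied first, since only afterwards
    are the points of a given degree finite in number: the first factor if a = 0, the second if b =
    0. *)
Lemma cone_sum : cong M (Fps cone_weight * ((1 - fps_term c1 N1) * (1 - fps_term c2 N2))) (Fps
  (plane strip)).
Proof.
case: (posnP b) => b0; last first.
  apply: (@cong_mul_term _ (Fps (plane strip1))); last first.
    apply: cong_trans (plane_shift (bounded_strip1 b0) strip1_add2) _ => n _ /=.
    exact/eq_plane/sweep_strip1.
  case: (posnP a) => a0; first exact: plane_strip1.
  apply: cong_trans (congM (plane_cone a0 b0) (@cong_refl _ M _)) _.
  apply: cong_trans (plane_shift (bounded_cone a0 b0) cone_add1) _ => n _ /=.
  exact/eq_plane/sweep_cone1.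
rewrite [X in _ * X]mulrC; apply: (@cong_mul_term _ (Fps (plane strip2)));
  first exact: plane_strip2.
apply: cong_trans (plane_shift (bounded_strip2 b0) strip2_add1) _ => n _ /=.
exact/eq_plane/sweep_strip2.
Qed.

Lemma bounded_strip : bounded strip.
Proof.
case: (posnP b) => b0.
  by apply: bounded_sub (bounded_strip2 b0) => i j; rewrite /strip /strip2 => /andP[/andP[-> _] ->].
by apply: bounded_sub (bounded_strip1 b0) => i j; rewrite /strip /strip1 => /andP[-> /andP[-> _]].
Qed.

End ConeSums.

Lemma fsbig_box (A : nmodType) (X : set (nat * nat)) (P : nat -> nat -> bool) m (F : nat * nat ->
  A) :
  (forall u, X u <-> P u.1 u.2) -> (forall u, X u -> F u <> 0 -> (u.1 < m)%N /\ (u.2 < m)%N) ->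
  \sum_(u \in X) F u = \sum_(i < m) \sum_(j < m) if P i j then F (i : nat, j : nat) else 0.
Proof.
move=> XP Fm; set r := [seq u <- [seq (i, j) | i <- iota 0 m, j <- iota 0 m] | P u.1 u.2].
rewrite (fsbigE r); first last.
- move=> u Xu; apply: contraNeq => /eqP /(Fm _ Xu) [u1 u2]; rewrite mem_filter (XP u).1 //=.
  by case: u u1 u2 {Xu} => i j /= i1 j1; apply/allpairsP; exists (i, j); split; rewrite // mem_iota.
- by move=> u /=; rewrite mem_filter => /andP[/XP].
- apply: filter_uniq; apply: allpairs_uniq; rewrite ?iota_uniq // => -[? ?] [? ?] _ _ /= [-> ->] //.
rewrite big_filter_cond big_mkcond big_allpairs_dep /=.
have e (G : nat -> A) : \sum_(i <- iota 0 m) G i = \sum_(i < m) G i by rewrite -(big_mkord predT)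
  /index_iota subn0.
rewrite e; apply: eq_bigr => i _; rewrite e; apply: eq_bigr => j _.
by case: ifP => [/andP[->]|] //; case: ifP => // p; rewrite (mem_set (_ : X _)) //; apply/XP.
Qed.

Lemma cone_pointsP F1 F2 u : (fq F1 * fp F2 < fp F1 * fq F2)%N ->
  cone_points F1 F2 u <-> strip (fp F1) (fq F1) (fp F2) (fq F2) u.1 u.2.
Proof.
case: F1 F2 u => [p1 q1 N1] [p2 q2 N2] [i j] /= det; rewrite /strip.
have d : (0 : rat) < (p1 * q2 - q1 * p2)%N%:R by rewrite ltr0n subn_gt0.
have de : ((p1 * q2 - q1 * p2)%N%:R : rat) = p1%:R * q2%:R - q1%:R * p2%:R by rewrite natrB
  ?natrM // ltnW.
rewrite -!(ltr_nat rat) -!(ler_nat rat) !natrD !natrM de; rewrite {}de in d; split.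
  move=> [m1 [m2 [/andP[a1 a2] /andP[b1 b2] -> ->]]]; apply/andP; split; apply/andP; split; nra.
move=> /andP[/andP[a1 a2] /andP[b1 b2]].
exists ((i%:R * q2%:R - j%:R * p2%:R) / (p1%:R * q2%:R - q1%:R * p2%:R)).
exists ((j%:R * p1%:R - i%:R * q1%:R) / (p1%:R * q2%:R - q1%:R * p2%:R)).
have d0 := lt0r_neq0 d; split; last 1 [by field|by field].
- by apply/andP; split; [apply: divr_gt0 => //; lra|rewrite ler_pdivrMr //; lra].
- by apply/andP; split; [apply: divr_gt0 => //; lra|rewrite ler_pdivrMr //; lra].
Qed.

Lemma cone_points_finite F1 F2 : finite_set (cone_points F1 F2).
Proof.
apply: (@sub_finite_set _ _ (`I_(fp F1 + fp F2).+1 `*` `I_(fq F1 + fq F2).+1)); last first.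
  by apply: finite_setX; exact: finite_II.
move=> [i j] [m1 [m2 [/andP[a1 a2] /andP[b1 b2] /= e1 e2]]]; split;
  rewrite /= ltnS -(ler_nat rat) natrD ?e1 ?e2;
  [have := ler0n rat (fp F1); have := ler0n rat (fp F2)|have := ler0n rat (fq F1);
    have := ler0n rat (fq F2)]; nra.
Qed.

(** * Coefficients of the rational expressions in the formula *)

Section ConeTerm.
Variable k : fieldType.
Local Notation ell := (cinv (Lloc k)).
Local Notation LM := (toM (Lloc k)).
Local Notation lM := (toM ell).

Lemma LM_unit : LM * lM = 1.
Proof. by rewrite /toM -rmorphM Lloc_unit rmorph1. Qed.

Lemma LTE e N : LT k e N = fps_term (lM ^+ e) N.
Proof. by rewrite /LT LpowN /toM rmorphXn. Qed.

(** For N > 0 the constant term is 1. For N = 0 the series is the constant 1 - L^-e, which is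
    invertible only in the further localization. *)
Lemma one_subLT_unit e N : (0 < e)%N -> exists u, (1 - LT k e N) * u = 1.
Proof.
move=> e0; have [->|N0] := posnP N; last first.
  by apply: fps_unit; rewrite coefD coefN coef1 coef_term ifN ?subr0 //; case: N N0.
have -> : 1 - LT k e 0 = fps_term (toM (1 - Lpow k (- e%:Z))) 0.
  by rewrite -fps_term_1 /LT /toM rmorphB rmorph1 fps_termD; congr (_ + _); apply: fpsP => n;
    rewrite coefN !coef_term; case: ifP; rewrite ?oppr0.
by apply: fps_unit_const; apply: to_loc_unit; exists e%:Z => //; rewrite -lt0n.
Qed.

Lemma mul_unit (A : comPzRingType) (x y : A) : (exists u, x * u = 1) -> (exists u, y * u = 1) ->
  exists u, x * y * u = 1.
Proof. by move=> [u xu] [v yv]; exists (u * v); rewrite mulrACA xu yv mulr1. Qed.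

Lemma coef_Dcone nu F1 F2 v M n : (n <= M)%N -> (fq F1 * fp F2 < fp F1 * fq F2)%N ->
  bounded M v.1 v.2 (strip (fp F1) (fq F1) (fp F2) (fq F2)) ->
  coef ((Lc k - 1) ^+ 2 * Dcone k nu F1 F2 v) n = plane LM lM nu M v.1 v.2 (strip (fp F1) (fq F1)
    (fp F2) (fq F2)) n.
Proof.
move=> nM det bd; have -> : Lc k - 1 = fps_term (LM - 1) 0.
  by rewrite /Lc -fps_term_1 fps_termD; congr (_ + _); apply: fpsP => m;
    rewrite coefN !coef_term; case: ifP; rewrite ?oppr0.
rewrite fps_termX mul0n coef_cstM /Dcone (fsbig_finite _ _ (cone_points_finite _ _)) /= coef_sum.
rewrite -(fsbig_finite _ _ (cone_points_finite _ _)) /=.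
rewrite (@fsbig_box _ _ (strip (fp F1) (fq F1) (fp F2) (fq F2)) M.+2) => [|u|u /cone_pointsP cp];
  first last.
- by rewrite /=; case: eqP => // e _; apply: bd; [exact: cp|rewrite -e].
- exact: cone_pointsP.
rewrite mulr_sumr; apply: eq_bigr => i _; rewrite mulr_sumr; apply: eq_bigr => j _ /=.
by rewrite eq_sym; case: (strip _ _ _ _ _ _); case: eqP => //= _;
  rewrite ?mulr0 // LpowN /toM rmorphXn.
Qed.

Lemma toM_cone_weight nu M a b p1 q1 p2 q2 n :
  toM (cone_weight (Lloc k) ell nu M a b p1 q1 p2 q2 n) = cone_weight LM lM nu M a b p1 q1 p2 q2 n.
Proof.
rewrite /toM rmorph_sum; apply: eq_bigr => i _; rewrite rmorph_sum; apply: eq_bigr => j _ /=.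
case: ifP => _; last exact: rmorph0.
have w m : to_loc (@denoms k) (wt (Lloc k) ell M m) = wt LM lM M m.
  by rewrite /wt; case: ifP => _; rewrite ?rmorphM ?rmorphB ?rmorph1 rmorphXn.
by rewrite !rmorphM rmorphXn; congr (_ * _ * _); exact: w.
Qed.

(** [cone_sum] at precision n compares the two series after multiplication by the denominator; this
    is a unit, and congruence modulo T^(n+1) is preserved when dividing by it. *)
Lemma coef_cone_term (A : set (nat * nat)) nu F1 F2 v n : corner A F1 F2 v -> (0 < nu)%N -> (0 <
  v.1 + v.2)%N -> (v.1 = 0%N -> nu = 1%N) ->
  coef (cone_term k nu F1 F2 v) n = toM (cone_weight (Lloc k) ell nu n v.1 v.2 (fp F1) (fq F1)
    (fp F2) (fq F2) n).
Proof.
move=> [_ _ _ N1 N2 det p1 q2 v1 v2] nu0 v0 vnu.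
have cs := cone_sum LM_unit det p1 q2 v1 v2 v0 vnu nu0 (M := n).
have eN p q (F : face) : fN F = (p * v.1 + q * v.2)%N -> LT k (p * nu + q) (fN F) = fps_term (lM
  ^+ (p * nu + q)) (p * v.1 + q * v.2).
  by move=> ->; exact: LTE.
rewrite -(eN _ _ F1 N1) -(eN _ _ F2 N2) in cs; set U := (1 - _) * _ in cs.
have [u Uu] : exists u, U * u = 1.
  by apply: mul_unit; apply: one_subLT_unit; rewrite addn_gt0 muln_gt0;
    case: (posnP (fp F1)) (posnP (fp F2)) => [?|?] [?|?]; rewrite ?nu0 ?andbT //; lia.
have Uc : U * cinv U = 1 by apply: cinvP; exists u.
rewrite /cone_term -/U; move: (cinv U) Uc => {Uu}u Uu.
rewrite toM_cone_weight; transitivity (coef (Fps (cone_weight LM lM nu n v.1 v.2 (fp F1) (fq F1)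
  (fp F2) (fq F2)) * (U * u)) n); last first.
  by rewrite Uu mulr1.
rewrite mulrA; apply: (@congM _ n) => // m mn; rewrite cs //.
by apply: coef_Dcone => //; exact: (bounded_strip (nu := nu)).
Qed.

Lemma coef_face_term nu r S n : (0 < fp S)%N -> (0 < nu)%N -> (0 < fN S)%N ->
  coef (face_term k nu r S) n =
  if (fN S %| n)%N && (0 < n)%N then toM ((Lloc k - 1) * (Lloc k - r%:R - 1) * ell ^+ ((fp S * nu
    + fq S) * (n %/ fN S))) else 0.
Proof.
move=> p0 nu0 N0; set c := lM ^+ (fp S * nu + fq S).
have -> : face_term k nu r S = fps_term ((LM - 1) * (LM - r%:R - 1)) 0 * Fps (fun n => if (fN S
  %| n)%N && (0 < n)%N then c ^+ (n %/ fN S) else 0).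
  apply/esym/cinv_eq; first by apply: one_subLT_unit; rewrite addn_gt0 muln_gt0 p0 nu0.
  rewrite LTE -/c; transitivity (fps_term ((LM - 1) * (LM - r%:R - 1)) 0 * fps_term c (fN S)).
    by rewrite -mulrA; congr (_ * _); exact: geometric.
  rewrite /Lc; congr (_ * _).
  have tN (x : Mloc k) : fps_term (- x) 0 = - fps_term x 0 by apply: fpsP => m;
    rewrite coefN !coef_term; case: ifP; rewrite ?oppr0.
  have tn m : fps_term (m%:R : Mloc k) 0 = m%:R.
    by elim: m => [|m IH]; [apply: fpsP => m; rewrite coef_term coef0;
      case: ifP|rewrite !mulrS fps_termD IH fps_term_1].
  by rewrite -[0%N in LHS]/(0 + 0)%N -fps_term_mul !fps_termD !tN tn fps_term_1.
rewrite coef_cstM /=; case: ifP => _; last by rewrite mulr0.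
by rewrite /c -exprM /toM !rmorphM !rmorphB rmorphXn rmorph1 rmorph_nat.
Qed.

End ConeTerm.

(** * The zeta function cell by cell *)

Section Cells.
Variable k : fieldType.
Local Notation ell := (cinv (Lloc k)).

(** Used both for a vertex, where one monomial has minimal weight, and for a compact face, where the
    initial form appears. *)
Lemma lead_ev i j N x y (f : fps2 k) : (0 < i)%N -> (0 < j)%N -> ordge i x -> ordge j y ->
  (forall u, supp f u -> (N <= i * u.1 + j * u.2)%N) ->
  ordge N (ev x y f) /\
  coef (ev x y f) N = \sum_(a < N.+1) \sum_(b < N.+1 | (i * a + j * b == N)%N) coef (coef f a) b
    * (coef x i ^+ a * coef y j ^+ b).
Proof.
move=> i0 j0 hx hy hN; have o1 : ordge 1 x by move=> m m0; apply: hx; lia.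
have o2 : ordge 1 y by move=> m m0; apply: hy; lia.
have z a b : (i * a + j * b < N)%N -> coef (coef f a) b = 0.
  by move=> h; apply/eqP/negPn/negP => nz; have := hN (a, b) nz => /=; lia.
split=> [m mN|]; rewrite (evE f o1 o2 (leqnn _)).
  apply: big1 => a _; apply: big1 => b _; case: (ltnP (i * a + j * b)%N N) => h;
    first by rewrite z ?mul0r.
  by have [l _] := lead_mono a b hx hy; rewrite l ?mulr0 //; lia.
apply: eq_bigr => a _; rewrite [RHS]big_mkcond; apply: eq_bigr => b _.
have [l e] := lead_mono a b hx hy; case: eqP => h; first by move: e; rewrite h => ->.
by case: (ltnP (i * a + j * b)%N N) => h'; [rewrite z ?mul0r|rewrite l ?mulr0 //; lia].
Qed.

Variable fs : seq (fps2 k).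
Local Notation A := (gen_supp fs).
Local Notation Q := (fun n (phi : arc k) => ord_gens [set` fs] phi n).

Lemma ord_gens_ordge i j n (phi : arc k) : (0 < i)%N -> (0 < j)%N -> ordge i phi.1 -> ordge j
  phi.2 ->
  (forall u, A u -> (n < i * u.1 + j * u.2)%N) -> ~ Q n phi.
Proof.
move=> i0 j0 hx hy hA [_ [f /= ff]]; apply.
have [h _] : ordge n.+1 (ev phi.1 phi.2 f) /\ _ := lead_ev i0 j0 hx hy (fun u hu => hA u
  (ex_intro2 _ _ f ff hu)).
exact: h.
Qed.

(** (i, j) is a positive combination of the two normals, so the two support inequalities add up;
    equality would put u on both lines and hence at v. *)
Lemma corner_min F1 F2 v i j u : corner A F1 F2 v -> cone (fp F1) (fq F1) (fp F2) (fq F2) i j ->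
  A u -> u <> v ->
  (i * v.1 + j * v.2 < i * u.1 + j * u.2)%N.
Proof.
move=> c /andP[c1 c2] Au uv; have s1 := corner_s1 c Au; have s2 := corner_s2 c Au.
rewrite (corner_N1 c) in s1; rewrite (corner_N2 c) in s2; have det := corner_det c.
case: F1 F2 c1 c2 s1 s2 det {c Au} => [p1 q1 N1] [p2 q2 N2] /= c1 c2 s1 s2 det.
case: u v uv s1 s2 => [u1 u2] [v1 v2] /= uv s1 s2.
rewrite ltnNge; apply/negP => h.
(* The coordinates of (i, j) with respect to the two normals, up to the determinant. *)
pose al := (i%:Z * q2%:Z - j%:Z * p2%:Z); pose be := (j%:Z * p1%:Z - i%:Z * q1%:Z).
have al0 : 0 < al by rewrite /al; lia.
have be0 : 0 < be by rewrite /be; lia.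
pose x := (p1%:Z * (u1%:Z - v1%:Z) + q1%:Z * (u2%:Z - v2%:Z));
  pose y := (p2%:Z * (u1%:Z - v1%:Z) + q2%:Z * (u2%:Z - v2%:Z)).
have x0 : 0 <= x by rewrite /x; lia.
have y0 : 0 <= y by rewrite /y; lia.
have e : al * x + be * y = (p1%:Z * q2%:Z - q1%:Z * p2%:Z) * (i%:Z * (u1%:Z - v1%:Z) + j%:Z *
  (u2%:Z - v2%:Z)) by rewrite /al /be /x /y; ring.
have h' : i%:Z * (u1%:Z - v1%:Z) + j%:Z * (u2%:Z - v2%:Z) <= 0 by lia.
have det' : 0 < p1%:Z * q2%:Z - q1%:Z * p2%:Z by lia.
have xy : x = 0 /\ y = 0 by split; nia.
move: xy; rewrite /x /y => -[ex ey]; apply: uv.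
have d1 : (p1%:Z * q2%:Z - q1%:Z * p2%:Z) * (u1%:Z - v1%:Z) = 0.
  transitivity (q2%:Z * x - q1%:Z * y); first by rewrite /x /y; ring.
  by rewrite /x /y ex ey !mulr0 subrr.
have d2 : (p1%:Z * q2%:Z - q1%:Z * p2%:Z) * (u2%:Z - v2%:Z) = 0.
  transitivity (p1%:Z * y - p2%:Z * x); first by rewrite /x /y; ring.
  by rewrite /x /y ex ey !mulr0 subrr.
by congr (_, _); nia.
Qed.

(** If i = n + 1 and the order does not exceed n, then v.1 = 0: the minimal monomial does not
    contain x, and no leading coefficient of x(t) is required. The same holds for j. *)
Lemma cone_cell F1 F2 v n i j : corner A F1 F2 v -> (0 < i <= n.+1)%N -> (0 < j <= n.+1)%N ->
  cone (fp F1) (fq F1) (fp F2) (fq F2) i j ->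
  motmeas (@cell k (i <= n)%N (j <= n)%N i j `&` Q n) =
  if (i * v.1 + j * v.2 == n)%N then wt (Lloc k) ell n i * wt (Lloc k) ell n j else 0.
Proof.
move=> c /andP[i0 iM] /andP[j0 jM] ij; set N := (i * v.1 + j * v.2)%N.
have minA u : A u -> (N <= i * u.1 + j * u.2)%N.
  by move=> Au; have [->//|/eqP ne] := eqVneq u v; exact: ltnW (corner_min c ij Au ne).
have nz (phi : arc k) : @cell k (i <= n)%N (j <= n)%N i j phi -> (N <= n)%N ->
    exists2 f, f \in fs & coef (ev phi.1 phi.2 f) N <> 0.
  move=> [hx hy nx ny] Nn; have [f ff fv] := corner_in c; exists f => //.
  have [_ ->] := lead_ev i0 j0 hx hy (fun u hu => minA u (ex_intro2 _ _ f ff hu)).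
  have v1N : (v.1 < N.+1)%N by rewrite /N; nia.
  have v2N : (v.2 < N.+1)%N by rewrite /N; nia.
  rewrite (bigD1 (Ordinal v1N)) //= (bigD1 (Ordinal v2N)) //= !big1 ?addr0.
  - have x0 : coef phi.1 i ^+ v.1 != 0.
      case: (leqP i n) => hi; first by rewrite expf_neq0 //; apply/eqP/nx.
      by have -> : v.1 = 0%N; [rewrite /N in Nn; nia|rewrite expr0 oner_neq0].
    have y0 : coef phi.2 j ^+ v.2 != 0.
      case: (leqP j n) => hj; first by rewrite expf_neq0 //; apply/eqP/ny.
      by have -> : v.2 = 0%N; [rewrite /N in Nn; nia|rewrite expr0 oner_neq0].
    by apply/eqP; rewrite !mulf_neq0.
  - move=> a ne; apply: big1 => b /eqP e; apply/eqP; rewrite mulf_eq0; apply/orP; left;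
    apply/negPn/negP => nf.
    have := corner_min c ij (ex_intro2 _ _ f ff nf : A (a : nat, b : nat)) => /= h.
    have : (N < i * a + j * b)%N; last by rewrite e ltnn.
    by apply: h => ve; move/eqP: ne; apply; apply/val_inj => /=; rewrite -ve.
  - move=> b /andP[/eqP e ne]; apply/eqP; rewrite mulf_eq0; apply/orP; left; apply/negPn/negP => nf.
    have := corner_min c ij (ex_intro2 _ _ f ff nf : A (v.1, b : nat)) => /= h.
    have : (N < i * v.1 + j * b)%N; last by rewrite e ltnn.
    by apply: h => ve; move/eqP: ne; apply; apply/val_inj => /=; rewrite -ve.
have lN (phi : arc k) f : @cell k (i <= n)%N (j <= n)%N i j phi -> f \in fs -> ordge N (ev phi.1
  phi.2 f).
  by move=> [hx hy _ _] ff; have [] := lead_ev i0 j0 hx hy (fun u hu => minA u (ex_intro2 _ _ f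
    ff hu)).
case: eqP => Nn.
  have -> : @cell k (i <= n)%N (j <= n)%N i j `&` Q n = @cell k (i <= n)%N (j <= n)%N i j.
    apply/seteqP; split=> [phi []//|phi hphi]; split=> //; split; rewrite -Nn.
      by move=> f /=; exact: lN.
    by apply: nz; rewrite // Nn.
  case: i j i0 j0 iM jM {ij N minA nz lN Nn} => // i [//|j] _ _ iM jM; rewrite motmeas_cell /wt.
  have w m (b := (m < n)%N) : (m < n.+1)%N -> (Lloc k - 1) ^+ b * ell ^+ (m + b) = if (m < n)%N
    then (Lloc k - 1) * ell ^+ m.+1 else ell ^+ n.
    move=> mn; rewrite /b; case: ltnP => h; first by rewrite expr1 addn1.
    by rewrite mul1r addn0; congr (_ ^+ _); lia.
  by rewrite -!w // !exprD mulrACA.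
rewrite (_ : _ `&` _ = set0) ?motmeas_set0 //; apply/seteqP;
  split=> // phi [hphi [ge [f /= ff f0]]].
case: (ltngtP N n) => // h.
  by have [g gf] := nz _ hphi (ltnW h); apply; exact: ge.
by apply: f0; exact: (lN _ _ hphi ff).
Qed.

End Cells.

(** * Conditions on n-jets to which additivity of the measure applies *)

Section JetConditions.
Variables (k : fieldType) (n : nat).
Implicit Types (P : arc k -> Prop) (g : arc k -> k).

(** Local closedness is asked on every polynomial family of arcs, not only on jets, so that a
    condition can be pulled back along the Newton map. *)
Definition jet_prop P := (forall phi psi, cong n phi.1 psi.1 -> cong n phi.2 psi.2 -> P phi -> P
  psi) /\
  (forall m (X Y : affpt k m -> fps k), pfam X -> pfam Y -> locally_closed [set z | P (X z, Y z)]).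

Definition jet_fun g := (forall phi psi, cong n phi.1 psi.1 -> cong n phi.2 psi.2 -> g phi = g
  psi) /\
  (forall m (X Y : affpt k m -> fps k), pfam X -> pfam Y -> polyf (fun z => g (X z, Y z))).

Lemma jet_coord1 m : (m <= n)%N -> jet_fun (fun phi => coef phi.1 m).
Proof. by move=> mn; split=> [phi psi h _|m' X Y hX _]; [exact: h|exact: hX]. Qed.

Lemma jet_coord2 m : (m <= n)%N -> jet_fun (fun phi => coef phi.2 m).
Proof. by move=> mn; split=> [phi psi _ h|m' X Y _ hY]; [exact: h|exact: hY]. Qed.

Lemma jet_cst c : jet_fun (fun=> c).
Proof. by split=> // m X Y _ _; exact: polyf_cst. Qed.

Lemma jet_funM g h : jet_fun g -> jet_fun h -> jet_fun (fun phi => g phi * h phi).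
Proof.
move=> [g1 g2] [h1 h2]; split=> [phi psi e1 e2|m X Y hX hY];
  first by rewrite (g1 _ _ e1 e2) (h1 _ _ e1 e2).
by apply: polyfM; [exact: g2|exact: h2].
Qed.

Lemma jet_funD g h : jet_fun g -> jet_fun h -> jet_fun (fun phi => g phi + h phi).
Proof.
move=> [g1 g2] [h1 h2]; split=> [phi psi e1 e2|m X Y hX hY];
  first by rewrite (g1 _ _ e1 e2) (h1 _ _ e1 e2).
by apply: polyfD; [exact: g2|exact: h2].
Qed.

Lemma jet_funX g p : jet_fun g -> jet_fun (fun phi => g phi ^+ p).
Proof.
move=> hg; elim: p => [|p IH]; first exact: jet_cst.
by have := jet_funM hg IH; congr jet_fun; apply/funext => phi; rewrite exprS.
Qed.

Lemma jet_eq0 g : jet_fun g -> jet_prop (fun phi => g phi = 0).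
Proof. by move=> [g1 g2]; split=> [phi psi e1 e2 <-|m X Y hX hY];
  [rewrite (g1 _ _ e1 e2)|apply: lc_eq0; exact: g2]. Qed.

Lemma jet_neq0 g : jet_fun g -> jet_prop (fun phi => g phi <> 0).
Proof. by move=> [g1 g2]; split=> [phi psi e1 e2|m X Y hX hY];
  [rewrite (g1 _ _ e1 e2)|apply: lc_neq0; exact: g2]. Qed.

Lemma jet_true (b : bool) : jet_prop (fun=> b).
Proof.
split=> // m X Y _ _; case: b; first by have := @lcT k m; congr locally_closed; apply/seteqP; split.
by have := @lc_set0 k m; congr locally_closed; apply/seteqP; split.
Qed.

Lemma jetI P P' : jet_prop P -> jet_prop P' -> jet_prop (fun phi => P phi /\ P' phi).
Proof.
move=> [a1 a2] [b1 b2]; split=> [phi psi e1 e2 [h1 h2]|m X Y hX hY]; first by split;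
  [exact: a1 h1|exact: b1 h2].
by apply: lcI; [exact: a2|exact: b2].
Qed.

Lemma jet_impl (b : bool) P : jet_prop P -> jet_prop (fun phi => b -> P phi).
Proof.
move=> hP; case: b; last by have := jet_true true; congr jet_prop; apply/funext => phi;
  apply/propext; split.
by move: hP; congr jet_prop; apply/funext => phi; apply/propext; split=> // h; exact: h.
Qed.

Lemma jet_all (J : finType) (P : J -> arc k -> Prop) : (forall j, jet_prop (P j)) -> jet_prop
  (fun phi => forall j, P j phi).
Proof.
move=> h; split=> [phi psi e1 e2 hp j|m X Y hX hY]; first by have [a _] := h j; exact: a (hp j).
by apply: (@lc_forall k m J (fun j => [set z | P j (X z, Y z)])) => j; have [_ a] := h j; exact: a.
Qed.

Lemma jet_ext P P' : (forall phi, P phi <-> P' phi) -> jet_prop P -> jet_prop P'.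
Proof. by move=> e; congr jet_prop; apply/funext => phi; exact/propext/e. Qed.

Lemma jet_ordge1 i : (i <= n.+1)%N -> jet_prop (fun phi => ordge i phi.1).
Proof.
move=> iN; apply: (@jet_ext (fun phi => forall m : 'I_i, coef phi.1 m = 0)).
  by move=> phi; split=> [h m mi|h m]; [exact: (h (Ordinal mi))|exact: h].
by apply: jet_all => m; apply/jet_eq0/jet_coord1; case: m => m /=; lia.
Qed.

Lemma jet_ordge2 i : (i <= n.+1)%N -> jet_prop (fun phi => ordge i phi.2).
Proof.
move=> iN; apply: (@jet_ext (fun phi => forall m : 'I_i, coef phi.2 m = 0)).
  by move=> phi; split=> [h m mi|h m]; [exact: (h (Ordinal mi))|exact: h].
by apply: jet_all => m; apply/jet_eq0/jet_coord2; case: m => m /=; lia.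
Qed.

Lemma jet_ord1 (b : bool) i : (i <= n.+1)%N -> (b -> i <= n)%N -> jet_prop (fun phi => ordge i
  phi.1 /\ (b -> coef phi.1 i <> 0)).
Proof.
move=> i1 ib; apply: jetI; first exact: jet_ordge1.
case: b ib => ib; first by apply: jet_impl; apply/jet_neq0/jet_coord1/ib.
by have := jet_true true; apply: jet_ext.
Qed.

Lemma jet_ord2 (b : bool) i : (i <= n.+1)%N -> (b -> i <= n)%N -> jet_prop (fun phi => ordge i
  phi.2 /\ (b -> coef phi.2 i <> 0)).
Proof.
move=> i1 ib; apply: jetI; first exact: jet_ordge2.
case: b ib => ib; first by apply: jet_impl; apply/jet_neq0/jet_coord2/ib.
by have := jet_true true; apply: jet_ext.
Qed.

Lemma jet_cell (b1 b2 : bool) i j : (i <= n.+1)%N -> (j <= n.+1)%N -> (b1 -> i <= n)%N -> (b2 ->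
  j <= n)%N ->
  jet_prop (cell b1 b2 i j).
Proof.
move=> i1 j1 ib jb; have := jetI (jet_ord1 i1 ib) (jet_ord2 j1 jb); apply: jet_ext => phi.
by split=> [[[? ?] [? ?]]|[? ? ? ?]].
Qed.

Lemma jet_ord_gens (fs : seq (fps2 k)) : jet_prop (fun phi => ord_gens [set` fs] phi n).
Proof.
split=> [phi psi e1 e2|m X Y hX hY]; last exact: lc_ord_gens.
by rewrite -!ord_idealE; exact: ord_ideal_cong.
Qed.

Lemma jet_narc p q mu P : jet_prop P -> jet_prop (fun phi => P (narc p q mu phi)).
Proof.
move=> [h1 h2]; split=> [phi psi e1 e2|m X Y hX hY].
  apply: h1; first by apply: congM => //; exact: congX.
  by apply: congM; [exact: congX|exact: congD].
apply: (h2 m (fun z => (narc p q mu (X z, Y z)).1) (fun z => (narc p q mu (X z, Y z)).2)).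
  by apply: pfamM; [exact: pfam_cst|exact: pfamX].
by apply: pfamM; [exact: pfamX|apply: pfamD => //; exact: pfam_cst].
Qed.

Lemma lcyl_jet P : jet_prop P -> lcyl n [set phi | arcs0 phi /\ P phi].
Proof.
move=> [h1 h2]; exists [set z | P (trunc_arc z)].
  apply: (h2 _ (fun z => (trunc_arc z).1) (fun z => (trunc_arc z).2)) => -[|m];
    try exact: polyf_cst.
    exact: polyf_xs.
  exact: polyf_ys.
apply/seteqP; split=> phi [a0] /= hP; split=> //; move: hP; apply: h1.
- by move=> [|m] mn; [case: a0|rewrite jetE /= xs_mk mn].
- by move=> [|m] mn; [case: a0|rewrite jetE /= ys_mk mn].
- by move=> [|m] mn; [case: a0|rewrite jetE /= xs_mk mn].
- by move=> [|m] mn; [case: a0|rewrite jetE /= ys_mk mn].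
Qed.

Lemma measure_partition (J : finType) P (E : J -> arc k -> Prop) : jet_prop P -> (forall j,
  jet_prop (E j)) ->
  (forall phi, arcs0 phi -> P phi -> exists j, E j phi) -> (forall i j phi, E i phi -> E j phi ->
    i = j) ->
  motmeas [set phi | arcs0 phi /\ P phi] = \sum_j motmeas [set phi | arcs0 phi /\ (P phi /\ E j
    phi)].
Proof.
move=> hP hE ex un; apply: (@motmeas_partition _ n).
- exact: lcyl_jet.
- by move=> j; apply/lcyl_jet/jetI.
- by move=> i j phi [_ [_ h]] [_ [_ h']]; exact: un h h'.
apply/seteqP; split=> phi; last by move=> [j _ [? []]].
by move=> [a0 p]; have [j e] := ex _ a0 p; exists j.
Qed.

End JetConditions.

(** * Coefficients of the zeta function as sums over cells *)

Section ZetaCoefficient.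
Variables (k : fieldType) (n : nat).
Local Notation ell := (cinv (Lloc k)).

(** The index [i = n.+1] collects all orders beyond the precision [n]. *)
Definition ford i (f : fps k) : Prop := ordge i f /\ ((i <= n)%N -> coef f i <> 0).

Lemma ford_exists f : ordge 1 f -> exists i : 'I_n.+1, ford i.+1 f.
Proof.
move=> f1; have ex : exists m, (m == n.+1) || (coef f m != 0) by exists n.+1; rewrite eqxx.
case: (ex_minnP ex) => -[|m] hm mmin; first by move: hm; rewrite f1 ?eqxx.
have mn : (m < n.+1)%N by apply: mmin; rewrite eqxx.
exists (Ordinal mn); split=> [i im|/= mn'].
  by apply/eqP/negPn/negP => h; have := mmin i; rewrite h orbT => /(_ isT); move: im => /=; lia.
by move: hm; case: eqP => /= [e|_ /eqP //]; lia.
Qed.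

Lemma ford_uniq i j f : (i <= n.+1)%N -> (j <= n.+1)%N -> ford i f -> ford j f -> i = j.
Proof.
move=> iN jN [o1 c1] [o2 c2]; case: (ltngtP i j) => // h.
  by case: c1; [lia|exact: o2].
by case: c2; [lia|exact: o1].
Qed.

Lemma jet_ford1 (i : 'I_n.+1) : jet_prop n (fun phi : arc k => ford i.+1 phi.1).
Proof. by apply: jet_ord1; case: i. Qed.

Lemma jet_ford2 (i : 'I_n.+1) : jet_prop n (fun phi : arc k => ford i.+1 phi.2).
Proof. by apply: jet_ord2; case: i. Qed.

Lemma measure_ford1 P : jet_prop n P ->
  motmeas [set phi : arc k | arcs0 phi /\ P phi] = \sum_(i < n.+1) motmeas [set phi | arcs0 phi
    /\ (P phi /\ ford i.+1 phi.1)].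
Proof.
move=> hP; apply: (measure_partition (n := n) (E := fun (i : 'I_n.+1) phi => ford i.+1 phi.1)) =>
  //.
- exact: jet_ford1.
- by move=> phi /arcs0_ordge [a0 _] _; exact: ford_exists.
- by move=> i j phi h h'; apply/val_inj; apply: succn_inj; apply: ford_uniq h h'; apply: ltn_ord.
Qed.

Lemma measure_ford2 P : jet_prop n P ->
  motmeas [set phi : arc k | arcs0 phi /\ P phi] = \sum_(i < n.+1) motmeas [set phi | arcs0 phi
    /\ (P phi /\ ford i.+1 phi.2)].
Proof.
move=> hP; apply: (measure_partition (n := n) (E := fun (i : 'I_n.+1) phi => ford i.+1 phi.2)) =>
  //.
- exact: jet_ford2.
- by move=> phi /arcs0_ordge [_ a0] _; exact: ford_exists.
- by move=> i j phi h h'; apply/val_inj; apply: succn_inj; apply: ford_uniq h h'; apply: ltn_ord.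
Qed.

(** Only m = (nu - 1) i matters, where i is the order of x(t). For nu = 1 everything sits in m = 0,
    including arcs with x(t) = 0; for nu > 1 the hypothesis leaves only the orders 1, ..., n. *)
Lemma zeta_coef J P nu : (0 < nu)%N -> (0 < n)%N -> jet_prop n P ->
  (forall phi, arcs0 phi -> ord_ideal J phi n <-> P phi) ->
  (nu = 1%N \/ forall phi, arcs0 phi -> P phi -> ~ ordge n.+1 phi.1) ->
  coef (zeta J nu) n =
  \sum_(i < n.+1) motmeas [set phi | arcs0 phi /\ (P phi /\ ford i.+1 phi.1)] * ell ^+ (nu.-1 *
    i.+1).
Proof.
move=> nu0 n0 hP JP; have -> : coef (zeta J nu) n = \sum_(m \in [set: nat]) motmeas (Vset J nu n
  m) * Lpow k (- m%:Z).
  by rewrite /zeta /=; case: n n0.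
case: (eqVneq nu 1%N) => [nu1 _|nu1 hyp].
  rewrite (fsbigE [:: 0%N]) //; last first.
    move=> m _; rewrite inE => m0; have -> : Vset J nu n m = set0.
      by apply/seteqP; split=> // phi [_ _]; rewrite /ord_form nu1 => -[e]; rewrite -e in m0.
    by rewrite motmeas_set0 mul0r.
  rewrite big_mkcond big_cons big_nil in_setT LpowN expr0 mulr1 /= addr0.
  have -> : Vset J nu n 0 = [set phi | arcs0 phi /\ P phi].
    by apply/seteqP; split=> phi; rewrite /Vset /ord_form nu1 /= => -[a0 h]; [move=> _|];
      split=> //; exact/(JP _ a0).
  by rewrite measure_ford1 //; apply: eq_bigr => i _; rewrite nu1 mul0n mulr1.
case: hyp => [/eqP|hyp]; first by rewrite (negbTE nu1).
have nu2 : (0 < nu.-1)%N by lia.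
rewrite (fsbigE [seq (nu.-1 * i)%N | i <- iota 1 n]) //; first last.
- move=> m _ mr; have -> : Vset J nu n m = set0; last by rewrite motmeas_set0 mul0r.
  apply/seteqP; split=> // phi [a0 /(JP _ a0) h]; rewrite /ord_form (negbTE nu1).
  case E : (order phi.1) => [i|] //= -[em]; move/negP: mr; apply; apply/mapP; exists i => //.
  move/orderP: E => [c0 oi]; rewrite mem_iota; apply/andP; split.
    by case: i c0 {em oi} => //; case: a0 => -> _; rewrite eqxx.
  rewrite add1n ltnNge; apply/negP => ni; apply: (hyp _ a0 h) => l ln; apply: oi; lia.
- by rewrite map_inj_uniq ?iota_uniq // => i j /eqP;
  rewrite eqn_mul2l -[_ == 0%N]negbK -lt0n nu2 => /eqP.
rewrite big_map (eq_bigl predT) => [|i]; last by rewrite in_setT.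
(* In the last cell the order of x(t) exceeds n, which the hypothesis excludes. *)
rewrite big_ord_recr /= [X in _ = _ + X * _](_ : _ = 0) ?mul0r ?addr0; last first.
  rewrite (_ : [set _ | _] = set0) ?motmeas_set0 //; apply/seteqP; split=> // phi [a0 [p [o _]]].
  exact: hyp a0 p o.
rewrite (iotaDl 1 0) big_map -[n in iota 0 n]subn0 -/(index_iota 0 n) big_mkord;
  apply: eq_bigr => i _.
rewrite LpowN add1n; congr (motmeas _ * _); apply/seteqP; split=> phi.
  move=> [a0 /(JP _ a0) h]; rewrite /ord_form (negbTE nu1);
    case E : (order phi.1) => [j|] //= -[/eqP].
  rewrite eqn_mul2l -[_ == 0%N]negbK -lt0n nu2 /= => /eqP ej; move/orderP: E => [c0 oi];
    rewrite ej in c0 oi.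
  by split=> //; split=> //; split=> // _; exact/eqP.
move=> [a0 [h [o c]]]; split=> //; first exact/(JP _ a0).
rewrite /ord_form (negbTE nu1); have -> : order phi.1 = Some i.+1 by apply/orderP; split=> //;
  apply/eqP/c.
by [].
Qed.

Lemma zeta_coef_cells (fs : seq (fps2 k)) nu : (0 < nu)%N -> (0 < n)%N ->
  (nu = 1%N \/ forall u, gen_supp fs u -> (0 < u.1)%N) ->
  coef (zeta (ideal_gen [set` fs]) nu) n =
  \sum_(i < n.+1) \sum_(j < n.+1)
    motmeas (cell (i < n)%N (j < n)%N i.+1 j.+1 `&` (fun phi => ord_gens [set` fs] phi n)) * ell
      ^+ (nu.-1 * i.+1).
Proof.
move=> nu0 n0 hyp; rewrite (zeta_coef nu0 n0 (jet_ord_gens n fs)); first last.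
- case: hyp => [|hyp]; [by left|right=> phi /arcs0_ordge [_ o2] h o1].
  by apply: (ord_gens_ordge _ _ o1 o2 _ h) => // u /hyp; nia.
- by move=> phi a0; exact: ord_ideal_gen.
apply: eq_bigr => i _; rewrite -mulr_suml measure_ford2; last by apply: jetI;
  [exact: jet_ord_gens|exact: jet_ford1].
congr (_ * _); apply: eq_bigr => j _; congr motmeas; apply/seteqP; split=> phi.
  by move=> [_ [[h [o1 c1]] [o2 c2]]]; split.
move=> [[o1 o2 c1 c2] h]; split=> //; apply/arcs0_ordge; split=> m m0; [apply: o1|apply: o2]; lia.
Qed.

End ZetaCoefficient.

Lemma sum_ord_widen (A : nmodType) m m' (F : nat -> A) : (m <= m')%N -> (forall a, (m <= a)%N ->
  F a = 0) ->
  \sum_(a < m') F a = \sum_(a < m) F a.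
Proof.
move=> mm F0; rewrite [RHS](big_ord_widen m' F) // [RHS]big_mkcond /=; apply: eq_bigr => a _.
by case: ltnP => // ma; rewrite F0.
Qed.

(** * Cells on the ray of a compact face *)

Section RayCells.
Variables (k : fieldType) (fs : seq (fps2 k)) (S : face) (v w : nat * nat).
Local Notation ell := (cinv (Lloc k)).
Local Notation A := (gen_supp fs).
Local Notation Q := (fun n (phi : arc k) => ord_gens [set` fs] phi n).
Hypothesis eS : edge A v w S.
Local Notation p := (fp S).
Local Notation q := (fq S).
Let pq : (0 < p)%N /\ (0 < q)%N.
Proof. by have [g []] := edge_params eS. Qed.

Lemma edge_N_bounds : (p <= fN S)%N /\ (q <= fN S)%N.
Proof.
have [g [g0 e1 e2 [pp qq] co]] := edge_params eS; rewrite (edge_N eS).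
by have := edge_lt1 eS; split; nia.
Qed.

Variable rs : seq k.
Hypotheses (urs : uniq rs) (rsP : forall mu, mu \in rs <-> face_roots fs S mu).
Hypothesis p0 : (p%:R : k) != 0.
Hypothesis pe : (p * (newton_exps p q).1 = q * (newton_exps p q).2 + 1)%N.
Variable n : nat.

Definition no_root i j (phi : arc k) := forall l : 'I_(size rs), coef phi.2 j ^+ p <> nth 0 rs l
  * coef phi.1 i ^+ q.

Lemma measure_roots P i j : (i <= n)%N -> (j <= n)%N -> (0 < i)%N -> (0 < j)%N -> jet_prop n P ->
  motmeas (cell true true i j `&` P) =
  motmeas (cell true true i j `&` P `&` no_root i j) + \sum_(mu <- rs) motmeas (root_cell p q mu
    i j `&` P).
Proof.
(* Index 0 stands for no root, index l + 1 for the root number l. Requiring the leading coefficient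
   of x to be nonzero makes the pieces disjoint even outside the cell. *)
move=> iN jN i0 j0 hP; pose E (l : 'I_(size rs).+1) (phi : arc k) :=
  if nat_of_ord l is l'.+1 then coef phi.1 i <> 0 /\ coef phi.2 j ^+ p + - nth 0 rs l' * coef
    phi.1 i ^+ q = 0 else no_root i j phi.
have arcs phi : cell true true i j phi -> arcs0 phi.
  by move=> [o1 o2 _ _]; apply/arcs0_ordge; split=> m m0; [apply: o1|apply: o2]; lia.
have eqE (C : set (arc k)) (B : arc k -> Prop) : (forall phi, B phi -> cell true true i j phi) ->
  (forall phi, C phi <-> B phi) ->
    motmeas C = motmeas [set phi | arcs0 phi /\ B phi].
  by move=> h e; congr motmeas; apply/seteqP; split=> phi; [move/e => b; split=> //;
    exact/arcs/h|move=> [_ /e]].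
have jr mu : jet_fun n (fun phi => coef phi.2 j ^+ p + - mu * coef phi.1 i ^+ q).
  apply: jet_funD; first by apply/jet_funX/jet_coord2.
  by apply: jet_funM; [exact: jet_cst|apply/jet_funX/jet_coord1].
have subE (a b c : k) : (a + - b * c = 0) <-> a = b * c.
  by rewrite mulNr; split=> [/subr0_eq|->]; rewrite ?subrr.
have jE l : jet_prop n (E l).
  case: l => -[|l] hl; last by apply: jetI; [apply/jet_neq0/jet_coord1|apply/jet_eq0/jr].
  rewrite /E /=; apply: (@jet_ext _ _ (fun phi => forall l : 'I_(size rs), coef phi.2 j ^+ p + -
    nth 0 rs l * coef phi.1 i ^+ q <> 0)).
    by move=> phi; split=> h l /subE; exact: h.
  by apply: jet_all => l; apply/jet_neq0/jr.
have jc : jet_prop n (@cell k true true i j) by apply: jet_cell; lia.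
rewrite (eqE _ (fun phi => cell true true i j phi /\ P phi)); [|by move=> phi []|by []].
rewrite (measure_partition (jetI jc hP) jE).
- rewrite big_ord_recl (eqE (_ `&` _ `&` _) (fun phi => (cell true true i j phi /\ P phi) /\
  no_root i j phi)); [|by move=> phi [[]]|by []].
  congr (_ + _); rewrite (big_nth 0) big_mkord; apply: eq_bigr => l _.
  rewrite (eqE (_ `&` _) (fun phi => (cell true true i j phi /\ P phi) /\ E (fintype.lift ord0 l)
    phi)) //.
    by move=> phi [[]].
  move=> phi; rewrite /E /=; split; first by move=> [[hc e] hp]; split=> //; split;
    [by case: hc => _ _ /(_ isT)|exact/subE].
  by move=> [[hc hp] [_ /subE e]]; split.
- move=> phi _ [[_ _ /(_ isT) x0 _] _]; case: (pselect (exists l : 'I_(size rs), coef phi.2 j ^+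
  p = nth 0 rs l * coef phi.1 i ^+ q)).
    by move=> [l e]; exists (fintype.lift ord0 l); rewrite /E /=; split=> //; exact/subE.
  by move=> ne; exists ord0 => l e; apply: ne; exists l.
move=> [[|l] hl] [[|l'] hl'] phi; rewrite /E /= => h h'; apply/val_inj => //=.
- by case: h' => _ /subE h'; case: (h (Ordinal (hl' : (l' < size rs)%N))).
- by case: h => _ /subE h; case: (h' (Ordinal (hl : (l < size rs)%N))).
case: h h' => /eqP x0 /subE -> [_ /subE e]; congr _.+1; apply/eqP.
by rewrite -(nth_uniq 0 _ _ urs) //; apply/eqP/(mulIf _ e); rewrite expf_neq0.
Qed.

(** The previous decomposition with the trivial condition: from a torus of class (L - 1)^2 each root
    removes a punctured line. *)
Lemma measure_no_root i j : (i <= n)%N -> (j <= n)%N -> (0 < i)%N -> (0 < j)%N ->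
  motmeas (cell true true i j `&` no_root i j) = ((Lloc k - 1) ^+ 2 - (size rs)%:R * (Lloc k -
    1)) * ell ^+ (i + j).
Proof.
move=> iN jN i0 j0; have := measure_roots iN jN i0 j0 (jet_true k n true).
have eT (B : set (arc k)) : B `&` (fun=> true) = B by apply/seteqP; split=> // phi [].
rewrite !eT => e; have [pp qq] := pq; move: e; rewrite (eq_big_seq (fun=> (Lloc k - 1) * ell ^+
  (i + j))); last first.
  by move=> mu /rsP [mu0 _]; rewrite eT motmeas_root_cell.
rewrite big_const_seq count_predT iter_addr addr0 => e.
have {e} -> : motmeas (cell true true i j `&` no_root i j) = motmeas (@cell k true true i j) -
  (Lloc k - 1) * ell ^+ (i + j) *+ size rs.
  by rewrite e addrK.
case: i j iN jN i0 j0 => // i [//|j] _ _ _ _; rewrite motmeas_cell /= !addn1 [RHS]mulrBl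
  -mulr_natl mulrA //.
Qed.

Lemma coef_ray t x y (f : fps2 k) : (0 < t)%N -> f \in fs -> ordge (p * t) x -> ordge (q * t) y ->
  ordge (fN S * t) (ev x y f) /\
  coef (ev x y f) (fN S * t) = ev2 (coef x (p * t)) (coef y (q * t)) (initial S f).
Proof.
move=> t0 ff hx hy; have [pp qq] := pq.
have sup u : supp f u -> (fN S * t <= p * t * u.1 + q * t * u.2)%N.
  by move=> hu; have := edge_sup eS (ex_intro2 _ _ f ff hu); nia.
have pt : (0 < p * t)%N by rewrite muln_gt0 pp.
have qt : (0 < q * t)%N by rewrite muln_gt0 qq.
have [h ->] := lead_ev pt qt hx hy sup; split=> //.
have e a b : (p * t * a + q * t * b == fN S * t)%N = (p * a + q * b == fN S)%N.
  by rewrite -[RHS](eqn_pmul2r t0) mulnDl; congr (_ == _); ring.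
have ab a b : (p * a + q * b == fN S)%N -> (a < (fN S).+1)%N /\ (b < (fN S).+1)%N by move=> /eqP;
  split; nia.
pose X := coef x (p * t); pose Y := coef y (q * t).
pose F a b := if (p * a + q * b == fN S)%N then coef (coef f a) b * (X ^+ a * Y ^+ b) else 0.
transitivity (\sum_(a < (fN S).+1) \sum_(b < (fN S).+1) F a b).
  have NN : (fN S < (fN S * t).+1)%N by rewrite ltnS leq_pmulr.
  rewrite -(sum_ord_widen (F := fun a => \sum_(b < (fN S).+1) F a b) NN); last first.
    by move=> a ha; apply: big1 => b _; rewrite /F; case: ifP => // /ab [h1 _]; lia.
  apply: eq_bigr => a _; rewrite -(sum_ord_widen (F := F a) NN); last first.
    by move=> b hb; rewrite /F; case: ifP => // /ab [_ h1]; lia.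
  by rewrite big_mkcond; apply: eq_bigr => b _; rewrite e.
rewrite /initial /ev2.
have eS2 (J : Type) (r : seq J) (C : pred J) (G : J -> {poly {poly k}}) : ev2 X Y (\sum_(j <- r |
  C j) G j) = \sum_(j <- r | C j) ev2 X Y (G j).
  by apply: (big_morph _ (ev2D X Y) (ev20 X Y)).
rewrite -/(ev2 X Y _) eS2; apply: eq_bigr => a _; rewrite eS2 [RHS]big_mkcond;
  apply: eq_bigr => b _.
by rewrite /F; case: ifP => // _; rewrite ev2_mono.
Qed.

(** Away from the roots some initial form is nonzero at the leading coefficients, so the order is
    exactly N t. *)
Lemma ray_cell t : (0 < t)%N -> (fN S * t <= n)%N ->
  motmeas (cell true true (p * t) (q * t) `&` Q n) =
  \sum_(mu <- rs) motmeas (root_cell p q mu (p * t) (q * t) `&` Q n) +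
  if (fN S * t == n)%N then ((Lloc k - 1) ^+ 2 - (size rs)%:R * (Lloc k - 1)) * ell ^+ (p * t + q
    * t) else 0.
Proof.
move=> t0 tn; have [pp qq] := pq; have [b1 b2] := edge_N_bounds.
have pn : (p * t <= n)%N by nia.
have qn : (q * t <= n)%N by nia.
have pt : (0 < p * t)%N by rewrite muln_gt0 pp.
have qt : (0 < q * t)%N by rewrite muln_gt0 qq.
rewrite measure_roots //; last exact: jet_ord_gens.
rewrite addrC; congr (_ + _).
have nz (phi : arc k) : cell true true (p * t) (q * t) phi -> no_root (p * t) (q * t) phi ->
    exists2 f, f \in fs & coef (ev phi.1 phi.2 f) (fN S * t) <> 0.
  move=> [o1 o2 /(_ isT) /eqP x0 /(_ isT) /eqP y0] nr.
  have : ~ face_roots fs S (coef phi.2 (q * t) ^+ p / coef phi.1 (p * t) ^+ q).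
    move/rsP => hm; apply: (nr (Ordinal (_ : index _ rs < size rs)%N));
      first by rewrite index_mem; exact: hm.
    by move=> hl /=; rewrite nth_index // divfK // expf_neq0.
  move=> h; apply: contrapT => none; apply: h; apply/(face_rootsP eS x0 y0) => f ff.
  have [_ <-] := coef_ray t0 ff o1 o2.
  by apply: contrapT => nz; apply: none; exists f.
have oN (phi : arc k) f : cell true true (p * t) (q * t) phi -> f \in fs -> ordge (fN S * t) (ev
  phi.1 phi.2 f).
  by move=> [o1 o2 _ _] ff; have [] := coef_ray t0 ff o1 o2.
case: eqP => e.
  rewrite -measure_no_root //; congr motmeas; apply/seteqP; split=> phi; first by move=> [[]].
  move=> [hc hr]; split=> //; split=> //; rewrite -e; split; last exact: nz.
  by move=> f /=; exact: oN.
rewrite (_ : _ `&` _ = set0) ?motmeas_set0 //; apply/seteqP; split=> // phi [[hc [ge _]] hr].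
by have [f ff] := nz _ hc hr; apply; apply: ge => //; lia.
Qed.

Lemma narc_ordge i mu (phi : arc k) : ordge i phi.1 -> ordge (p * i) (narc p q mu phi).1 /\ ordge
  (q * i) (narc p q mu phi).2.
Proof.
move=> o; have z g : ordge 0 (g : fps k) by [].
have [h1 _] := lead_exp p o; have [h2 _] := lead_exp q o; rewrite /narc /=; split.
  by have [h _] := lead_mul (z (fps_term (mu ^+ (newton_exps p q).2) 0)) h1; rewrite mulnC.
by have [h _] := lead_mul h2 (z (phi.2 + fps_term (mu ^+ (newton_exps p q).1) 0));
  rewrite mulnC -[X in ordge X]addn0.
Qed.

Lemma narc_high t mu (phi : arc k) : (0 < t)%N -> (n < fN S * t)%N -> ordge t phi.1 -> ~ Q n
  (narc p q mu phi).
Proof.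
move=> t0 nt o [_ [f /= ff]]; apply; have [h1 h2] := narc_ordge mu o.
by have [h _] := coef_ray t0 ff h1 h2; exact: h.
Qed.

(** The weight (nu - 1) p t of the form and the Jacobian (p + q - 1) t add up to (p nu + q - 1) t,
    the order of omega_1. *)
Lemma root_cell_newton nu mu t : (0 < nu)%N -> mu \in rs -> (0 < t <= n)%N ->
  (if (fN S * t <= n)%N then motmeas (root_cell p q mu (p * t) (q * t) `&` Q n) * ell ^+ (nu.-1 *
    (p * t)) else 0) =
  motmeas [set phi | arcs0 phi /\ (Q n (narc p q mu phi) /\ ford n t phi.1)] * ell ^+ ((p * nu +
    q).-1 * t).
Proof.
move=> nu0 /rsP [mu0 _] /andP[t0 tn]; have [pp qq] := pq; case: leqP => h; last first.
  rewrite (_ : [set _ | _] = set0) ?motmeas_set0 ?mul0r //; apply/seteqP;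
    split=> // phi [_ [hQ [o _]]].
  exact: (narc_high t0 h o hQ).
have [jc jl] := jet_ord_gens n fs.
rewrite (motmeas_newton p0 pp qq mu0 pe jc jl t0) -mulrA -exprD; congr (motmeas _ * _ ^+ _).
  apply/seteqP; split=> phi; first by move=> [[a0 o c] hQ]; split.
  by move=> [a0 [hQ [o c]]]; split=> //; split=> //; exact: c.
case: nu nu0 => // nu' _ /=; have -> : (p * nu'.+1 + q).-1 = ((p + q).-1 + nu' * p)%N by rewrite
  mulnS (mulnC nu'); lia.
by rewrite mulnDl mulnA.
Qed.

(** If x1 had order above n, the order along the ideal would be at least N (n + 1) > n; so the last
    cell is empty, as the positive exponent of omega_1 requires. *)
Lemma zeta_newton nu mu : (0 < nu)%N -> (0 < n)%N -> mu \in rs ->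
  coef (zeta (newton_ideal (ideal_gen [set` fs]) p q mu) (p * nu + q)) n =
  \sum_(t < n) if (fN S * t.+1 <= n)%N then motmeas (root_cell p q mu (p * t.+1) (q * t.+1) `&` Q
    n) * ell ^+ (nu.-1 * (p * t.+1)) else 0.
Proof.
move=> nu0 n0 hmu; have [pp qq] := pq; have [b1 _] := edge_N_bounds.
have high phi : arcs0 phi -> Q n (narc p q mu phi) -> ~ ordge n.+1 phi.1.
  by move=> _ hQ o; apply: (narc_high _ _ o hQ); nia.
rewrite (zeta_coef (P := fun phi => Q n (narc p q mu phi))) //; first last.
- by right.
- move=> phi a0; rewrite ord_newton //; apply: ord_ideal_gen.
  have /arcs0_ordge [o1 _] := a0; have [h1 h2] := narc_ordge mu o1.
  by apply/arcs0_ordge; split=> m m0; [apply: h1|apply: h2]; lia.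
- exact: (@jet_narc k n p q mu (Q n) (jet_ord_gens n fs)).
- by lia.
rewrite big_ord_recr /= [X in _ + X * _](_ : _ = 0) ?mul0r ?addr0; last first.
  rewrite (_ : [set _ | _] = set0) ?motmeas_set0 //; apply/seteqP; split=> // phi [a0 [hQ [o _]]].
  exact: high a0 hQ o.
by apply: eq_bigr => t _; rewrite root_cell_newton //=.
Qed.

Lemma ray_sum nu : (0 < nu)%N -> (0 < n)%N ->
  \sum_(t < n) (if (fN S * t.+1 <= n)%N then motmeas (cell true true (p * t.+1) (q * t.+1) `&` Q
    n) * ell ^+ (nu.-1 * (p * t.+1)) else 0) =
  \sum_(mu <- rs) coef (zeta (newton_ideal (ideal_gen [set` fs]) p q mu) (p * nu + q)) n +
  if (fN S %| n)%N then ((Lloc k - 1) * (Lloc k - (size rs)%:R - 1)) * ell ^+ ((p * nu + q) * (n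
    %/ fN S)) else 0.
Proof.
move=> nu0 n0; have [b1 _] := edge_N_bounds; have [pp qq] := pq; have N0 : (0 < fN S)%N by lia.
have -> : \sum_(mu <- rs) coef (zeta (newton_ideal (ideal_gen [set` fs]) p q mu) (p * nu + q)) n =
    \sum_(t < n) \sum_(mu <- rs) if (fN S * t.+1 <= n)%N then motmeas (root_cell p q mu (p *
      t.+1) (q * t.+1) `&` Q n) * ell ^+ (nu.-1 * (p * t.+1)) else 0.
  by rewrite exchange_big; apply: eq_big_seq => mu hmu; exact: zeta_newton.
set R := (Lloc k - 1) * _.
have RE : R = (Lloc k - 1) ^+ 2 - (size rs)%:R * (Lloc k - 1) by rewrite /R; ring.
have <- : \sum_(t < n) (if (fN S * t.+1 == n)%N then R * ell ^+ ((p * nu + q) * t.+1) else 0) =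
    if (fN S %| n)%N then R * ell ^+ ((p * nu + q) * (n %/ fN S)) else 0.
  case: ifP => [/dvdnP [d e]|/negP nd]; last first.
    by apply: big1 => t _; case: eqP => // e; case: nd; rewrite -e dvdn_mulr.
  have d0 : (0 < d)%N by case: d e => // e; move: n0; rewrite e.
  have dn : (d.-1 < n)%N by rewrite e; nia.
  have ed : (n %/ fN S)%N = d by rewrite e mulnK.
  have en m : (fN S * m == n)%N = (m == d) by rewrite e [(d * _)%N]mulnC eqn_pmul2l.
  rewrite ed (bigD1 (Ordinal dn)) //= en prednK // eqxx big1 ?addr0 // => t ne.
  by rewrite en ifN //; apply: contra ne => /eqP td; apply/eqP/val_inj; rewrite /= -td.
rewrite -big_split; apply: eq_bigr => t _ /=; case: leqP => h; last first.
  by rewrite big1 ?add0r // ifN //; lia.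
rewrite ray_cell // mulrDl mulr_suml -RE; congr (_ + _); case: eqP => _; last by rewrite mul0r.
rewrite -mulrA -exprD; congr (_ * _ ^+ _).
by case: nu nu0 => // nu' _ /=; rewrite mulnS; nia.
Qed.

End RayCells.

(** Telescoping along the chain of vertices: T F stands for everything beyond F, and splits into the
    cone up to the next face, the ray of that face, and what lies beyond it. *)
Lemma hull_sum (V : nmodType) A (G : face -> face -> nat * nat -> V) (H T : face -> V) :
  (forall F v, corner A F (Face 0 1 v.2) v -> G F (Face 0 1 v.2) v = T F) ->
  (forall F v w, (v.1 < w.1)%N -> (w.2 < v.2)%N -> corner A F (compact_face v w) v ->
     G F (compact_face v w) v + (H (compact_face v w) + T (compact_face v w)) = T F) ->
  forall F v vs, hull_from A F v vs ->
  let Fs := F :: rcons (compact_faces (v :: vs)) (Face 0 1 (last v vs).2) in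
  \sum_(i < size (v :: vs)) G (nth (Face 0 0 0) Fs i) (nth (Face 0 0 0) Fs i.+1) (nth (0, 0)%N (v
    :: vs) i) +
  \sum_(S <- compact_faces (v :: vs)) H S = T F.
Proof.
move=> h1 h2 F v vs; elim: vs F v => [|w vs IH] F v.
  by move=> c; rewrite /= big_ord1 /= big_nil addr0 h1.
move=> [vw1 vw2 c hw]; rewrite compact_faces_cons big_cons -[size _]/(size (w :: vs)).+1; cbv zeta.
rewrite big_ord_recl -(h2 _ _ _ vw1 vw2 c) -(IH _ _ hw) -!addrA; congr (_ + _).
by rewrite addrCA.
Qed.

(** Bezout coefficients within the required bounds exist, so the default (0, 0) is not taken. *)
Lemma newton_exps_spec p q : (0 < p)%N -> (0 < q)%N -> coprime p q ->
  (p * (newton_exps p q).1 = q * (newton_exps p q).2 + 1)%N.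
Proof.
move=> p0 q0 co; rewrite /newton_exps; case: xgetP => [e -> [] //|none]; exfalso.
case: (egcdnP q p0) => km kn; rewrite (eqP co : gcdn p q = 1%N) muln1 => e lt.
by apply: (none (km, kn)); split=> /=; [rewrite mulnC e mulnC|nia|].
Qed.

(** * Summation over all cones and rays *)

Section Assembly.
Variables (k : fieldType) (fs : seq (fps2 k)) (nu n : nat).
Hypothesis char0 : forall m, (0 < m)%N -> (m%:R : k) != 0.
Hypotheses (nu0 : (0 < nu)%N) (n0 : (0 < n)%N).
Local Notation ell := (cinv (Lloc k)).
Local Notation A := (gen_supp fs).
Local Notation Q := (fun (phi : arc k) => ord_gens [set` fs] phi n).

Definition cell_weight i j := motmeas (cell (i <= n)%N (j <= n)%N i j `&` Q) * ell ^+ (nu.-1 * i).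

Definition sum_on (C : nat -> nat -> bool) := \sum_(i < n.+1) \sum_(j < n.+1) if C i.+1 j.+1 then
  cell_weight i.+1 j.+1 else 0.

(** Sums over an open cone, over a ray, and over all cells beyond the ray of a face. For the
    vertical face the last is the sum of all cells, as i * 0 < j; for the horizontal face it is
    0. *)
Let G F1 F2 (v : nat * nat) := sum_on (cone (fp F1) (fq F1) (fp F2) (fq F2)).
Let H S := sum_on (fun i j => (i * fq S == j * fp S)%N).
Let T F := sum_on (fun i j => (i * fq F < j * fp F)%N).

Lemma cells_sum v vs : hull_from A (Face 1 0 v.1) v vs ->
  let Fs := faces (v :: vs) in
  \sum_(i < size (v :: vs)) G (nth (Face 0 0 0) Fs i) (nth (Face 0 0 0) Fs i.+1) (nth (0, 0)%N (v
    :: vs) i) +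
  \sum_(S <- compact_faces (v :: vs)) H S = \sum_(i < n.+1) \sum_(j < n.+1) cell_weight i.+1 j.+1.
Proof.
move=> h; apply: (etrans (@hull_sum _ A G H T _ _ (Face 1 0 v.1) v vs h));
  last by apply: eq_bigr => i _; apply: eq_bigr => j _; rewrite muln0 muln1.
  by move=> F u _; apply: eq_bigr => i _; apply: eq_bigr => j _; rewrite /cone /= muln0 muln1.
move=> F u w uw1 uw2 c; have [g [_ _ _ [p0 q0] _]] := compact_faceP uw1 uw2; have := corner_det c.
move: (compact_face u w) p0 q0 => S p0 q0 det.
rewrite /G /H /T /sum_on -!big_split; apply: eq_bigr => i _; rewrite -!big_split;
  apply: eq_bigr => j _ /=.
rewrite /cone; case: (ltngtP (i.+1 * fq S)%N (j.+1 * fp S)%N) => h' /=; rewrite ?add0r ?addr0 //.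
- by rewrite ifT //; nia.
- by rewrite ifT //; nia.
Qed.

Lemma coef_cones v vs i : hull_from A (Face 1 0 v.1) v vs -> ~ A (0, 0)%N ->
  (nu = 1%N \/ forall u, A u -> (0 < u.1)%N) -> (i <= size vs)%N ->
  let Fs := faces (v :: vs) in
  coef (cone_term k nu (nth (Face 0 0 0) Fs i) (nth (Face 0 0 0) Fs i.+1) (nth (0, 0)%N (v :: vs)
    i)) n =
  toM (G (nth (Face 0 0 0) Fs i) (nth (Face 0 0 0) Fs i.+1) (nth (0, 0)%N (v :: vs) i)).
Proof.
move=> hh A0 hyp ivs Fs; have c : corner A (nth (Face 0 0 0) Fs i) (nth (Face 0 0 0) Fs i.+1)
  (nth (0, 0)%N (v :: vs) i) := hull_fromP hh ivs.
move: (nth _ Fs i) (nth _ Fs i.+1) (nth _ (v :: vs) i) c => F1 F2 u c {Fs hh ivs v vs}.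
have Au := corner_in c.
rewrite (coef_cone_term k n c) //; first last.
- by move=> u1; case: hyp => // /(_ _ Au); rewrite u1.
- by rewrite lt0n; apply/eqP => e; apply: A0; move: Au; have -> // : u = (0, 0)%N;
  case: u e {c hyp} => a b /= e; congr (_, _); lia.
congr toM; rewrite /G /sum_on /cone_weight big_ord_recl [X in X + _]big1 ?add0r => [|j _];
  last by [].
apply: eq_bigr => {}i _; rewrite big_ord_recl [X in X + _]ifN ?add0r;
  last by rewrite /cone /= ?mul0n ltn0 andbF.
apply: eq_bigr => j _; rewrite !lift0; case: (boolP (cone _ _ _ _ _ _)) => //= hc.
have iM : (0 < i.+1 <= n.+1)%N by case: i {hc}.
have jM : (0 < j.+1 <= n.+1)%N by case: j {hc}.
rewrite /cell_weight (cone_cell c iM jM hc).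
by case: eqP => _; rewrite ?mul0r // mulrAC.
Qed.

(** By coprimality the cells on the ray are the (p t, q t); those with N t > n contain no arc of
    order n along the ideal. *)
Lemma ray_reindex S v w : edge A v w S ->
  H S = \sum_(t < n) if (fN S * t.+1 <= n)%N then cell_weight (fp S * t.+1) (fq S * t.+1) else 0.
Proof.
move=> eS; have [g [g0 _ _ [p0 q0] co]] := edge_params eS; have [b1 b2] := edge_N_bounds eS.
pose K t i j := [&& (fN S * t.+1 <= n)%N, i.+1 == (fp S * t.+1)%N & j.+1 == (fq S * t.+1)%N].
transitivity (\sum_(i < n.+1) \sum_(j < n.+1) \sum_(t < n) if K t i j then cell_weight i.+1 j.+1
  else 0).
  apply: eq_bigr => i _; apply: eq_bigr => j _; case: eqP => e; last first.
    rewrite big1 // => t _; rewrite ifN //; apply/negP => /and3P[_ /eqP ei /eqP ej]; apply: e.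
    by rewrite ei ej; ring.
  have [t et] : exists t, i.+1 = (fp S * t)%N.
    have : (fp S %| i.+1)%N by rewrite -(Gauss_dvdl _ co) e dvdn_mull.
    by move=> /dvdnP [t ->]; exists t; rewrite mulnC.
  have ej : j.+1 = (fq S * t)%N by apply/eqP; rewrite -(eqn_pmul2r p0) -e et; apply/eqP; ring.
  case: t et ej => [|t] et ej; first by rewrite muln0 in et.
  case: (leqP (fN S * t.+1)%N n) => h; last first.
    rewrite big1 => [|s _]; last first.
      rewrite ifN //; apply/negP => /and3P[h' /eqP es _]; move: es; rewrite et => /eqP.
      by rewrite eqn_pmul2l // => /eqP es; move: h; rewrite es ltnNge h'.
    rewrite /cell_weight (_ : _ `&` _ = set0) ?motmeas_set0 ?mul0r //.
    apply/seteqP; split=> // phi [[o1 o2 _ _]]; apply: (ord_gens_ordge _ _ o1 o2) => // u Au.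
    by rewrite et ej; have := edge_sup eS Au; nia.
  have tn : (t < n)%N by nia.
  rewrite (bigD1 (Ordinal tn)) //= /K /= h et ej !eqxx big1 ?addr0 // => s ne.
  rewrite ifN //; apply: contra ne => /and3P[_ es _]; move: es; rewrite eqn_pmul2l // => /eqP [es].
  exact/eqP/val_inj.
under eq_bigr => i _ do rewrite exchange_big /=.
rewrite exchange_big /=; apply: eq_bigr => t _; case: leqP => h; last first.
  by apply: big1 => i _; apply: big1 => j _; rewrite /K leqNgt h.
have pt : (0 < fp S * t.+1)%N by rewrite muln_gt0 p0.
have qt : (0 < fq S * t.+1)%N by rewrite muln_gt0 q0.
have pn : ((fp S * t.+1).-1 < n.+1)%N by nia.
have qn : ((fq S * t.+1).-1 < n.+1)%N by nia.
rewrite (bigD1 (Ordinal pn)) //= (bigD1 (Ordinal qn)) //= /K h !prednK // !eqxx /= !big1 ?addr0 //.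
- move=> i ne; apply: big1 => j _; rewrite ifN //; apply: contra ne => /andP[/eqP e _].
  by apply/eqP/val_inj; rewrite /= -e.
- by move=> j ne; rewrite ifN //; apply: contra ne => /eqP e; apply/eqP/val_inj; rewrite /= -e.
Qed.

Lemma coef_rays S v w : edge A v w S ->
  toM (H S) =
  coef (face_term k nu #|` fset_set (face_roots fs S)| S) n +
  coef (\sum_(mu \in face_roots fs S)
    map_fps (@toM k) (zeta (newton_ideal (ideal_gen [set` fs]) (fp S) (fq S) mu) (fp S * nu + fq
      S))) n.
Proof.
move=> eS; have [g [_ _ _ [p0 q0] co]] := edge_params eS; have [b1 _] := edge_N_bounds eS.
have fin := face_roots_finite eS; pose rs : seq k := fset_set (face_roots fs S).
have rsP mu : mu \in rs <-> face_roots fs S mu by rewrite in_fset_set // in_setE.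
have pe := newton_exps_spec p0 q0 co.
rewrite coef_face_term //; last by lia.
rewrite fsbig_finite //= coef_sum (ray_reindex eS).
have -> : \sum_(t < n) (if (fN S * t.+1 <= n)%N then cell_weight (fp S * t.+1) (fq S * t.+1) else
  0) =
  \sum_(t < n) (if (fN S * t.+1 <= n)%N then motmeas (cell true true (fp S * t.+1) (fq S * t.+1)
    `&` Q) * ell ^+ (nu.-1 * (fp S * t.+1)) else 0).
  have [_ b2] := edge_N_bounds eS; apply: eq_bigr => t _; case: ifP => // h; rewrite /cell_weight.
  have -> : (fp S * t.+1 <= n)%N by nia.
  by have -> : (fq S * t.+1 <= n)%N by nia.
rewrite (ray_sum eS (fset_uniq _) rsP (char0 p0) pe nu0 n0) addrC /toM rmorphD rmorph_sum;
  congr (_ + _).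
by rewrite n0 andbT; case: ifP => _; [|exact: rmorph0].
Qed.

Lemma coef_zeta v vs : hull_from A (Face 1 0 v.1) v vs -> ~ A (0, 0)%N ->
  (nu = 1%N \/ forall u, A u -> (0 < u.1)%N) ->
  let Fs := faces (v :: vs) in
  toM (coef (zeta (ideal_gen [set` fs]) nu) n) =
  \sum_(i < size (v :: vs)) coef (cone_term k nu (nth (Face 0 0 0) Fs i) (nth (Face 0 0 0) Fs
    i.+1) (nth (0, 0)%N (v :: vs) i)) n
  + \sum_(S <- compact_faces (v :: vs)) coef (face_term k nu #|` fset_set (face_roots fs S)| S) n
  + \sum_(S <- compact_faces (v :: vs)) coef (\sum_(mu \in face_roots fs S)
      map_fps (@toM k) (zeta (newton_ideal (ideal_gen [set` fs]) (fp S) (fq S) mu) (fp S * nu +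
        fq S))) n.
Proof.
move=> hh A0 hyp Fs; rewrite zeta_coef_cells // -(cells_sum hh) /toM rmorphD !rmorph_sum -addrA;
  congr (_ + _).
  by apply: eq_bigr => i _; rewrite coef_cones // -ltnS.
rewrite -big_split /=; have he := hull_edge hh.
elim: (compact_faces (v :: vs)) he => [|S Ss IH] he; first by rewrite !big_nil.
rewrite !big_cons IH; last by move=> S' hS; apply: he; right.
by have [v' [w' eS]] := he S (or_introl erefl); rewrite -/(toM _) (coef_rays eS).
Qed.

End Assembly.

Lemma gen_supp_nonempty (k : fieldType) (fs : seq (fps2 k)) : ideal_gen [set` fs] <> [set 0] ->
  exists u, gen_supp fs u.
Proof.
move=> I0; apply: contrapT => none; apply: I0; apply/seteqP; split; last by move=> _ ->;
  exact: ideal_gen0.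
apply: smallest_sub.
  by split=> // a b; [move=> /= -> ->; rewrite addr0|move=> /= ->; rewrite mulr0].
move=> f ff; apply: fpsP => a; apply: fpsP => b; apply/eqP/negPn/negP => h.
by apply: none; exists (a, b); exists f.
Qed.

(** A generator with nonzero constant term is invertible; as series in x over k[[y]] are considered,
    its coefficient of x^0 is inverted before the series itself. *)
Lemma gen_supp_origin (k : fieldType) (fs : seq (fps2 k)) : ideal_gen [set` fs] <> [set: fps2 k]
  -> ~ gen_supp fs (0, 0)%N.
Proof.
move=> IT [f ff f0]; apply: IT; apply/seteqP; split=> // g _.
have c0 : coef (coef f 0) 0 != 0 := f0.
have [u u0] : exists u, u * coef f 0 = 1.
  have [u hu] : exists u, (fps_term (coef (coef f 0) 0)^-1 0 * coef f 0) * u = 1.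
    by apply: fps_unit; rewrite coef_cstM mulVf.
  by exists (fps_term (coef (coef f 0) 0)^-1 0 * u); rewrite mulrAC.
have [h hh] : exists h, (fps_term u 0 * f) * h = 1 by apply: fps_unit; rewrite coef_cstM.
have -> : g = (g * fps_term u 0 * h) * f by rewrite -[LHS]mulr1 -hh; ring.
by apply: ideal_gen_mul; exact: sub_ideal_gen.
Qed.

Lemma gen_supp_pos (k : fieldType) (fs : seq (fps2 k)) :
  (forall f, ideal_gen [set` fs] f -> exists g, f = fps_term 1 1 * g) -> forall u, gen_supp fs u
    -> (0 < u.1)%N.
Proof.
move=> h [[|a] b] // [f ff]; have [g ->] := h f (sub_ideal_gen (ff : [set` fs] f)).
have e : coef (fps_term 1 1 * g) 0 = 0 by rewrite coef_termM.
by move=> s; have : coef (coef (fps_term 1 1 * g) 0) b != 0 := s; rewrite e coef0 eqxx.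
Qed.

(** In the open cone i and j are positive, so i a + j b > 0. This matches the absence of a term T^0
    in the zeta function. *)
Lemma coef0_cone_term (k : fieldType) (A : set (nat * nat)) nu F1 F2 v : corner A F1 F2 v -> (0 <
  nu)%N -> (0 < v.1 + v.2)%N ->
  (v.1 = 0%N -> nu = 1%N) -> coef (cone_term k nu F1 F2 v) 0 = 0.
Proof.
move=> c nu0 v0 vnu; rewrite (coef_cone_term k 0 c) // /cone_weight /toM big1 ?rmorph0 // => i _;
  apply: big1 => j _.
case: ifP => // /andP[/andP[h1 h2] /eqP e]; exfalso.
have i0 : (0 < i)%N by rewrite lt0n; apply/eqP => i0; rewrite i0 in h1.
have j0 : (0 < j)%N by rewrite lt0n; apply/eqP => j0; rewrite j0 in h2.
nia.
Qed.

Lemma coef0_rays (k : fieldType) (fs : seq (fps2 k)) nu Ss (J : face -> k -> set (fps2 k)) (N :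
  face -> nat) (r : face -> nat) : (0 < nu)%N ->
  (forall S, List.In S Ss -> exists v w, edge (gen_supp fs) v w S) ->
  \sum_(S <- Ss) coef (face_term k nu (r S) S) 0 = 0 /\
  \sum_(S <- Ss) coef (\sum_(mu \in face_roots fs S) map_fps (@toM k) (zeta (J S mu) (N S))) 0 = 0.
Proof.
move=> nu0; elim: Ss => [|S Ss IH] he; first by rewrite !big_nil.
have [v [w eS]] := he S (or_introl erefl).
have [g [_ _ _ [p0 q0] _]] := edge_params eS; have [b1 _] := edge_N_bounds eS.
have [e1 e2] := IH (fun S' hS => he S' (or_intror hS)).
rewrite !big_cons e1 e2 !addr0; split.
  by rewrite coef_face_term ?andbF //; lia.
rewrite fsbig_finite; last exact: face_roots_finite eS.
by rewrite coef_sum big1 // => mu _; exact: rmorph0.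
Qed.

Lemma zeta_formula (k : fieldType) (fs : seq (fps2 k)) nu v vs : (forall m, (0 < m)%N -> (m%:R :
  k) != 0) -> (0 < nu)%N ->
  hull_from (gen_supp fs) (Face 1 0 v.1) v vs -> ~ gen_supp fs (0, 0)%N ->
  (nu = 1%N \/ forall u, gen_supp fs u -> (0 < u.1)%N) ->
  let F i := nth (Face 0 0 0) (faces (v :: vs)) i in
  map_fps (@toM k) (zeta (ideal_gen [set` fs]) nu) =
  \sum_(i < size (v :: vs)) cone_term k nu (F i) (F i.+1) (nth (0, 0)%N (v :: vs) i)
  + \sum_(S <- compact_faces (v :: vs)) face_term k nu #|` fset_set (face_roots fs S)| S
  + \sum_(S <- compact_faces (v :: vs)) \sum_(mu \in face_roots fs S)
      map_fps (@toM k) (zeta (newton_ideal (ideal_gen [set` fs]) (fp S) (fq S) mu) (fp S * nu +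
        fq S)).
Proof.
move=> char0 nu0 hh A0 hyp F; apply: fpsP => -[|n]; rewrite !coefD !coef_sum; last exact: coef_zeta.
transitivity (0 : Mloc k); first exact: rmorph0.
have [-> ->] := coef0_rays (fun S mu => newton_ideal (ideal_gen [set` fs]) (fp S) (fq S) mu) (fun
  S => fp S * nu + fq S)%N
  (fun S => #|` fset_set (face_roots fs S)|) nu0 (hull_edge hh).
rewrite !addr0 big1 // => i _.
have c : corner _ (F i) (F i.+1) (nth (0, 0)%N (v :: vs) i) := hull_fromP hh (ltn_ord i : (i <=
  size vs)%N).
have Au := corner_in c; apply: (coef0_cone_term _ c) => //.
- rewrite lt0n; apply/eqP => e; apply: A0; move: Au; case: (nth _ _ _) e => a b /= e.
  by have [-> ->] : a = 0%N /\ b = 0%N by lia.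
- by case: hyp => [//|/(_ _ Au)] h u1; rewrite u1 in h.
Qed.

Theorem theorem3p4 (R : realType) (I : set (fps2 R[i])) (fs : seq (fps2 R[i]))
    (nu : nat) :
  I = ideal_gen [set` fs] ->
  I <> [set 0] -> I <> [set: fps2 R[i]] ->
  (0 < nu)%N ->
  (~ (forall f, I f -> exists g, f = fps_term 1 1 * g) -> nu = 1%N) ->
  let vs := newton_vertices R fs in
  let F i := nth (Face 0 0 0) (faces vs) i in
  let r S := #|` fset_set (face_roots fs S) | in
  map_fps (@toM _) (zeta I nu) =
    \sum_(i < size vs) cone_term _ nu (F i) (F i.+1) (nth (0, 0)%N vs i)
    + \sum_(S <- compact_faces vs) face_term _ nu (r S) S
    + \sum_(S <- compact_faces vs) \sum_(mu \in face_roots fs S)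
        map_fps (@toM _) (zeta (newton_ideal I (fp S) (fq S) mu)
                               (fp S * nu + fq S)).
Proof.
move=> IE I0 IT nu0 hyp vs F r; rewrite IE in I0 IT hyp *.
have [v [ws hh]] := hull_start (gen_supp_nonempty I0).
have vsE : vs = v :: ws := newton_verticesE R hh.
rewrite {}/F {}/r; move: vs vsE => _ ->; apply: zeta_formula => //; last 2 first.
- exact: gen_supp_origin.
- case: (pselect (forall f, ideal_gen [set` fs] f -> exists g, f = fps_term 1 1 * g)) => [/gen_supp_pos|/hyp]; by [right|left].
- by move=> m m0; rewrite pnatr_eq0 -lt0n.
Qed.
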